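(* For every $q > 2$ there exists a compact set $K \subset \mathbb{T}$ of Hausdorff dimension $2/q$ such that: (1) $K$ supports a non-zero Schwartz distribution $S$ with $\widehat{S} \in \ell_q(\mathbb{Z})$; (2) $K$ does not support any non-zero finite complex Borel measure $\mu$ with $\widehat{\mu} \in \ell_q(\mathbb{Z})$.
   Context: $\mathbb{T} = \mathbb{R}/2\pi\mathbb{Z}$ is the circle. For a Schwartz distribution (or measure) $S$ on $\mathbb{T}$, $\widehat{S}(n)$, $n \in \mathbb{Z}$, denotes its Fourier coefficients. A compact set $K$ supports a distribution or measure if the support of the latter is contained in $K$. *)

(* Defs.v *)
From HB Require Import structures.
From mathcomp Require Import all_boot all_order all_algebra generic_quotient.
From mathcomp Require Import all_classical all_reals all_analysis.
From mathcomp Require Import complex ring.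

Set Implicit Arguments.
Unset Strict Implicit.
Unset Printing Implicit Defensive.

Import Order.TTheory GRing.Theory Num.Theory.
Import numFieldNormedType.Exports.

Local Open Scope classical_set_scope.
Local Open Scope ring_scope.
Local Open Scope complex_scope.
Local Open Scope quotient_scope.

(** ** The circle R / 2 pi Z *)

Section circle.
Variable R : realType.
Implicit Types x y z : R.

Definition eqmod2pi x y : bool := `[< exists k : int, x - y = k%:~R * (2 * pi) >].

Lemma eqmod2pi_refl : reflexive eqmod2pi.
Proof. by move=> x; apply/asboolP; exists 0; rewrite subrr mul0r. Qed.

Lemma eqmod2pi_sym : symmetric eqmod2pi.
Proof.
have sub x y : eqmod2pi x y -> eqmod2pi y x.
  move=> /asboolP[k xyk]; apply/asboolP; exists (- k).
  by rewrite intrN mulNr -xyk opprB.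
by move=> x y; apply/idP/idP; exact: sub.
Qed.

Lemma eqmod2pi_trans : transitive eqmod2pi.
Proof.
move=> y x z /asboolP[k xyk] /asboolP[l yzl]; apply/asboolP; exists (k + l).
by rewrite intrD mulrDl -xyk -yzl addrA subrK.
Qed.

Canonical eqmod2pi_equiv :=
  EquivRel eqmod2pi eqmod2pi_refl eqmod2pi_sym eqmod2pi_trans.

Definition circle : Type := {eq_quot eqmod2pi}.

HB.instance Definition _ := Choice.on circle.
HB.instance Definition _ := Quotient.on circle.
HB.instance Definition _ := isPointed.Build circle (\pi_circle 0).

Lemma eq_circleP x y :
  \pi_circle x = \pi_circle y <-> exists k : int, x - y = k%:~R * (2 * pi).
Proof.
split=> [/eqP|xy]; first by rewrite eqmodE => /asboolP.
by apply/eqP; rewrite eqmodE; apply/asboolP.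
Qed.

Lemma repr_circleP x :
  exists k : int, repr (\pi_circle x) - x = k%:~R * (2 * pi).
Proof. by apply/eq_circleP; rewrite reprK. Qed.

(** The quotient metric (arc length along the shorter arc). *)
Definition circle_dist (u v : circle) : R :=
  inf [set `|repr u - repr v + k%:~R * (2 * pi)| | k in [set: int]].

Lemma circle_distE x y : circle_dist (\pi x) (\pi y) =
  inf [set `|x - y + k%:~R * (2 * pi)| | k in [set: int]].
Proof.
rewrite /circle_dist; have [k Hk] := repr_circleP x.
have [l Hl] := repr_circleP y.
have E : repr (\pi_circle x) - repr (\pi_circle y) =
    x - y + (k - l)%:~R * (2 * pi).
  by rewrite intrB mulrBl -Hk -Hl; ring.
rewrite E; congr inf; apply/seteqP; split => [_ [m _ <-]|_ [m _ <-]] /=.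
  by exists (k - l + m) => //; rewrite intrD mulrDl addrA.
by exists (m - (k - l)) => //; rewrite -addrA -mulrDl -intrD subrKC.
Qed.

Let dists (u v : circle) := [set `|repr u - repr v + k%:~R * (2 * pi)| | k in [set: int]].

Let dists_inf (u v : circle) : has_inf (dists u v).
Proof.
by split; [exists `|repr u - repr v + 0%:~R * (2 * pi)|, 0
          | exists 0 => _ [k _ <-]].
Qed.

Let le_dist u v (k : int) :
  circle_dist u v <= `|repr u - repr v + k%:~R * (2 * pi)|.
Proof. by apply: ge_inf; [case: (dists_inf u v)|exists k]. Qed.

Let dist_lt u v e : 0 < e ->
  exists k : int, `|repr u - repr v + k%:~R * (2 * pi)| < circle_dist u v + e.
Proof.
by move=> e0; have [_ [k _ <-] ?] := inf_adherent e0 (dists_inf u v); exists k.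
Qed.

Let dist_ge0 u v : 0 <= circle_dist u v.
Proof. by apply: lb_le_inf; [case: (dists_inf u v)|move=> _ [k _ <-]]. Qed.

Lemma circle_distxx u : circle_dist u u = 0.
Proof.
apply/eqP; rewrite eq_le dist_ge0 andbT.
by apply: (le_trans (le_dist u u 0)); rewrite subrr mul0r addr0 normr0.
Qed.

Lemma circle_dist_sym u v : circle_dist u v = circle_dist v u.
Proof.
have sub a b : circle_dist a b <= circle_dist b a.
  apply/ler_addgt0Pr => e e0; have [k /ltW] := dist_lt b a e0; apply: le_trans.
  apply: (le_trans (le_dist a b (- k))).
  by rewrite -normrN intrN mulNr opprD opprB opprK.
by apply/eqP; rewrite eq_le !sub.
Qed.

Lemma circle_dist_triangle v u w :
  circle_dist u w <= circle_dist u v + circle_dist v w.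
Proof.
apply/ler_addgt0Pr => e e0.
have e20 : 0 < e / 2 by rewrite divr_gt0.
have [k uv] := dist_lt u v e20; have [l vw] := dist_lt v w e20.
rewrite [e]splitr addrACA; apply: ltW; apply: le_lt_trans (ltrD uv vw).
apply: le_trans (ler_normD _ _); apply: (le_trans (le_dist u w (k + l))).
by rewrite addrACA subrKA intrD mulrDl.
Qed.

Lemma circle_dist_eq0 u v : circle_dist u v = 0 -> u = v.
Proof.
move=> uv0; have pi0 : 0 < pi :> R by exact: pi_gt0.
have [k] := dist_lt u v pi0; rewrite uv0 add0r => kpi.
have [E|N] := eqVneq (repr u - repr v + k%:~R * (2 * pi)) 0.
  rewrite -[u]reprK -[v]reprK; apply/eq_circleP; exists (- k).
  by rewrite intrN mulNr; apply/eqP; rewrite -addr_eq0 E.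
have [l] := dist_lt u v (etrans (normr_gt0 _) N : 0 < `|_|).
rewrite uv0 add0r => lt_lk.
have lpi := lt_trans lt_lk kpi.
have : `|(l - k)%:~R * (2 * pi)| < 2 * pi :> R.
  rewrite [X in _ < X]mulrDl mul1r.
  have -> : (l - k)%:~R * (2 * pi) = (repr u - repr v + l%:~R * (2 * pi))
      - (repr u - repr v + k%:~R * (2 * pi)) :> R.
    by rewrite intrB mulrBl opprD addrACA subrr add0r.
  by apply: le_lt_trans (ler_normB _ _) _; exact: ltrD.
have pi20 : 0 < 2 * pi :> R by rewrite mulr_gt0.
rewrite normrM (gtr0_norm pi20) gtr_pMl// -intr_norm -[1]/(1%:~R) ltr_int.
rewrite -[1]add0r ltzD1 normr_le0 subr_eq0 => /eqP lk.
by move: lt_lk; rewrite lk ltxx.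
Qed.

HB.instance Definition _ := isMetric.Build R circle
  circle_distxx circle_dist_eq0 circle_dist_sym circle_dist_triangle.

Definition circle_borel := g_sigma_algebraType (@open circle).

End circle.

(** The character t |-> exp (- i n t). *)
Definition circle_exp (R : realType) (n : int) (u : circle R) : R[i] :=
  cos (n%:~R * repr u) -i* sin (n%:~R * repr u).

Lemma cos_sin_period (R : realType) (m : int) (x : R) :
  cos (x + m%:~R * (2 * pi)) = cos x /\ sin (x + m%:~R * (2 * pi)) = sin x.
Proof.
have N (n : nat) y : cos (y + n%:R * (2 * pi)) = cos y /\
                     sin (y + n%:R * (2 * pi)) = sin y :> R.
  elim: n y => [|n IH] y; first by rewrite mul0r addr0.
  have -> : y + n.+1%:R * (2 * pi) = y + n%:R * (2 * pi) + pi *+ 2.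
    by rewrite -natr1 mulrDl mul1r addrA [2 * _]mulr_natl.
  by rewrite cosD2pi sinD2pi.
case: m => n; first exact: N.
have [cE sE] := N n.+1 (x + (Negz n)%:~R * (2 * pi)).
by move: cE sE; rewrite NegzE intrN mulNr subrK => -> ->.
Qed.

Lemma circle_expE (R : realType) (n : int) (x : R) :
  circle_exp n (\pi x) = cos (n%:~R * x) -i* sin (n%:~R * x).
Proof.
rewrite /circle_exp; have [k /eqP] := repr_circleP x.
rewrite subr_eq => /eqP ->; rewrite addrC mulrDr mulrA -intrM.
by have [-> ->] := cos_sin_period (n * k) (n%:~R * x).
Qed.

(** ** Schwartz distributions on the circle *)

Section schwartz.
Variable R : realType.
Implicit Types (phi : circle R -> R[i]) (k : nat) (x : R).

Definition lift_Re phi x : R := complex.Re (phi (\pi x)).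
Definition lift_Im phi x : R := complex.Im (phi (\pi x)).

Definition test_function phi := forall k x,
  derivable (derive1n k (lift_Re phi)) x 1 /\
  derivable (derive1n k (lift_Im phi)) x 1.

(** The supremum norm of the k-th derivative; for a test function the set is
    bounded, so that this real supremum is the usual one. *)
Definition seminorm k phi : R :=
  sup [set Normc.normc (derive1n k (lift_Re phi) x +i* derive1n k (lift_Im phi) x)
      | x in [set: R]].

(** Only the values at test functions are meaningful. *)
Record schwartz := Schwartz {
  pairing :> (circle R -> R[i]) -> R[i] ;
  schwartz_linear : forall (a : R[i]) phi psi,
    test_function phi -> test_function psi ->
    pairing (fun u => a * phi u + psi u) = a * pairing phi + pairing psi ;
  schwartz_continuous : exists (C : R) (N : nat), forall phi,
    test_function phi ->
    Normc.normc (pairing phi) <= C * \sum_(k < N.+1) seminorm k phi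
}.

Definition schwartz_nonzero (S : schwartz) :=
  exists2 phi, test_function phi & S phi != 0.

Definition schwartz_null_on (S : schwartz) (U : set (circle R)) :=
  forall phi, test_function phi -> closure [set u | phi u != 0] `<=` U ->
    S phi = 0.

Definition schwartz_support (S : schwartz) : set (circle R) :=
  ~` \bigcup_(U in [set U | open U /\ schwartz_null_on S U]) U.

(** A measure acts by phi |-> the integral of phi, so that there is no factor
    1 / (2 pi) here or in [measure_fourier]. *)
Definition schwartz_fourier (S : schwartz) (n : int) : R[i] :=
  S (circle_exp n).

End schwartz.

(** ** Finite complex Borel measures on the circle *)

(** Integral against a signed measure, through its Jordan decomposition; by
    [Hahn_decomposition_uniq] the chosen Hahn decomposition is irrelevant. *)
Section charge_integral.
Context d (T : measurableType d) (R : realType).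
Variable nu : {charge set T -> \bar R}.

Lemma hahn_pair : exists PN, hahn_decomposition nu PN.1 PN.2.
Proof. by have [P [N PN]] := Hahn_decomposition nu; exists (P, N). Qed.

Let nuPN := projT2 (cid hahn_pair).

Definition charge_integral (f : T -> R) : R :=
  \int[jordan_pos nuPN]_x f x - \int[jordan_neg nuPN]_x f x.

Definition charge_integralC (f : T -> R[i]) : R[i] :=
  charge_integral (fun x => complex.Re (f x))
  +i* charge_integral (fun x => complex.Im (f x)).

End charge_integral.

Section complex_measure.
Variable R : realType.

(** Charges are finite-valued; the measure is [measure_Re + i measure_Im]. *)
Record complex_measure := ComplexMeasure {
  measure_Re : {charge set (circle_borel R) -> \bar R} ;
  measure_Im : {charge set (circle_borel R) -> \bar R}
}.

Implicit Types (mu : complex_measure) (A U : set (circle_borel R)).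

Definition measure_value mu A : R[i] :=
  fine (measure_Re mu A) +i* fine (measure_Im mu A).

Definition measure_nonzero mu :=
  exists2 A, measurable A & measure_value mu A != 0.

(** Equivalently, the total variation of [mu] vanishes on [U]. *)
Definition measure_null_on mu U :=
  forall A, measurable A -> A `<=` U -> measure_value mu A = 0.

Definition measure_support mu : set (circle R) :=
  ~` \bigcup_(U in [set U : set (circle R) | open U /\ measure_null_on mu U]) U.

Definition complex_integral mu (f : circle R -> R[i]) : R[i] :=
  charge_integralC (measure_Re mu) f + (0 +i* 1) * charge_integralC (measure_Im mu) f.

Definition measure_fourier mu (n : int) : R[i] :=
  complex_integral mu (circle_exp n).

End complex_measure.

Definition in_lq (R : realType) (q : R) (c : int -> R[i]) : Prop :=
  (\esum_(n in [set: int]) (Normc.normc (c n) `^ q)%:E < +oo)%E.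

(** ** Hausdorff dimension *)

Section hausdorff.
Context (R : realType) (T : metricType R).
Implicit Types (A E : set T) (s delta : R).
Local Open Scope ereal_scope.

(** The added 0 only serves to make the diameter of [set0] equal to 0. *)
Definition diameter A : \bar R :=
  ereal_sup (0 |` [set (mdist p.1 p.2)%:E | p in A `*` A]).

(** The test is only relevant for s = 0, where 0 `^ 0 = 1. *)
Definition diameter_pow s A : \bar R :=
  if A == set0 then 0 else diameter A `^ s.

Definition hausdorff_content s delta E : \bar R :=
  ereal_inf [set \sum_(0 <= i <oo) diameter_pow s (U i) | U in
    [set U : (set T)^nat | E `<=` \bigcup_i U i /\
                           forall i, diameter (U i) <= delta%:E]].

Definition hausdorff_measure s E : \bar R :=
  ereal_sup [set hausdorff_content s delta E | delta in [set x | (0 < x)%R]].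

Definition hausdorff_dim E : \bar R :=
  ereal_inf [set s%:E | s in [set s | (0 <= s)%R /\ hausdorff_measure s E = 0]].

End hausdorff.

(* Main.v *)
(* The set [K] is an intersection of finite stages, obtained by multiplying, again
   and again, two C^2 densities [S_j] and [nu_j >= 0] by factors close to [1].

   A first kind of factor is supported where [f = c * \sum_(k < m) cos (9^k t)] lies
   in [1, 512], with [c^q m^(q-1)] tiny.  A positive factor of this kind, a truncated
   Riesz product, is close to [1] only in [l_r], [r > q]; but the finite difference
   in [y] of the Riesz products with parameter proportional to [y], divided by [y],
   cancels the low orders and gives a signed factor close to [1] in [l_q].  By
   Hoelder's inequality, if [mu] has Fourier coefficients in [l_q], then the
   integrals of [f] against [g mu] are tiny for every trigonometric polynomial [g];
   in the limit they vanish against the restriction of [mu] to any Borel set, while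
   [f >= 1] on [K], so a measure carried by [K] is zero.  The signed products [S_j]
   nevertheless converge to a distribution.

   A second kind of factor is positive and carried by [N] short arcs of length [2 d],
   with [N (2 d)^s] tiny for some [s] slightly above [2 / q]; this makes [K] of
   dimension at most [2 / q].  Conversely the positive products [nu_j] are bounded in
   [l_r] for each [r > q], which bounds their energies of all orders [s < 2 / q] and
   hence bounds below the Hausdorff content of every cover of [K]. *)

From HB Require Import structures.
From mathcomp Require Import all_boot all_order all_algebra generic_quotient.
From mathcomp Require Import all_classical all_reals all_analysis.
From mathcomp Require Import complex ring lra zify finmap measurable_realfun.
Require Import Defs.

Set Implicit Arguments.
Unset Strict Implicit.
Unset Printing Implicit Defensive.
Import Order.TTheory GRing.Theory Num.Theory.
Import numFieldNormedType.Exports.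
Local Open Scope classical_set_scope.
Local Open Scope ring_scope.

(** * Continuity and derivatives of real functions *)

Section Calculus.
Variable R : realType.
Implicit Types (f g h u : R -> R) (x y t c : R).

(** The demands on a stage conflict. As [c] is of order [1 / (s m)], smallness of [c^q m^(q-1)]
    forces [K = s^q m] to be large, and then the Riesz product with parameter [s] is far from 1 in
    [l_q]. The way out: its coefficients of order [d] are multiples of [s^d], so dividing by the
    parameter and taking a difference of order [M] annihilates the orders 1 to [M]. The rest gains a
    factor [2^-M], which beats the exponential of a multiple of [K], provided [M] is chosen after
    [K]. Then [m] is chosen. Since [q > 2], [s^2 m = K^(2/q) m^(1-2/q)] is as large as desired, so
    the lacunary sum concentrates at the scale [s m] and cutting off the rest costs little even in
    [L^2]; this needs no sign. For [r > q], [s^r m] is as small as desired, so the plain product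
    serves the positive density. Each new factor is chosen after the multiplier norms of the
    densities that it multiplies, so those norms may grow without harm. All functions multiplied are
    even, hence only their cosine coefficients matter. *)

Definition cont f : Prop := continuous f.

Lemma ctsC c : cont (fun _ : R => c).
Proof. by move=> x; exact: cvg_cst. Qed.
Lemma ctsI : cont (fun x : R => x).
Proof. by move=> x; exact: cvg_id. Qed.
Lemma ctsD f g : cont f -> cont g -> cont (fun x => f x + g x).
Proof. by move=> cf cg x; apply: cvgD; [exact: cf|exact: cg]. Qed.
Lemma ctsN f : cont f -> cont (fun x => - f x).
Proof. by move=> cf x; apply: cvgN; exact: cf. Qed.
Lemma ctsM f g : cont f -> cont g -> cont (fun x => f x * g x).
Proof. by move=> cf cg x; apply: cvgM; [exact: cf|exact: cg]. Qed.
Lemma cts_comp f g : cont g -> cont f -> cont (fun x => g (f x)).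
Proof. by move=> cg cf x; apply: continuous_comp; [exact: cf|exact: cg]. Qed.
Lemma ctsX f n : cont f -> cont (fun x => f x ^+ n).
Proof.
move=> cf; elim: n => [|n IH]; first exact: ctsC.
by under eq_fun do rewrite exprS; exact: ctsM.
Qed.
Lemma cts_sum I (r : seq I) (P : pred I) (F : I -> R -> R) :
  (forall i, cont (F i)) -> cont (fun x => \sum_(i <- r | P i) F i x).
Proof.
move=> cF; elim: r => [|i r IH].
  by under eq_fun do rewrite big_nil; exact: ctsC.
under eq_fun do rewrite big_cons.
by case: (P i) => //; exact: ctsD.
Qed.
Lemma cts_prod I (r : seq I) (P : pred I) (F : I -> R -> R) :
  (forall i, cont (F i)) -> cont (fun x => \prod_(i <- r | P i) F i x).
Proof.
move=> cF; elim: r => [|i r IH].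
  by under eq_fun do rewrite big_nil; exact: ctsC.
under eq_fun do rewrite big_cons.
by case: (P i) => //; exact: ctsM.
Qed.
Lemma ctsabs f : cont f -> cont (fun x => `|f x|).
Proof. by move=> cf x; apply: cvg_norm; exact: cf. Qed.
Lemma cts_cos f : cont f -> cont (fun x => cos (f x)).
Proof. by move=> cf; apply: cts_comp => //; exact: continuous_cos. Qed.
Lemma cts_sin f : cont f -> cont (fun x => sin (f x)).
Proof. by move=> cf; apply: cts_comp => //; exact: continuous_sin. Qed.
Lemma cts_expR f : cont f -> cont (fun x => expR (f x)).
Proof. by move=> cf; apply: cts_comp => //; exact: continuous_expR. Qed.

Definition dv f g := forall x, is_derive x 1 f (g x).

Lemma dv_eq f g h : dv f g -> g =1 h -> dv f h.
Proof. by move=> fg gh x; rewrite -gh. Qed.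
Lemma dvC c : dv (fun _ => c) (fun _ => 0).
Proof. by move=> x; exact: is_derive_cst. Qed.
Lemma dvI : dv (fun x => x) (fun _ => 1).
Proof. by move=> x; exact: is_derive_id. Qed.
Lemma dvD f g f' g' : dv f f' -> dv g g' ->
  dv (fun x => f x + g x) (fun x => f' x + g' x).
Proof. by move=> df dg x; apply: is_deriveD; [exact: df|exact: dg]. Qed.
Lemma dvN f f' : dv f f' -> dv (fun x => - f x) (fun x => - f' x).
Proof. by move=> df x; apply: is_deriveN; exact: df. Qed.
Lemma dvM f g f' g' : dv f f' -> dv g g' ->
  dv (fun x => f x * g x) (fun x => f x * g' x + g x * f' x).
Proof. by move=> df dg x; apply: is_deriveM; [exact: df|exact: dg]. Qed.
Lemma dv_comp f g f' g' : dv g g' -> dv f f' ->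
  dv (fun x => g (f x)) (fun x => g' (f x) * f' x).
Proof.
by move=> dg df x; apply: is_derive1_comp; [exact: dg|exact: df].
Qed.
Lemma dv_cos : dv cos (fun x => - sin x).
Proof. by move=> x; exact: is_derive_cos. Qed.
Lemma dv_sin : dv sin cos.
Proof. by move=> x; exact: is_derive_sin. Qed.
Lemma dv_cts f f' : dv f f' -> cont f.
Proof.
move=> df x; apply: differentiable_continuous; apply/derivable1_diffP.
by have [] := df x.
Qed.

End Calculus.

(** Continuity is proved by recursion on the syntax of the function; [cont] exists so that the goal
    has a fixed head on which to match. *)
Ltac cts := lazymatch goal with
  | |- forall _, cont _ => move=> ?; cts
  | |- cont (fun x => x) => exact: ctsI
  | |- cont (fun x => (@?f x + @?g x)%R) => apply: (@ctsD _ f g); cts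
  | |- cont (fun x => (@?f x * @?g x)%R) => apply: (@ctsM _ f g); cts
  | |- cont (fun x => (- @?f x)%R) => apply: (@ctsN _ f); cts
  | |- cont (fun x => (@?f x ^+ ?n)%R) => apply: (@ctsX _ f n); cts
  | |- cont (fun x => `|@?f x|) => apply: (@ctsabs _ f); cts
  | |- cont (fun x => cos (@?f x)) => apply: (@cts_cos _ f); cts
  | |- cont (fun x => sin (@?f x)) => apply: (@cts_sin _ f); cts
  | |- cont (fun x => expR (@?f x)) => apply: (@cts_expR _ f); cts
  | |- cont (fun x => \sum_(i <- _ | _) _) => apply: cts_sum; cts
  | |- cont (fun x => \prod_(i <- _ | _) _) => apply: cts_prod; cts
  | |- cont _ => first [ exact: ctsC | assumption | solve [auto] | cts_app ]
  | |- _ => idtac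
  end
with cts_app := lazymatch goal with
  | |- cont (fun x => ?f (@?g x)) => apply: (@cts_comp _ g f); cts
  end.

(** * Means and Fourier coefficients *)

Section Average.
Variable R : realType.
Implicit Types (f g h u : R -> R) (x y t c : R).
Local Notation mu := (@lebesgue_measure R).

(* Averaging [f t + f (- t)] over [0, pi] makes the mean of an odd function
   vanish without any change of variables. *)
Definition av f : R := (2 * pi)^-1 * \int[mu]_(t in `[0, pi]) (f t + f (- t)).

Let integ f : cont f -> mu.-integrable `[0, pi] (EFin \o f).
Proof.
move=> cf; apply: continuous_compact_integrable; first exact: segment_compact.
by apply: continuous_subspaceT => x; exact: cf.
Qed.

Let ctss f : cont f -> cont (fun t => f t + f (- t)).
Proof. by move=> cf; cts. Qed.

Lemma avD f g : cont f -> cont g ->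
  av (fun t => f t + g t) = av f + av g.
Proof.
move=> cf cg; rewrite /av -mulrDr -RintegralD//; [|exact: (integ (ctss cf))|exact: (integ (ctss cg))].
by congr (_ * _); apply: eq_Rintegral => t _; rewrite addrACA.
Qed.

Lemma avZ c f : cont f -> av (fun t => c * f t) = c * av f.
Proof.
move=> cf; rewrite /av mulrCA; congr (_ * _); rewrite -RintegralZl//; [|exact: (integ (ctss cf))].
by apply: eq_Rintegral => t _; rewrite mulrDr.
Qed.

Lemma avN f : cont f -> av (fun t => - f t) = - av f.
Proof.
move=> cf; rewrite -mulN1r -avZ//.
by congr av; apply/funext => t; rewrite mulN1r.
Qed.

Lemma avB f g : cont f -> cont g ->
  av (fun t => f t - g t) = av f - av g.
Proof. by move=> cf cg; rewrite avD ?avN//; cts. Qed.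

Lemma av_cst c : av (fun=> c) = c.
Proof.
rewrite /av Rintegral_cst//= lebesgue_measure_itv/= lte_fin pi_gt0 oppr0 adde0/=.
have := @pi_gt0 R; move: pi => p p0; field.
by rewrite gt_eqF.
Qed.

Lemma av_le f g : cont f -> cont g -> (forall t, f t <= g t) ->
  av f <= av g.
Proof.
move=> cf cg fg; rewrite /av ler_wpM2l ?invr_ge0 ?mulr_ge0 ?pi_ge0//.
by apply: le_Rintegral => //; [by apply: integ; apply: ctss|by apply: integ; apply: ctss|move=> t _; exact: lerD].
Qed.

Lemma av_ge0 f : cont f -> (forall t, 0 <= f t) -> 0 <= av f.
Proof. by move=> cf f0; rewrite -(av_cst 0); apply: av_le => //; exact: ctsC. Qed.

Lemma av_abs f g : cont f -> cont g -> (forall t, `|f t| <= g t) ->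
  `|av f| <= av g.
Proof.
move=> cf cg fg; rewrite ler_norml -avN//; apply/andP; split.
  apply: av_le => // [|t]; first by cts.
  by have := fg t; rewrite ler_norml => /andP[].
by apply: av_le => // t; have := fg t; rewrite ler_norml => /andP[].
Qed.

Lemma av_abs_cst f c : cont f -> (forall t, `|f t| <= c) -> `|av f| <= c.
Proof. by move=> cf fc; rewrite -[leRHS]av_cst; apply: av_abs => //; exact: ctsC. Qed.

Lemma av_odd f : (forall t, f (- t) = - f t) -> av f = 0.
Proof.
move=> fo; rewrite /av (@eq_Rintegral _ _ _ _ _ (fun=> 0)).
  by rewrite Rintegral_cst// mul0r mulr0.
by move=> t _; rewrite fo subrr.
Qed.

Lemma av_sum I (r : seq I) (P : pred I) (F : I -> R -> R) :
  (forall i, cont (F i)) ->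
  av (fun x => \sum_(i <- r | P i) F i x) = \sum_(i <- r | P i) av (F i).
Proof.
move=> cF; elim: r => [|i r IH].
  by under eq_fun do rewrite big_nil; rewrite big_nil av_cst.
under eq_fun do rewrite big_cons.
rewrite big_cons; case: (P i) => //.
by rewrite avD// ?IH//; cts.
Qed.

(** The folded integrand [f' t + f' (- t)] is the derivative of [f t - f (- t)], which vanishes at
    0, so only the boundary term at [pi] remains. *)
Lemma av_deriv f f' : dv f f' -> cont f' ->
  av f' = (2 * pi)^-1 * (f pi - f (- pi)).
Proof.
move=> df cf'; rewrite /av; congr (_ * _).
pose F t := f t - f (- t).
have dF : dv F (fun t => f' t + f' (- t)).
  rewrite /F; have d2 : dv (fun t => f (- t)) (fun t => f' (- t) * -1).
    apply: dv_comp => //; apply: dvN; exact: dvI.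
  by apply: dv_eq (dvD df (dvN d2)) _ => t /=; rewrite mulrN1 opprK.
rewrite /Rintegral (@continuous_FTC2 _ _ F)//=.
- by rewrite /F oppr0 subrr subr0.
- exact: pi_gt0.
- by apply: continuous_subspaceT => x; exact: ctss.
- split.
  + by move=> x _; have [] := dF x.
  + by apply: cvg_at_right_filter; exact: (dv_cts dF).
  + by apply: cvg_at_left_filter; exact: (dv_cts dF).
- by move=> x _; rewrite derive1E; have [_ ->] := dF x.
Qed.

Lemma av_deriv0 f f' : dv f f' -> cont f' -> f pi = f (- pi) -> av f' = 0.
Proof. by move=> df cf' e; rewrite (av_deriv df)// e subrr mulr0. Qed.

Lemma av_ge_on f c d : cont f -> (forall t, 0 <= f t) -> 0 < d -> d <= pi ->
  (forall t, `|t| <= d -> c <= f t) -> c * d / pi <= av f.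
Proof.
move=> cf f0 d0 dpi fc; have p0 := @pi_gt0 R.
have i1 := integ (ctss cf).
have e := @Rintegral_itvB R (fun t => f t + f (- t)) (BLeft 0) (BRight pi) d i1.
have i2 : mu.-integrable `[0, d] (EFin \o (fun t => f t + f (- t))).
  apply: integrableS i1 => //; apply: subset_itvl; by rewrite bnd_simp.
have i3 : mu.-integrable `[0, d] (EFin \o (fun _ : R => 2 * c)).
  apply: continuous_compact_integrable; first exact: segment_compact.
  by apply: continuous_subspaceT => x; exact: cvg_cst.
have h1 : \int[mu]_(t in `[0, d]) (2 * c) <= \int[mu]_(t in `[0, d]) (f t + f (- t)).
  apply: le_Rintegral => // t; rewrite /= in_itv /= => /andP[t0 td].
  have := fc t; have := fc (- t); rewrite normrN ger0_norm// => /(_ td) a /(_ td) b; lra.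
have h2 : 0 <= \int[mu]_(t in `]d, pi]) (f t + f (- t)).
  by apply: Rintegral_ge0 => t _; rewrite addr_ge0.
rewrite Rintegral_cst//= lebesgue_measure_itv/= lte_fin d0 oppr0 adde0/= in h1.
rewrite /av (_ : c * d / pi = (2 * pi)^-1 * (2 * c * d)); last first.
  by move: pi p0 => p p0'; field; rewrite gt_eqF.
rewrite ler_wpM2l ?invr_ge0 ?mulr_ge0 ?(ltW p0)//.
apply: le_trans h1 _; rewrite -subr_ge0 e// bnd_simp ltW//.
Qed.

End Average.
Global Opaque av.

(** * Jensen's inequality for powers *)

Section Jensen.
Variable R : realType.
Implicit Types (q W : R).

(* Young's inequality [x a^(q-1) <= x^q / q + a^q (1 - 1/q)] at the mean [a]. *)
Lemma powR_jensen q W I (s : seq I) (P : pred I) (w y : I -> R) : 1 < q -> 0 < W ->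
  (forall i, 0 <= w i) -> \sum_(i <- s | P i) w i <= W ->
  `|\sum_(i <- s | P i) w i * y i| `^ q
    <= W `^ (q - 1) * \sum_(i <- s | P i) w i * `|y i| `^ q.
Proof.
move=> q1 W0 w0 wW.
have q0 : 0 < q by rewrite (lt_trans _ q1).
set S := \sum_(i <- s | P i) w i * `|y i| `^ q.
pose A := \sum_(i <- s | P i) w i * `|y i|.
have A0 : 0 <= A by apply: sumr_ge0 => i _; rewrite mulr_ge0.
have leA : `|\sum_(i <- s | P i) w i * y i| `^ q <= A `^ q.
  apply: ge0_ler_powR; [exact: ltW|by rewrite nnegrE|by rewrite nnegrE|].
  apply: le_trans (ler_norm_sum _ _ _) _; apply: ler_sum => i _.
  by rewrite normrM (ger0_norm (w0 i)).
apply: le_trans leA _.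
have [->|An0] := eqVneq A 0.
  rewrite powR0 ?gt_eqF//; rewrite mulr_ge0 ?powR_ge0//.
  by apply: sumr_ge0 => i _; rewrite mulr_ge0 ?powR_ge0.
have Ap : 0 < A by rewrite lt_neqAle eq_sym An0.
pose a := A / W.
have a0 : 0 < a by rewrite divr_gt0.
pose p := q / (q - 1).
have q10 : 0 < q - 1 by rewrite subr_gt0.
have p0 : 0 < p by rewrite divr_gt0.
have pq : q^-1 + p^-1 = 1 by rewrite /p invf_div; field; rewrite gt_eqF.
have Y i : `|y i| * a `^ (q - 1) <= `|y i| `^ q / q + a `^ q / p.
  have := @conjugate_powR _ `|y i| (a `^ (q - 1)) q p (normr_ge0 _) (powR_ge0 _ _) q0 p0 pq.
  by rewrite -powRrM /p mulrCA divff ?gt_eqF// mulr1.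
have SA : A * a `^ (q - 1) <= S / q + W * (a `^ q / p).
  rewrite mulr_suml; apply: (@le_trans _ _ (\sum_(i <- s | P i)
     (w i * `|y i| `^ q / q + w i * (a `^ q / p)))).
    by apply: ler_sum => i _; rewrite -!mulrA -mulrDr ler_wpM2l.
  rewrite big_split /= -!mulr_suml lerD2l ler_wpM2r//.
  by rewrite divr_ge0 ?powR_ge0 ?ltW.
have aq : a `^ q = a * a `^ (q - 1) by rewrite mulr_powRB1 // ltW.
have Aq : A `^ q = W `^ (q - 1) * (A * a `^ (q - 1)).
  rewrite mulrCA -powRM ?ltW// /a mulrCA divff ?gt_eqF// mulr1.
  by rewrite mulr_powRB1// ltW.
rewrite Aq ler_wpM2l ?powR_ge0//.
have WA : W * (a `^ q / p) = (A * a `^ (q - 1)) / p.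
  by rewrite aq /a; field; rewrite !gt_eqF.
rewrite WA in SA.
have e : A * a `^ (q - 1) / q + A * a `^ (q - 1) / p = A * a `^ (q - 1).
  by rewrite -mulrDr pq mulr1.
have : A * a `^ (q - 1) / q <= S / q by rewrite -(lerD2r (A * a `^ (q - 1) / p)) e.
by rewrite ler_pM2r ?invr_gt0.
Qed.

Lemma powR_normD_le q (x y : R) : 1 < q ->
  `|x + y| `^ q <= 2 `^ q * (`|x| `^ q + `|y| `^ q).
Proof.
move=> q1; have := @powR_jensen q 2 bool [:: true; false] predT (fun=> 1)
  (fun b => if b then x else y) q1 (ltr0n _ 2) (fun=> ler01).
rewrite !big_cons !big_nil !addr0 !mul1r => /(_ (lexx _)) h.
apply: le_trans h _; rewrite ler_wpM2r ?addr_ge0 ?powR_ge0//.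
by rewrite ler_powR ?ler1n// gerBl.
Qed.

End Jensen.

(** * Cosine coefficients and Bessel's inequality *)

Section Fourier.
Variable R : realType.
Implicit Types (f g h u : R -> R) (x y t c q D : R) (n k : int).

(* The densities are even, so their cosine coefficients are their Fourier coefficients. *)
Definition hat f n : R := av (fun t => f t * cos (n%:~R * t)).

(** [D] bounds the [q]-th power of the [l_q] norm, not the norm itself; finite partial sums stand
    for the series. *)
Definition lq q f D := forall s : seq int, uniq s ->
  \sum_(n <- s) `|hat f n| `^ q <= D.

Lemma sin_intpi n : sin (n%:~R * pi) = 0 :> R.
Proof.
have [_] := @cos_sin_period R n (- (n%:~R * pi)).
rewrite (_ : _ + _ = n%:~R * pi); last by ring.
by rewrite sinN => h; move: h; lra.
Qed.

Lemma av_cosn n : av (fun t : R => cos (n%:~R * t)) = (n == 0)%:R.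
Proof.
have [->|n0] := eqVneq n 0.
  by under eq_fun do rewrite mul0r cos0; rewrite av_cst.
have nR : (n%:~R : R) != 0 by rewrite intr_eq0.
have d : dv (fun t : R => n%:~R^-1 * sin (n%:~R * t)) (fun t => cos (n%:~R * t)).
  apply: dv_eq.
    apply: dvM; first exact: dvC.
    apply: dv_comp; first exact: dv_sin.
    by apply: dvM; [exact: dvC|exact: dvI].
  by move=> t /=; field.
rewrite (av_deriv0 d) //; first by cts.
by rewrite mulrN sinN sin_intpi oppr0.
Qed.

Lemma cosMcos x y : cos x * cos y = 2^-1 * (cos (x + y) + cos (x - y)).
Proof. by rewrite cosD cosB; field. Qed.

Lemma hatN f n : hat f (- n) = hat f n.
Proof.
by congr av; apply/funext => t; rewrite intrN mulNr cosN.
Qed.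

Lemma hatD f g n : cont f -> cont g ->
  hat (fun t => f t + g t) n = hat f n + hat g n.
Proof.
move=> cf cg; rewrite -avD; [|by cts|by cts].
by congr av; apply/funext => t; rewrite mulrDl.
Qed.

Lemma hatZ c f n : cont f -> hat (fun t => c * f t) n = c * hat f n.
Proof.
move=> cf; rewrite -avZ; last by cts.
by congr av; apply/funext => t; rewrite mulrA.
Qed.

Lemma hatB f g n : cont f -> cont g ->
  hat (fun t => f t - g t) n = hat f n - hat g n.
Proof.
move=> cf cg; rewrite hatD//; last by cts.
congr (_ + _); rewrite -avN; last by cts.
by congr av; apply/funext => t; rewrite mulNr.
Qed.

Lemma hat_sum I (r : seq I) (P : pred I) (F : I -> R -> R) n :
  (forall i, cont (F i)) ->
  hat (fun x => \sum_(i <- r | P i) F i x) n = \sum_(i <- r | P i) hat (F i) n.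
Proof.
move=> cF; rewrite -av_sum; last by move=> i; cts.
by congr av; apply/funext => t; rewrite mulr_suml.
Qed.

Lemma hat_le_cst f c n : cont f -> (forall t, `|f t| <= c) -> `|hat f n| <= c.
Proof.
move=> cf fc; apply: av_abs_cst => [|t]; first by cts.
rewrite normrM -[leRHS]mulr1 ler_pM//; exact: cos_max.
Qed.

Lemma hat_le_av f n : cont f -> `|hat f n| <= av (fun t => `|f t|).
Proof.
move=> cf; apply: av_abs => [| |t]; [by cts|by cts|].
by rewrite normrM ler_piMr// cos_max.
Qed.

Lemma hat0 f : hat f 0 = av f.
Proof. by congr av; apply/funext => t; rewrite mul0r cos0 mulr1. Qed.

Lemma hat_cosM f k n : cont f ->
  hat (fun t => f t * cos (k%:~R * t)) n = 2^-1 * (hat f (n + k) + hat f (n - k)).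
Proof.
move=> cf; rewrite -avD -?avZ; [|by cts..].
congr av; apply/funext => t.
by rewrite -mulrA cosMcos intrD intrB !mulrDl (addrC (k%:~R * t)) -[cos (_ - _)]cosN opprB mulNr; ring.
Qed.

Lemma hat_cos k n :
  hat (fun t => cos (k%:~R * t)) n = 2^-1 * ((n + k == 0)%:R + (n - k == 0)%:R).
Proof.
have -> : (fun t : R => cos (k%:~R * t)) = (fun t => 1 * cos (k%:~R * t)).
  by apply/funext => t; rewrite mul1r.
rewrite hat_cosM; last exact: ctsC.
have h m : hat (fun=> 1 : R) m = (m == 0)%:R.
  by rewrite -av_cosn; congr av; apply/funext => t; rewrite mul1r.
by rewrite !h.
Qed.

Lemma hat1 n : hat (fun=> 1 : R) n = (n == 0)%:R.
Proof. by rewrite -av_cosn; congr av; apply/funext => t; rewrite mul1r. Qed.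

(** Expand the mean of [(f - T)^2] with [T] the partial cosine sum over [s]. As [s] need not be
    symmetric and the cosines of [n] and [- n] coincide, the mean of [T^2] is only bounded by [S],
    which suffices. *)
Lemma hat_bessel f (s : seq int) : cont f -> uniq s ->
  \sum_(n <- s) hat f n ^+ 2 <= av (fun t => f t ^+ 2).
Proof.
move=> cf us; set S := \sum_(n <- s) _.
pose T t := \sum_(n <- s) hat f n * cos (n%:~R * t).
have cT : cont T by rewrite /T; cts.
have fT : av (fun t => f t * T t) = S.
  rewrite /S (_ : (fun t => _) = fun t => \sum_(n <- s) hat f n * (f t * cos (n%:~R * t))).
    rewrite av_sum => [|n]; last by cts.
    by apply: eq_bigr => n _; rewrite avZ//; cts.
  by apply/funext => t; rewrite mulr_sumr; apply: eq_bigr => n _; rewrite mulrCA.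
have sub (r : seq int) k : uniq r ->
    \sum_(m <- r) hat f m * (k == m)%:R = hat f k * (k \in r)%:R.
  elim: r => [|m r IH]; first by rewrite big_nil in_nil mulr0.
  rewrite cons_uniq big_cons in_cons => /andP[mr ur]; rewrite IH//.
  have [->|km] := eqVneq k m; last by rewrite mulr0 add0r.
  by rewrite (negPf mr) mulr0 addr0.
have hT n : hat T n = 2^-1 * (hat f n * (n \in s)%:R + hat f n * (- n \in s)%:R).
  rewrite /T hat_sum => [|m]; last by cts.
  rewrite -{2}hatN -!sub// -big_split mulr_sumr; apply: eq_bigr => i _ /=.
  rewrite hatZ; last by cts.
  rewrite hat_cos -mulrDr mulrCA subr_eq0 addr_eq0 addrC.
  by congr (_ * (_ * (_ + _%:R))); rewrite eqr_oppLR.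
have TT : av (fun t => T t * T t) <= S.
  have -> : (fun t => T t * T t) = fun t => \sum_(n <- s) hat f n * (T t * cos (n%:~R * t)).
    by apply/funext => t; rewrite {2}/T mulr_sumr; apply: eq_bigr => n _; rewrite mulrCA.
  rewrite av_sum => [|n]; last by cts.
  apply: ler_sum => n _; rewrite avZ; last by cts.
  rewrite -/(hat T n) hT.
  have := sqr_ge0 (hat f n); rewrite expr2; set a := _ * _ => a0.
  rewrite (_ : _ * _ = a * (2^-1 * ((n \in s)%:R + (- n \in s)%:R))); last by rewrite /a; ring.
  rewrite ler_piMr//.
  by case: (n \in s); case: (- n \in s) => /=; lra.
have : 0 <= av (fun t => (f t ^+ 2 - 2 * (f t * T t)) + T t * T t).
  apply: av_ge0 => [|t]; first by cts.
  by have := sqr_ge0 (f t - T t); rewrite sqrrB !expr2 !mulr_natl; lra.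
rewrite avD; [|cts..]; rewrite avB; [|cts..]; rewrite avZ ?fT; last by cts.
by move: TT; lra.
Qed.

End Fourier.
Global Opaque hat.
(** * Fejer means and C^2 functions *)

Section Trig.
Variable R : realType.
Implicit Types (f g h u : R -> R) (x y z t c : R) (n k : int).

Lemma sqr_abs x : `|x| ^+ 2 = x ^+ 2.
Proof. by rewrite real_normK ?num_real. Qed.

Lemma mvt f f' a b : dv f f' -> a < b ->
  exists2 c : R, a < c < b & f b - f a = f' c * (b - a).
Proof.
move=> df ab; have [|c] := @MVT R f f' a b ab (fun x _ => df x).
  by apply: continuous_subspaceT => x; exact: (dv_cts df).
by rewrite in_itv/= => cab e; exists c.
Qed.

Lemma mvt_norm f f' B : dv f f' -> (forall x, `|f' x| <= B) ->
  forall x y, `|f x - f y| <= B * `|x - y|.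
Proof.
move=> df fB x y; wlog xy : x y / y < x => [H|].
  have [xy|xy|->] := ltgtP x y; last by rewrite !subrr normr0 mulr0.
  - by rewrite distrC [X in _ * X]distrC; exact: H.
  - exact: H.
by have [c _ ->] := mvt df xy; rewrite normrM ler_wpM2r.
Qed.

Lemma sin_le_norm x : `|sin x| <= `|x|.
Proof.
have := @mvt_norm _ _ 1 (@dv_sin R) (@cos_max R) x 0.
by rewrite sin0 !subr0 mul1r.
Qed.

Lemma subr1cos x : 1 - cos x = 2 * sin (x / 2) ^+ 2.
Proof.
rewrite -[in cos x](_ : (x / 2) *+ 2 = x); last by rewrite -mulr_natr; field.
by rewrite cos_mulr2n cos2sin2; ring.
Qed.

Lemma cos_ge_sqr x : 1 - x ^+ 2 / 2 <= cos x.
Proof.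
suff : 1 - cos x <= x ^+ 2 / 2 by lra.
rewrite subr1cos.
have : `|sin (x / 2)| ^+ 2 <= `|x / 2| ^+ 2 by rewrite lerXn2r ?nnegrE// sin_le_norm.
by rewrite !sqr_abs expr_div_n; lra.
Qed.

Lemma cos_ge_half x : `|x| <= 1 -> 2^-1 <= cos x.
Proof.
move=> x1; apply: le_trans (cos_ge_sqr x).
have : `|x| ^+ 2 <= 1 by rewrite exprn_ile1.
by rewrite sqr_abs; lra.
Qed.

(** Up to 1 the derivative is at least 1/2; beyond 1 monotonicity keeps [sin x] above 1/2, while
    [x / 4] stays below 1/2. *)
Lemma sin_ge_quarter x : 0 <= x <= pi / 2 -> x / 4 <= sin x.
Proof.
have half y : 0 <= y <= 1 -> y / 2 <= sin y.
  move=> /andP[]; rewrite le_eqVlt => /predU1P[<-|y0 y1].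
    by rewrite sin0 mul0r.
  have [c /andP[c0 cy]] := mvt (@dv_sin R) y0.
  rewrite sin0 !subr0 => ->; rewrite mulrC ler_wpM2r//; first exact: ltW.
  by rewrite cos_ge_half// ger0_norm; [rewrite ltW// (lt_le_trans cy)|exact: ltW].
move=> /andP[x0 xp]; have [x1|x1] := leP x 1.
  have : x / 2 <= sin x by apply: half; rewrite x0.
  lra.
have p2 := @pihalf_lt2 R.
have s1 : 1 / 2 <= sin (1 : R) by apply: half; rewrite ler01 lexx.
have : sin 1 < sin x by rewrite ltr_sin// !in_itv/=; apply/andP; split; lra.
lra.
Qed.

(** The constant comes from [1 - cos z = 2 * sin (z / 2) ^+ 2] and [sin (z / 2) >= z / 8]. *)
Lemma sqr_le_cos z : `|z| <= pi -> z ^+ 2 <= 32 * (1 - cos z).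
Proof.
move=> zp; rewrite -cos_norm -sqr_abs; have := normr_ge0 z.
move: `|z| zp => {}z zp z0.
have := @sin_ge_quarter (z / 2); rewrite subr1cos.
have -> : 0 <= z / 2 <= pi / 2 by apply/andP; split; lra.
move=> /(_ isT) h.
have : (z / 2 / 4) ^+ 2 <= sin (z / 2) ^+ 2.
  by rewrite lerXn2r ?nnegrE//; [lra|apply: le_trans h; lra].
rewrite !expr_div_n; lra.
Qed.

Lemma per_reduce x : exists k, - pi <= x - k%:~R * (2 * pi) <= pi.
Proof.
exists (Num.floor ((x + pi) / (2 * pi))).
have p0 : 0 < 2 * pi :> R by rewrite mulr_gt0// pi_gt0.
set m := Num.floor _.
have h1 : m%:~R <= (x + pi) / (2 * pi) by exact: floor_le.
have h2 : (x + pi) / (2 * pi) < (m + 1)%:~R by exact: floorD1_gt.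
rewrite ler_pdivlMr// in h1; rewrite ltr_pdivrMr// intrD mulrDl mul1r in h2.
by apply/andP; split; lra.
Qed.

Definition periodic2pi u := forall k x, u (x + k%:~R * (2 * pi)) = u x.

Lemma per_bounded u : cont u -> periodic2pi u ->
  exists2 B : R, 0 <= B & forall x, `|u x| <= B.
Proof.
move=> cu up.
have [||c _ hc] := @EVT_max R (fun x => `|u x|) (- pi) pi.
- by have := @pi_ge0 R; lra.
- by apply: continuous_subspaceT; have : cont (fun x => `|u x|) by cts.
exists `|u c| => // x; have [k kx] := per_reduce x.
have := hc (x - k%:~R * (2 * pi)); rewrite in_itv/= kx => /(_ isT).
by have := up (- k) x; rewrite intrN mulNr => ->.
Qed.

Lemma cos_per k x : cos (x + k%:~R * (2 * pi)) = cos x.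
Proof. by have [] := cos_sin_period k x. Qed.

(* [1 - cos (x - y)] is comparable to the squared arc distance of [x] and [y]. *)
Definition lipc L u := forall x y, (u x - u y) ^+ 2 <= L * (1 - cos (x - y)).

Lemma lipc_of u B : periodic2pi u -> (forall x y, `|u x - u y| <= B * `|x - y|) ->
  0 <= B -> lipc (32 * B ^+ 2) u.
Proof.
move=> up uB B0 x y.
have [k kx] := per_reduce (x - y).
have e : u x = u (x - k%:~R * (2 * pi)).
  by have := up (- k) x; rewrite intrN mulNr => ->.
have ec : cos (x - y) = cos (x - y - k%:~R * (2 * pi)).
  by have := cos_per (- k) (x - y); rewrite intrN mulNr => ->.
rewrite e ec; set z := x - y - _ in kx ec *.
have hz : z ^+ 2 <= 32 * (1 - cos z).
  by apply: sqr_le_cos; rewrite ler_norml.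
have : `|u (x - k%:~R * (2 * pi)) - u y| ^+ 2 <= (B * `|z|) ^+ 2.
  rewrite lerXn2r ?nnegrE ?mulr_ge0//.
  by apply: le_trans (uB _ _) _; rewrite /z addrAC.
rewrite sqr_abs exprMn sqr_abs => h; apply: le_trans h _.
have := ler_wpM2l (sqr_ge0 B) hz; lra.
Qed.

End Trig.

(** * The Fejer kernel *)

Section Fejer.
Variable R : realType.
Implicit Types (f g h u : R -> R) (x y z t c q D L B e : R) (n k : int) (K : nat).

Definition hats u n : R := av (fun t => u t * sin (n%:~R * t)).

(** The kernel as [K^-1] times the squared modulus of the sum of [e^(i k t)] over [k < K], which
    makes its positivity evident; [fejE] is its expansion into cosines. *)
Definition fej K t : R :=
  K%:R^-1 * ((\sum_(k < K) cos (k%:R * t)) ^+ 2 + (\sum_(k < K) sin (k%:R * t)) ^+ 2).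

Lemma fej_ge0 K t : 0 <= fej K t.
Proof. by rewrite mulr_ge0// addr_ge0// sqr_ge0. Qed.

Lemma fejE K t : fej K t =
  K%:R^-1 * \sum_(j < K) \sum_(k < K) cos ((j%:Z - k%:Z)%:~R * t).
Proof.
congr (_ * _); rewrite !expr2 !mulr_suml -big_split; apply: eq_bigr => j _ /=.
rewrite !mulr_sumr -big_split; apply: eq_bigr => k _ /=.
by rewrite intrB !pmulrn mulrBl cosB.
Qed.

Lemma cont_fej K : cont (fej K).
Proof. by rewrite /fej; cts. Qed.

(* Telescoping [(1 - e^(i t)) \sum_(k < K) e^(i k t) = 1 - e^(i K t)]. *)
Lemma fej_closed K t : (0 < K)%N ->
  (1 - cos t) * fej K t = K%:R^-1 * (1 - cos (K%:R * t)).
Proof.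
move=> K0; rewrite /fej; set C := \sum_(k < K) cos _; set S := \sum_(k < K) sin _.
have e1 : C - (cos t * C - sin t * S) = 1 - cos (K%:R * t).
  rewrite /C /S {K0}; elim: K {C S} => [|K IH].
    by rewrite !big_ord0 mul0r cos0; ring.
  by rewrite !big_ord_recr /= -natr1 mulrDl mul1r cosD; move: IH; lra.
have e2 : S - (cos t * S + sin t * C) = - sin (K%:R * t).
  rewrite /C /S {e1 K0}; elim: K {C S} => [|K IH].
    by rewrite !big_ord0 mul0r sin0; ring.
  by rewrite !big_ord_recr /= -natr1 mulrDl mul1r sinD; move: IH; lra.
have c1 := cos2Dsin2 t; have c2 := cos2Dsin2 (K%:R * t).
have : 2 * ((1 - cos t) * (C ^+ 2 + S ^+ 2)) = 2 * (1 - cos (K%:R * t)).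
  have -> : 2 * ((1 - cos t) * (C ^+ 2 + S ^+ 2)) =
     (C - (cos t * C - sin t * S)) ^+ 2 + (S - (cos t * S + sin t * C)) ^+ 2
     + (1 - (cos t ^+ 2 + sin t ^+ 2)) * (C ^+ 2 + S ^+ 2) by ring.
  rewrite e1 e2 c1 subrr mul0r addr0.
  have -> : 2 * (1 - cos (K%:R * t)) = 1 - 2 * cos (K%:R * t) +
     (cos (K%:R * t) ^+ 2 + sin (K%:R * t) ^+ 2) by rewrite c2; ring.
  by ring.
by move=> h; rewrite mulrCA; congr (_ * _); move: h; lra.
Qed.

Lemma fej_lower K t : (0 < K)%N -> `|t| <= K%:R^-1 -> K%:R / 4 <= fej K t.
Proof.
move=> K0 tK; rewrite /fej.
have KR : 0 < K%:R :> R by rewrite ltr0n.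
have : K%:R / 2 <= \sum_(k < K) cos (k%:R * t).
  rewrite -[K in K%:R / 2]card_ord mulr_natl -sumr_const; apply: ler_sum => k _.
  apply: cos_ge_half; rewrite normrM ger0_norm//.
  have : k%:R <= K%:R :> R by rewrite ler_nat ltnW.
  move=> kK; apply: (@le_trans _ _ (K%:R * K%:R^-1)); last by rewrite divff// gt_eqF.
  by rewrite ler_pM.
set C := \sum_(k < K) _ => hC.
have C2 : (K%:R / 2) ^+ 2 <= C ^+ 2.
  by rewrite lerXn2r ?nnegrE ?divr_ge0// (le_trans _ hC) ?divr_ge0.
apply: (@le_trans _ _ (K%:R^-1 * (K%:R / 2) ^+ 2)).
  by rewrite le_eqVlt; apply/orP; left; apply/eqP; field; rewrite gt_eqF.
by rewrite ler_wpM2l ?invr_ge0 ?ler0n// (le_trans C2)// lerDl sqr_ge0.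
Qed.

Lemma fej_per K k t : fej K (t + k%:~R * (2 * pi)) = fej K t.
Proof.
rewrite !fejE; congr (_ * _); apply: eq_bigr => j _; apply: eq_bigr => i _.
by rewrite mulrDr mulrA -intrM cos_per.
Qed.

Definition sig K u x : R := av (fun y => u y * fej K (x - y)).

Lemma sigE K u x : cont u -> sig K u x = K%:R^-1 * \sum_(j < K) \sum_(k < K)
   (hat u (j%:Z - k%:Z) * cos ((j%:Z - k%:Z)%:~R * x)
    + hats u (j%:Z - k%:Z) * sin ((j%:Z - k%:Z)%:~R * x)).
Proof.
move=> cu; rewrite /sig.
have -> : (fun y => u y * fej K (x - y)) = (fun y => K%:R^-1 *
   \sum_(j < K) \sum_(k < K) (cos ((j%:Z - k%:Z)%:~R * x) * (u y * cos ((j%:Z - k%:Z)%:~R * y)) +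
   sin ((j%:Z - k%:Z)%:~R * x) * (u y * sin ((j%:Z - k%:Z)%:~R * y)))).
  apply/funext => y; rewrite fejE mulrCA; congr (_ * _).
  rewrite mulr_sumr; apply: eq_bigr => j _; rewrite mulr_sumr; apply: eq_bigr => k _.
  by rewrite mulrBr cosB; ring.
rewrite avZ; last by cts.
congr (_ * _); rewrite av_sum; last by move=> j; cts.
apply: eq_bigr => j _; rewrite av_sum; last by move=> k; cts.
apply: eq_bigr => k _; rewrite avD ?avZ; [|cts..].
by rewrite mulrC [X in _ + X]mulrC.
Qed.

Lemma cont_sig K u : cont u -> cont (sig K u).
Proof.
by move=> cu; rewrite (funext (fun x => sigE K x cu)); cts.
Qed.

Lemma hats1 n : hats (fun=> 1 : R) n = 0.
Proof. by apply: av_odd => t; rewrite !mul1r mulrN sinN. Qed.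

Lemma av_fej K x : (0 < K)%N -> av (fun y => fej K (x - y)) = 1.
Proof.
move=> K0; have -> : av (fun y => fej K (x - y)) = sig K (fun=> 1 : R) x.
  by congr av; apply/funext => y; rewrite mul1r.
rewrite sigE; last exact: ctsC.
rewrite (_ : \sum_(j < K) _ = K%:R); first by rewrite mulVf// pnatr_eq0 -lt0n.
rewrite (eq_bigr (fun=> 1)); first by rewrite sumr_const card_ord.
move=> j _; rewrite (bigD1 j)//= subrr hat1 hats1 eqxx mul1r mul0r cos0 mul0r addr0.
rewrite big1 ?addr0// => k kj; rewrite hat1 hats1 mul0r addr0 subr_eq0.
by rewrite eqz_nat eq_sym (negPf kj : (nat_of_ord k == j) = false) mul0r.
Qed.

(** By the inequality of the means, [|u y - u x|] is at most [e + (u y - u x)^2 / (4 e)], hence at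
    most [e + L (1 - cos (x - y)) / (4 e)]. The last factor turns the kernel into an explicit cosine
    with mean [1 / K], by [fej_closed]. *)
Lemma sig_approx K u L e x : cont u -> lipc L u -> 0 <= L -> 0 < e -> (0 < K)%N ->
  `|sig K u x - u x| <= e + L / (4 * e * K%:R).
Proof.
move=> cu lu L0 e0 K0.
have cf : cont (fun y => fej K (x - y)) by apply: cts_comp; [exact: cont_fej|cts].
have -> : sig K u x - u x = av (fun y => (u y - u x) * fej K (x - y)).
  transitivity (av (fun y => u y * fej K (x - y) - u x * fej K (x - y))).
    by rewrite avB ?(avZ (u x) cf) ?av_fej ?mulr1//; cts.
  by congr av; apply/funext => y; rewrite mulrBl.
apply: (@le_trans _ _ (av (fun y => e * fej K (x - y) +
    L / (4 * e * K%:R) * (1 - cos (K%:R * (x - y)))))).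
  apply: av_abs => [||y]; [by cts|by cts|].
  rewrite normrM (ger0_norm (fej_ge0 _ _)).
  have F0 := fej_ge0 K (x - y).
  have FC := fej_closed (x - y) K0.
  have h : `|u y - u x| <= e + (4 * e)^-1 * (L * (1 - cos (x - y))).
    have := lu x y; rewrite -sqr_abs distrC; set a := `|_| => ha.
    apply: (@le_trans _ _ (e + (4 * e)^-1 * a ^+ 2)); last first.
      by rewrite lerD2l ler_wpM2l// invr_ge0 mulr_ge0// ltW.
    rewrite -subr_ge0 (_ : _ - _ = (4 * e)^-1 * (2 * e - a) ^+ 2); last first.
      by field; rewrite gt_eqF.
    by rewrite mulr_ge0 ?sqr_ge0// invr_ge0 mulr_ge0// ltW.
  apply: le_trans (ler_wpM2r F0 h) _; rewrite mulrDl lerD2l.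
  rewrite -!mulrA FC le_eqVlt; apply/orP; left; apply/eqP.
  have en : e != 0 by rewrite gt_eqF.
  have Kn : K%:R != 0 :> R by rewrite pnatr_eq0 -lt0n.
  by field; rewrite en Kn.
rewrite avD ?(avZ e cf) ?av_fej ?mulr1//; [|by cts..].
rewrite avZ; last by cts.
rewrite avB ?av_cst; [|by cts..].
have c0 : 0 <= L / (4 * e * K%:R).
  by rewrite divr_ge0// mulr_ge0// mulr_ge0// ltW.
rewrite lerD2l -[leRHS]mulr1 ler_wpM2l//.
rewrite gerBl (_ : (fun t => cos _) = fun t => cos (K%:R * x) * cos (K%:Z%:~R * t)
  + sin (K%:R * x) * sin (K%:Z%:~R * t)); last first.
  by apply/funext => t; rewrite mulrBr cosB !pmulrn.
rewrite avD ?avZ ?av_cosn; [|cts..].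
rewrite (@av_odd _ (fun t => sin _)); last by move=> t; rewrite mulrN sinN.
by rewrite eqz_nat (gtn_eqF K0) !mulr0 addr0.
Qed.

Lemma sig_unif u L e : cont u -> lipc L u -> 0 <= L -> 0 < e ->
  exists2 K, (0 < K)%N & forall x, `|sig K u x - u x| <= e.
Proof.
move=> cu lu L0 e0; pose K := (Num.truncn (L / e ^+ 2)).+1.
exists K => // x; apply: le_trans (sig_approx x cu lu L0 (divr_gt0 e0 (ltr0n _ 2)) (ltn0Sn _)) _.
have hK : L / e ^+ 2 < K%:R by rewrite /K truncnS_gt.
rewrite ltr_pdivrMr ?exprn_gt0// in hK.
have KR : 0 < K%:R :> R by rewrite ltr0n.
have : L / (4 * (e / 2) * K%:R) <= e / 2.
  rewrite ler_pdivrMr ?mulr_gt0// ?divr_gt0//.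
  have -> : e / 2 * (4 * (e / 2) * K%:R) = K%:R * e ^+ 2 by field.
  exact: (ltW hK).
by move=> h; apply: le_trans (lerD (lexx (e / 2)) h) _; lra.
Qed.

End Fejer.

(** * Decay of the coefficients of C^2 functions *)

Section C2.
Variable R : realType.
Implicit Types (f g h u : R -> R) (x y z t c q D L B e : R) (n k : int) (K : nat).

Definition D2 u := exists u1 u2, [/\ dv u u1, dv u1 u2 & cont u2].

Lemma D2C c : D2 (fun=> c).
Proof. by exists (fun=> 0), (fun=> 0); split; [exact: dvC|exact: dvC|exact: ctsC]. Qed.

Lemma D2I : D2 (fun x => x).
Proof. by exists (fun=> 1), (fun=> 0); split; [exact: dvI|exact: dvC|exact: ctsC]. Qed.

Lemma D2D f g : D2 f -> D2 g -> D2 (fun x => f x + g x).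
Proof.
move=> [f1 [f2 [df1 df2 cf]]] [g1 [g2 [dg1 dg2 cg]]].
exists (fun x => f1 x + g1 x), (fun x => f2 x + g2 x).
by split; [exact: dvD|exact: dvD|cts].
Qed.

Lemma D2M f g : D2 f -> D2 g -> D2 (fun x => f x * g x).
Proof.
move=> [f1 [f2 [df1 df2 cf]]] [g1 [g2 [dg1 dg2 cg]]].
have [cf1 cg1] := (dv_cts df2, dv_cts dg2).
have [cf0 cg0] := (dv_cts df1, dv_cts dg1).
eexists; eexists; split; first exact: dvM.
  by apply: dvD; exact: dvM.
by move: cf0 cg0 cf1 cg1; rewrite -/(cont f) -/(cont g) -/(cont f1) -/(cont g1) => *; cts.
Qed.

Lemma D2N f : D2 f -> D2 (fun x => - f x).
Proof.
move=> [f1 [f2 [df1 df2 cf]]].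
by exists (fun x => - f1 x), (fun x => - f2 x); split; [exact: dvN|exact: dvN|cts].
Qed.

Lemma D2_comp f g : D2 f -> D2 g -> D2 (fun x => g (f x)).
Proof.
move=> [f1 [f2 [df1 df2 cf]]] [g1 [g2 [dg1 dg2 cg]]].
have cf1 : cont f1 := dv_cts df2; have cg1 : cont g1 := dv_cts dg2.
have cf0 : cont f := dv_cts df1.
eexists; eexists; split; first exact: (dv_comp dg1 df1).
  by apply: dvM => //; exact: (dv_comp dg2 df1).
by cts.
Qed.

Lemma D2_cos : D2 (@cos R).
Proof.
exists (fun x => - sin x), (fun x => - cos x); split; first exact: dv_cos.
  by apply: dvN; exact: dv_sin.
by cts.
Qed.

Lemma D2_cont f : D2 f -> cont f.
Proof. by move=> [f1 [f2 [df _ _]]]; exact: (dv_cts df). Qed.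

Lemma dv_unique f g h : dv f g -> dv f h -> g =1 h.
Proof. by move=> fg fh x; have [_ <-] := fg x; have [_ <-] := fh x. Qed.

Lemma dv_per f f' : dv f f' -> periodic2pi f -> periodic2pi f'.
Proof.
move=> df fp k; set c := k%:~R * _.
have d2 : dv (fun x => f (x + c)) (fun x => f' (x + c) * (1 + 0)).
  by apply: dv_comp => //; apply: dvD; [exact: dvI|exact: dvC].
have fE : (fun x => f (x + c)) = f by apply/funext => x; exact: fp.
rewrite fE in d2; have := dv_unique d2 df => e x.
by have := e x; rewrite addr0 mulr1.
Qed.

Lemma ler_sum_subset (T : eqType) (s l : seq T) (F : T -> R) :
  uniq s -> uniq l -> {subset s <= l} -> (forall i, 0 <= F i) ->
  \sum_(i <- s) F i <= \sum_(i <- l) F i.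
Proof.
move=> us ul sl F0.
have p : perm_eq s [seq i <- l | i \in s].
  apply: uniq_perm => //; first exact: filter_uniq.
  by move=> i; rewrite mem_filter; case: (boolP (i \in s)) => // /sl ->.
by rewrite (perm_big _ p) big_filter big_mkcond; apply: ler_sum => i _; case: ifP.
Qed.

Definition wt n : R := if n == 0 then 1 else (n%:~R ^+ 2)^-1.

Lemma wt_ge0 n : 0 <= wt n.
Proof. by rewrite /wt; case: ifP => // _; rewrite invr_ge0 sqr_ge0. Qed.

Lemma sum_wt (s : seq int) : uniq s -> \sum_(n <- s) wt n <= 5.
Proof.
move=> us; pose N := \max_(n <- s) `|n|%N.
pose l := [seq Posz i | i <- iota 0 N.+1] ++ [seq Negz i | i <- iota 0 N.+1].
have ul : uniq l.
  rewrite cat_uniq; apply/and3P; split.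
  - by rewrite map_inj_uniq ?iota_uniq// => ? ? [].
  - by apply/hasPn => _ /mapP[j _ ->]; apply/negP => /mapP[? _].
  - by rewrite map_inj_uniq ?iota_uniq// => ? ? [].
have sl : {subset s <= l}.
  move=> n ns; have : (`|n| <= N)%N by rewrite /N (big_rem n)//= leq_maxl.
  rewrite mem_cat; case: n ns => m _ mN; apply/orP; [left|right].
    by apply/mapP; exists m => //; rewrite mem_iota leq0n add0n ltnS; exact: mN.
  by apply/mapP; exists m => //; rewrite mem_iota leq0n add0n ltnS; exact: ltnW mN.
apply: (@le_trans _ _ (\sum_(n <- l) wt n)).
  by apply: ler_sum_subset => // n; exact: wt_ge0.
rewrite big_cat !big_map.
have half M : \sum_(i <- iota 0 M.+1) (i.+1%:R ^+ 2)^-1 <= 2 - M.+1%:R^-1 :> R.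
  elim: M => [|M IH]; first by rewrite big_cons big_nil expr1n invr1; lra.
  rewrite -addn1 iotaD big_cat /= big_seq1 add0n.
  apply: le_trans (lerD IH (lexx _)) _.
  have M0 : 0 < M.+1%:R :> R by rewrite ltr0n.
  rewrite ?addn1 -(natr1 M.+1); move: M0; move: M.+1%:R => {IH} w w0.
  rewrite -subr_ge0 (_ : _ - _ = (w * (w + 1) ^+ 2)^-1).
    by rewrite invr_ge0 mulr_ge0// ?sqr_ge0// ltW.
  have wn : w != 0 by rewrite gt_eqF.
  have wn1 : w + 1 != 0 by rewrite gt_eqF// addr_gt0.
  by field; rewrite wn wn1.
have h2 M : \sum_(i <- iota 0 M.+1) wt (Negz i) <= 2.
  apply: le_trans (le_trans (half M) _); last by rewrite gerBl invr_ge0 ler0n.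
  by apply: ler_sum => i _; rewrite /wt /= NegzE intrN sqrrN.
have h1 : \sum_(i <- iota 0 N.+1) wt (Posz i) <= 3.
  rewrite /= big_cons {1}/wt eqxx.
  have -> : iota 1 N = [seq i.+1 | i <- iota 0 N] := iotaDl 1 0 N.
  rewrite big_map; case: N {l ul sl} => [|M]; first by rewrite big_nil; lra.
  have : \sum_(i <- iota 0 M.+1) wt (Posz i.+1) <= 2.
    apply: le_trans (le_trans (half M) _); last by rewrite gerBl invr_ge0 ler0n.
    by apply: ler_sum => i _.
  lra.
by apply: le_trans (lerD h1 (h2 N)) _; lra.
Qed.

(** Two integrations by parts at once: [u t * cos (n t) + n^-2 * u2 t * cos (n t)] is the derivative
    of a periodic function and so has mean zero; likewise with sines. The bound [B0] is needed only
    for [n = 0]. *)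
Lemma D2_coef_le u u1 u2 B0 B2 n : dv u u1 -> dv u1 u2 -> cont u2 -> periodic2pi u ->
  (forall x, `|u x| <= B0) -> (forall x, `|u2 x| <= B2) ->
  `|hat u n| <= (B0 + B2) * wt n /\ `|hats u n| <= (B0 + B2) * wt n.
Proof.
move=> d1 d2 c2 up hB0 hB2.
have B00 : 0 <= B0 := le_trans (normr_ge0 _) (hB0 0).
have B20 : 0 <= B2 := le_trans (normr_ge0 _) (hB2 0).
have up1 := dv_per d1 up.
have cu : cont u := dv_cts d1; have c1 : cont u1 := dv_cts d2.
rewrite /wt; have [->|n0] := eqVneq n 0.
  rewrite mulr1 /hats; under eq_fun do rewrite mul0r sin0 mulr0.
  rewrite av_cst normr0 addr_ge0//; split=> //.
  by apply: hat_le_cst => // t; apply: le_trans (hB0 t) _; rewrite lerDl.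
have nR : (n%:~R : R) != 0 by rewrite intr_eq0.
have n2 : 0 < n%:~R ^+ 2 :> R by rewrite exprn_even_gt0.
have sp f : periodic2pi f -> f pi = f (- pi).
  by move=> fp; rewrite -(fp 1 (- pi)) mul1r; congr f; ring.
have e1 := sp _ up; have e2 := sp _ up1.
have dns : dv (fun t => sin (n%:~R * t)) (fun t => cos (n%:~R * t) * n%:~R).
  apply: dv_eq; first (apply: dv_comp; [exact: dv_sin|by apply: dvM; [exact: dvC|exact: dvI]]).
  by move=> t /=; ring.
have dnc : dv (fun t => cos (n%:~R * t)) (fun t => - sin (n%:~R * t) * n%:~R).
  apply: dv_eq; first (apply: dv_comp; [exact: dv_cos|by apply: dvM; [exact: dvC|exact: dvI]]).
  by move=> t /=; ring.
have bnd (F G : R -> R) : cont F -> cont G ->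
    av (fun t => F t + n%:~R ^- 2 * G t) = 0 -> (forall t, `|G t| <= B2) ->
    `|av F| <= (B0 + B2) / n%:~R ^+ 2.
  move=> cF cG; rewrite avD ?avZ//; [|by cts] => /eqP; rewrite addr_eq0 => /eqP -> hG.
  have n2V : 0 <= n%:~R ^- 2 :> R by rewrite invr_ge0 ltW.
  rewrite normrN normrM mulrC (ger0_norm n2V).
  rewrite ler_wpM2r ?invr_ge0 ?(ltW n2)//.
  by apply: le_trans (av_abs_cst cG hG) _; rewrite lerDr.
split.
- apply: (bnd _ (fun t => u2 t * cos (n%:~R * t))); [by cts|by cts| |].
    pose F t := n%:~R^-1 * (u t * sin (n%:~R * t)) + n%:~R ^- 2 * (u1 t * cos (n%:~R * t)).
    apply: (@av_deriv0 _ F); [|by cts|].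
      apply: dv_eq.
        apply: dvD; (apply: dvM; first exact: dvC); apply: dvM; eassumption.
      by move=> t /=; field.
    by rewrite /F e1 e2 !mulrN sinN cosN sin_intpi oppr0.
  by move=> t; rewrite normrM -[leRHS]mulr1 ler_pM ?cos_max.
- apply: (bnd _ (fun t => u2 t * sin (n%:~R * t))); [by cts|by cts| |].
    pose F t := - n%:~R^-1 * (u t * cos (n%:~R * t)) + n%:~R ^- 2 * (u1 t * sin (n%:~R * t)).
    apply: (@av_deriv0 _ F); [|by cts|].
      apply: dv_eq.
        apply: dvD; (apply: dvM; first exact: dvC); apply: dvM; eassumption.
      by move=> t /=; field.
    by rewrite /F e1 e2 !mulrN sinN cosN sin_intpi oppr0.
  by move=> t; rewrite normrM -[leRHS]mulr1 ler_pM ?sin_max.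
Qed.

Lemma D2_coef u : D2 u -> periodic2pi u -> exists2 B : R, 0 <= B &
  forall n, `|hat u n| <= B * wt n /\ `|hats u n| <= B * wt n.
Proof.
move=> [u1 [u2 [d1 d2 c2]]] up.
have [B0 B00 hB0] := per_bounded (dv_cts d1) up.
have [B2 B20 hB2] := per_bounded c2 (dv_per d2 (dv_per d1 up)).
by exists (B0 + B2) => [|n]; [exact: addr_ge0|exact: D2_coef_le d1 d2 c2 up hB0 hB2].
Qed.

Lemma D2_lipc u : D2 u -> periodic2pi u -> exists2 L : R, 0 <= L & lipc L u.
Proof.
move=> [u1 [u2 [d1 d2 c2]]] up.
have [B B0 hB] := per_bounded (dv_cts d2) (dv_per d1 up).
exists (32 * B ^+ 2); first by rewrite mulr_ge0// sqr_ge0.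
by apply: lipc_of => //; exact: mvt_norm.
Qed.

End C2.

(** * Stability of [lq] bounds under combinations, limits and products *)

Section Multiplier.
Variable R : realType.
Implicit Types (f g h u : R -> R) (x y z t c q D L B W e : R) (n k : int) (K : nat).

Lemma powR_half_le q x y : 1 < q ->
  `|2^-1 * (x + y)| `^ q <= 2^-1 * (`|x| `^ q + `|y| `^ q).
Proof.
move=> q1; have := @powR_jensen R q 1 bool [:: true; false] predT (fun=> 2^-1)
  (fun b => if b then x else y) q1 ltr01.
rewrite !big_cons !big_nil !addr0 -!mulrDr powR1 mul1r; apply => //.
by rewrite -mulr2n -[_ *+ 2]mulr_natr mulVf.
Qed.

Lemma lq_ge0 q f D : lq q f D -> 0 <= D.
Proof. by move=> /(_ [::] isT); rewrite big_nil. Qed.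

Lemma lq_le q f D D' : D <= D' -> lq q f D -> lq q f D'.
Proof. by move=> DD h s us; apply: le_trans DD; exact: h. Qed.

Lemma lq1 q f D n : 0 < q -> 0 <= D -> lq q f (D `^ q) -> `|hat f n| <= D.
Proof.
move=> q0 D0 /(_ [:: n] isT); rewrite big_seq1 leNgt => h.
rewrite leNgt; apply/negP => Dn; move/negP: h; apply.
by apply: gt0_ltr_powR.
Qed.

Lemma sum_powR_shift q f D k (s : seq int) : lq q f D -> uniq s ->
  \sum_(n <- s) `|hat f (n + k)| `^ q <= D.
Proof.
move=> fD us; have := fD [seq n + k | n <- s]; rewrite big_map; apply.
by rewrite map_inj_uniq// => i j /addIr.
Qed.

Lemma lqD q f g D1 D2 : 1 < q -> cont f -> cont g -> lq q f D1 -> lq q g D2 ->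
  lq q (fun t => f t + g t) (2 `^ q * (D1 + D2)).
Proof.
move=> q1 cf cg fD gD s us; apply: (@le_trans _ _ (\sum_(n <- s)
    2 `^ q * (`|hat f n| `^ q + `|hat g n| `^ q))).
  by apply: ler_sum => n _; rewrite hatD//; exact: powR_normD_le.
rewrite -mulr_sumr big_split ler_wpM2l ?powR_ge0//.
exact: lerD (fD s us) (gD s us).
Qed.

Lemma lq_cosM q f D k : 1 < q -> cont f -> lq q f D ->
  lq q (fun t => f t * cos (k%:~R * t)) D.
Proof.
move=> q1 cf fD s us; apply: (@le_trans _ _ (\sum_(n <- s)
   2^-1 * (`|hat f (n + k)| `^ q + `|hat f (n - k)| `^ q))).
  by apply: ler_sum => n _; rewrite hat_cosM// powR_half_le.
rewrite -mulr_sumr big_split/= (splitr D).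
have := lerD (sum_powR_shift k fD us) (sum_powR_shift (- k) fD us).
move: (_ + _) => S hS; have : 2^-1 * S <= 2^-1 * (D + D) by rewrite ler_wpM2l.
move=> h; apply: le_trans h _; clear; lra.
Qed.

(** A form of Minkowski's inequality: Jensen at each frequency with weights [|w i|], the signs of
    the [w i] being moved into the values. *)
Lemma lq_comb q I (r : seq I) (w : I -> R) (F : I -> R -> R) W D :
  1 < q -> 0 < W -> 0 <= D -> (forall i, cont (F i)) -> (forall i, lq q (F i) D) ->
  \sum_(i <- r) `|w i| <= W ->
  lq q (fun t => \sum_(i <- r) w i * F i t) (W `^ q * D).
Proof.
move=> q1 W0 D0 cF FD wW s us.
have W1 : W `^ (q - 1) * W = W `^ q by rewrite mulrC mulr_powRB1// ?(lt_trans _ q1)// ltW.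
apply: (@le_trans _ _ (\sum_(n <- s) W `^ (q - 1) *
   \sum_(i <- r) `|w i| * `|hat (F i) n| `^ q)).
  apply: ler_sum => n _; rewrite hat_sum; last by move=> i; cts.
  have := @powR_jensen R q W I r predT (fun i => `|w i|)
    (fun i => Num.sg (w i) * hat (F i) n) q1 W0 (fun i => normr_ge0 _) wW.
  rewrite (eq_bigr (fun i => hat (fun t => w i * F i t) n)); last first.
    by move=> i _; rewrite hatZ// mulrA [_ * Num.sg _]mulrC -numEsg.
  move=> h; apply: le_trans h _; rewrite ler_wpM2l ?powR_ge0//.
  apply: ler_sum => i _; have [->|w0] := eqVneq (w i) 0; first by rewrite normr0 !mul0r.
  by rewrite normrM normr_sg w0 mul1r.
rewrite -mulr_sumr -W1 -mulrA ler_wpM2l ?powR_ge0// exchange_big /=.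
apply: (@le_trans _ _ (\sum_(i <- r) `|w i| * D)).
  by apply: ler_sum => i _; rewrite -mulr_sumr ler_wpM2l//; exact: FD.
by rewrite -mulr_suml ler_wpM2r.
Qed.

(** For a fixed finite set of frequencies uniform closeness of coefficients suffices: the error [d]
    is chosen after [s], small compared with its size. The factor [2 ^ q] is the price of splitting
    [hat f n] by [powR_normD_le]. *)
Lemma lq_limit q f D : 1 < q -> cont f ->
  (forall e, 0 < e -> exists g, [/\ cont g, lq q g D & forall n, `|hat f n - hat g n| <= e]) ->
  lq q f (2 `^ q * D).
Proof.
move=> q1 cf H s us.
have q0 : 0 < q by rewrite (lt_trans _ q1).
apply/ler_addgt0Pr => e e0.
pose m := 2 `^ q * (size s)%:R + 1.
have m0 : 0 < m by rewrite ltr_wpDl// mulr_ge0// powR_ge0.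
pose d := Num.min 1 (e / m).
have d0 : 0 < d by rewrite lt_min ltr01 divr_gt0.
have [g [cg gD fg]] := H d d0.
apply: (@le_trans _ _ (\sum_(n <- s) 2 `^ q * (`|hat g n| `^ q + d))).
  apply: ler_sum => n _.
  have -> : hat f n = hat g n + (hat f n - hat g n) by rewrite addrC subrK.
  apply: le_trans (powR_normD_le _ _ q1) _; rewrite ler_wpM2l ?powR_ge0// lerD2l.
  apply: (@le_trans _ _ (d `^ q)).
    by apply: ge0_ler_powR; rewrite ?nnegrE ?(ltW q0) ?(ltW d0) ?fg.
  by rewrite ge1r_powR ?(ltW q1)// d0 ge_min lexx.
rewrite -mulr_sumr big_split mulrDr lerD//=.
  by rewrite ler_wpM2l ?powR_ge0//; exact: gD.
have -> : \sum_(i <- s) d = (size s)%:R * d.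
  by rewrite big_const_seq count_predT iter_addr_0 mulr_natl.
rewrite mulrA.
apply: (@le_trans _ _ (m * (e / m))); last by rewrite mulrCA divff ?mulr1// gt_eqF.
rewrite ler_pM ?(ltW d0)// ?mulr_ge0 ?powR_ge0//; first by rewrite /m lerDl.
by rewrite ge_min lexx orbT.
Qed.

(* Fejer sums exhibit a C^2 even function as a limit of cosine polynomials with
   uniformly summable coefficients, and each cosine preserves [lq]. *)
Lemma C2_multiplier q u : 1 < q -> D2 u -> periodic2pi u ->
  (forall x, u (- x) = u x) ->
  exists2 C : R, 0 <= C & forall h D, cont h -> lq q h D ->
    lq q (fun t => u t * h t) (C * D).
Proof.
move=> q1 du up ue; have cu := D2_cont du.
have [B B0 hB] := D2_coef du up.
have [L L0 uL] := D2_lipc du up.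
have hs0 n : hats u n = 0 by apply: av_odd => t; rewrite ue mulrN sinN mulrN.
pose W := B * 5 + 1.
have W0 : 0 < W by rewrite ltr_wpDl// mulr_ge0.
exists (2 `^ q * W `^ q); first by rewrite mulr_ge0// powR_ge0.
move=> h D ch hD; rewrite -mulrA; apply: lq_limit => //; first by cts.
pose M := av (fun t => `|h t|) + 1.
have M0 : 0 < M by rewrite ltr_wpDl// av_ge0//; cts.
move=> e e0; have [K K0 hK] := sig_unif cu uL L0 (divr_gt0 e0 M0).
have cs := @cont_sig _ K _ cu.
exists (fun t => sig K u t * h t); split; [by cts| |move=> n]; last first.
  rewrite -hatB; [|by cts|by cts].
  apply: (@le_trans _ _ (av (fun t => e / M * `|h t|))).
    apply: av_abs => [||t]; [by cts|by cts|].
    rewrite -mulrBl normrM; apply: (@le_trans _ _ (e / M * `|h t| * 1)); last by rewrite mulr1.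
    rewrite ler_pM ?cos_max// normrM ler_wpM2r// distrC; exact: hK.
  rewrite avZ; last by cts.
  rewrite mulrAC ler_pdivrMr// ler_wpM2l ?(ltW e0)// /M lerDl//.
have -> : (fun t => sig K u t * h t) = (fun t => \sum_(p <- index_enum ('I_K * 'I_K)%type)
    (K%:R^-1 * hat u (p.1%:Z - p.2%:Z)) * (h t * cos ((p.1%:Z - p.2%:Z)%:~R * t))).
  apply/funext => t; rewrite sigE// pair_bigA mulrAC -mulrA !mulr_sumr.
  by apply: eq_bigr => p _ /=; rewrite hs0 mul0r addr0; ring.
apply: (@lq_comb q _ _ (fun p : 'I_K * 'I_K => K%:R^-1 * hat u (p.1%:Z - p.2%:Z))
  (fun p t => h t * cos ((p.1%:Z - p.2%:Z)%:~R * t)) W D q1 W0 (lq_ge0 hD)).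
- by move=> p; cts.
- by move=> p; exact: lq_cosM.
rewrite -(pair_bigA _ (fun i j : 'I_K => `|K%:R^-1 * hat u (i%:Z - j%:Z)|)) /=.
apply: (@le_trans _ _ (\sum_(i < K) K%:R^-1 * W)).
  apply: ler_sum => i _; under eq_bigr do rewrite normrM.
  rewrite -mulr_sumr ger0_norm ?invr_ge0// ler_wpM2l ?invr_ge0//.
  have wl := @le_trans _ R (\sum_(j <- [seq i%:Z - (nat_of_ord m)%:Z | m : 'I_K <- index_enum 'I_K]) B * wt R j). apply: wl.
    by rewrite big_map; apply: ler_sum => j _; have [] := hB (i%:Z - j%:Z).
  rewrite -mulr_sumr; apply: (@le_trans _ _ (B * 5)); last by rewrite /W lerDl.
  rewrite ler_wpM2l// sum_wt// map_inj_uniq ?index_enum_uniq// => a b /addrI /oppr_inj [] ab.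
  exact: val_inj.
rewrite sumr_const card_ord -(mulr_natl (K%:R^-1 * W)) mulrA divff ?mul1r//.
by rewrite pnatr_eq0 -lt0n.
Qed.

End Multiplier.
(** * Riesz products and lacunary sums *)

Section Riesz.
Variable R : realType.
Implicit Types (f g h u : R -> R) (x y z t c q D H s : R) (n k : int) (m : nat) (tau : nat -> R).

(* [rz m tau] is the sum over [e] in [{-1, 0, 1}^m] of
   [tau (number of nonzero e_k) * cos ((\sum_k e_k 9^k) t)]. *)
Fixpoint rz m tau t : R := if m is m'.+1 then
    rz m' tau t + 2 * (rz m' (tau \o S) t * cos ((9 ^ m')%:Z%:~R * t))
  else tau 0%N.

Lemma cont_rz m tau : cont (rz m tau).
Proof.
elim: m tau => [|m IH] tau /=; first exact: ctsC.
by have := IH tau; have := IH (tau \o S) => *; cts.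
Qed.

Lemma hat_rzS m tau n : hat (rz m.+1 tau) n = hat (rz m tau) n +
  (hat (rz m (tau \o S)) (n + (9 ^ m)%:Z) + hat (rz m (tau \o S)) (n - (9 ^ m)%:Z)).
Proof.
have c1 := @cont_rz m tau; have c2 := @cont_rz m (tau \o S).
rewrite [rz _.+1 _]/=.
rewrite hatD//; last by cts.
rewrite hatZ; last by cts.
by rewrite hat_cosM// mulrA mulfV ?mul1r// pnatr_eq0.
Qed.

Lemma hat_cst c n : hat (fun=> c) n = c * (n == 0)%:R.
Proof.
rewrite -hat1 -hatZ; last exact: ctsC.
by congr hat; apply/funext => t; rewrite mulr1.
Qed.

(** The largest frequency present is the sum of [9 ^ k] over [k < m], which is [(9 ^ m - 1) / 8]. *)
Lemma rz_spec m tau n : (9 ^ m <= 8 * `|n|)%N -> hat (rz m tau) n = 0.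
Proof.
elim: m tau n => [|m IH] tau n hn.
  by rewrite hat_cst; case: eqP => [n0|]; [rewrite n0 in hn|rewrite mulr0].
rewrite hat_rzS !IH ?addr0//; move: hn; rewrite expnS; move: (9 ^ m)%N => b; lia.
Qed.

Lemma sum_delta (c : R) (r : seq int) : 0 <= c -> uniq r ->
  \sum_(n <- r) c * (n == 0)%:R <= c.
Proof.
move=> c0; elim: r => [|n r IH]; first by rewrite big_nil.
rewrite cons_uniq big_cons => /andP[nr ur].
have [n0|n0] := eqVneq n 0; last by rewrite mulr0 add0r IH.
rewrite mulr1 big1_seq ?addr0// => j /= jr; case: eqP => [j0|]; last by rewrite mulr0.
by rewrite n0 -j0 jr in nr.
Qed.

(** Passing from [m] to [m + 1] adds two translates of a spectrum by [9 ^ m] and [- 9 ^ m]. The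
    three blocks are disjoint by [rz_spec], so the [q]-th powers simply add, which produces the
    factor [1 + 2 * y]. *)
Lemma rz_lq q m tau H y : 1 < q -> 0 <= y ->
  (forall d, `|tau d| `^ q <= H * y ^+ d) ->
  lq q (rz m tau) (H * (1 + 2 * y) ^+ m).
Proof.
move=> q1 y0; have q0 : q != 0 by rewrite gt_eqF// (lt_trans _ q1).
have z0 : (0 : R) `^ q = 0 by rewrite powR0.
elim: m tau H => [|m IH] tau H tH r ur.
  apply: (@le_trans _ _ (\sum_(n <- r) `|tau 0%N| `^ q * (n == 0)%:R)).
    apply: ler_sum => n _; rewrite hat_cst.
    by case: eqP => _; rewrite ?mulr1// !mulr0 normr0 z0.
  by apply: le_trans (sum_delta (powR_ge0 _ _) ur) _; have := tH 0%N; rewrite !expr0.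
have tH' d : `|(tau \o S) d| `^ q <= (H * y) * y ^+ d.
  by have := tH d.+1; rewrite exprS mulrA.
have h1 := IH _ _ tH; have h2 := IH _ _ tH'.
set b := (9 ^ m)%N.
apply: (@le_trans _ _ (\sum_(n <- r) (`|hat (rz m tau) n| `^ q +
    (`|hat (rz m (tau \o S)) (n + b%:Z)| `^ q + `|hat (rz m (tau \o S)) (n - b%:Z)| `^ q)))).
  apply: ler_sum => n _; rewrite hat_rzS -/b.
  have [B1|B1] := leqP b (8 * `|n|)%N; last first.
    rewrite [hat _ (n + _)]rz_spec; last by rewrite -/b; lia.
    rewrite [hat _ (n - _)]rz_spec; last by rewrite -/b; lia.
    by rewrite normr0 z0 !addr0.
  rewrite [hat _ n]rz_spec// normr0 z0 !add0r.
  have [B2|B2] := leqP b (8 * absz (n + b%:Z)%R)%N; last first.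
    rewrite [hat _ (n - _)]rz_spec; last by rewrite -/b; lia.
    by rewrite normr0 z0 !addr0.
  by rewrite [hat _ (n + _)]rz_spec// normr0 z0 !add0r.
rewrite big_split big_split /=.
have s1 := h1 r ur; have s2 := sum_powR_shift b%:Z h2 ur.
have s3 := sum_powR_shift (- b%:Z) h2 ur.
apply: le_trans (lerD s1 (lerD s2 s3)) _.
by rewrite exprS le_eqVlt; apply/orP; left; apply/eqP; ring.
Qed.

Lemma rzZ m tau c t : rz m (fun d => c * tau d) t = c * rz m tau t.
Proof.
elim: m tau => [//|m IH] tau /=; rewrite IH.
have -> : (fun d => c * tau d) \o S = (fun d => c * (tau \o S) d) by [].
by rewrite IH; ring.
Qed.

Lemma rzB m tau tau' t :
  rz m (fun d => tau d - tau' d) t = rz m tau t - rz m tau' t.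
Proof.
elim: m tau tau' => [//|m IH] tau tau' /=; rewrite IH.
have -> : (fun d => tau d - tau' d) \o S = (fun d => (tau \o S) d - (tau' \o S) d) by [].
by rewrite IH; ring.
Qed.

Lemma rz_delta m t : rz m (fun d => (d == 0)%:R) t = 1.
Proof.
elim: m => [//|m IH] /=; rewrite IH.
have -> : (fun d => (d == 0)%:R) \o S = (fun d : nat => 0 * (d == 0)%:R : R).
  by apply/funext => d /=; rewrite mul0r.
by rewrite rzZ mul0r mul0r mulr0 addr0.
Qed.

Definition rp m s t : R := \prod_(k < m) (1 + s * cos ((9 ^ k)%:Z%:~R * t)).

Lemma rpE m s t : rp m s t = rz m (fun d => (s / 2) ^+ d) t.
Proof.
elim: m => [|m IH]; first by rewrite /rp big_ord0.
rewrite /rp big_ord_recr /= -/(rp m s t) IH.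
have -> : (fun d => (s / 2) ^+ d) \o S = (fun d => (s / 2) * (s / 2) ^+ d).
  by apply/funext => d /=; rewrite exprS.
by rewrite rzZ; field.
Qed.

Lemma cont_rp m s : cont (rp m s).
Proof. by rewrite /rp; cts. Qed.

(** The [m]-th forward difference up to the sign [(- 1) ^ m]. *)
Fixpoint fd m (F : nat -> R) (j : nat) : R :=
  if m is m'.+1 then fd m' F j - fd m' F j.+1 else F j.

Lemma rz_fd m l (tau : nat -> nat -> R) j t :
  rz m (fun d => fd l (fun i => tau i d) j) t = fd l (fun i => rz m (tau i) t) j.
Proof. by elim: l j => [//|l IH] j /=; rewrite rzB !IH. Qed.

Lemma eq_fd l F G j : F =1 G -> fd l F j = fd l G j.
Proof. by move=> FG; elim: l j => [|l IH] j /=; rewrite ?FG ?IH. Qed.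

Lemma fdZ l c F j : fd l (fun i => c * F i) j = c * fd l F j.
Proof. by elim: l j => [//|l IH] j /=; rewrite !IH mulrBr. Qed.

Lemma fdD l F G j : fd l (fun i => F i + G i) j = fd l F j + fd l G j.
Proof. by elim: l j => [//|l IH] j /=; rewrite !IH; ring. Qed.

Lemma fd_shift l F j : fd l F j.+1 = fd l (F \o S) j.
Proof. by elim: l j => [//|l IH] j /=; rewrite !IH. Qed.

Lemma fd_sum l (r : seq nat) (F : nat -> nat -> R) j :
  fd l (fun i => \sum_(a <- r) F a i) j = \sum_(a <- r) fd l (F a) j.
Proof.
elim: r => [|a r IH].
  rewrite big_nil (@eq_fd _ _ (fun=> 0)) => [|i]; last by rewrite big_nil.
  by elim: l j => [//|l IH] j /=; rewrite !IH subrr.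
by rewrite big_cons -IH -fdD; apply: eq_fd => i; rewrite big_cons.
Qed.

Lemma fd_pow l d j : (d < l)%N -> fd l (fun i => i%:R ^+ d) j = 0.
Proof.
elim: l d j => [//|l IH] d j dl /=.
rewrite fd_shift -[X in _ - X]mul1r -mulNr -fdZ -fdD.
rewrite (@eq_fd _ _ (fun i => \sum_(a <- index_iota 0 d) (- 1 *+ 'C(d, a)) * i%:R ^+ a)).
  rewrite fd_sum big_seq big1// => a; rewrite mem_index_iota => /andP[_ ad].
  by rewrite fdZ IH ?mulr0// (leq_trans ad).
move=> i /=; rewrite mulN1r -natr1 [i%:R + 1]addrC exprDn big_ord_recr /= subnn expr0 binn mul1r mulr1n.
rewrite opprD addrCA subrr addr0 -sumrN big_mkord; apply: eq_bigr => a _.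
by rewrite expr1n mul1r [in RHS]mulNrn mulNr mulr_natl.
Qed.

(** The right-hand side is the Beta value [B (j, l + 1)]. *)
Lemma fd_inv l j : (0 < j)%N ->
  fd l (fun i => i%:R^-1) j = l`!%:R / \prod_(i < l.+1) (j + i)%:R.
Proof.
elim: l j => [|l IH] j j0 /=.
  by rewrite big_ord_recr big_ord0 /= mul1r addn0 mul1r.
rewrite !IH//.
set A := \prod_(i < l) (j.+1 + i)%:R : R.
have e1 : \prod_(i < l.+1) (j + i)%:R = j%:R * A :> R.
  rewrite big_ord_recl addn0; congr (_ * _); apply: eq_bigr => i _.
  by rewrite /= /bump leq0n add1n addnS addSn.
have e2 : \prod_(i < l.+1) (j.+1 + i)%:R = A * (j.+1 + l)%:R :> R by rewrite big_ord_recr.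
have e3 : \prod_(i < l.+2) (j + i)%:R = j%:R * (A * (j.+1 + l)%:R) :> R.
  rewrite big_ord_recl addn0 -e2; congr (_ * _); apply: eq_bigr => i _.
  by rewrite /= /bump leq0n add1n addnS addSn.
rewrite e1 e2 e3 factS natrM.
have A0 : A != 0 by apply/prodf_neq0 => i _; rewrite pnatr_eq0.
have j0' : j%:R != 0 :> R by rewrite pnatr_eq0 -lt0n.
have jl : (j.+1 + l)%:R = j%:R + l.+1%:R :> R by rewrite -natrD addSnnS.
have jl0 : j%:R + l.+1%:R != 0 :> R by rewrite -jl pnatr_eq0.
rewrite jl; move: (l.+1%:R : R) (l`!%:R : R) jl0 => w v jl0.
by field; rewrite A0 j0' jl0.
Qed.

(** At [j = l] the difference is the inverse of [l * 'C(2 l, l)], and the binomial is at most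
    [4 ^ l]. This bounds the inverse of the normalising constant of [psi]. *)
Lemma fd_inv_ge l : (0 < l)%N -> 1 <= l%:R * 4 ^+ l * fd l (fun i => i%:R^-1) l.
Proof.
move=> l0; rewrite fd_inv//.
have -> : \prod_(i < l.+1) (l + i)%:R = l%:R * \prod_(i < l) (l + i.+1)%:R :> R.
  by rewrite big_ord_recl addn0.
have P0 : 0 < \prod_(i < l) (l + i.+1)%:R :> R by apply: prodr_gt0 => i _; rewrite ltr0n addnS.
have lR : l%:R != 0 :> R by rewrite pnatr_eq0 -lt0n.
set P := \prod_(i < l) _ in P0 *.
have -> : l%:R * 4 ^+ l * (l`!%:R / (l%:R * P)) = 4 ^+ l * l`!%:R / P.
  by field; rewrite lR gt_eqF.
rewrite ler_pdivlMr// mul1r /P {P P0}.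
have fact (k : nat) : (\prod_(i < k) (l + i.+1) * l`! = (l + k)`!)%N.
  elim: k => [|k IH]; first by rewrite big_ord0 mul1n addn0.
  by rewrite big_ord_recr /= mulnAC IH mulnC addnS factS.
have Pl : (\prod_(i < l) (l + i.+1) = 'C(l + l, l) * l`!)%N.
  apply/eqP; rewrite -(eqn_pmul2r (fact_gt0 l)) fact -mulnA.
  by have := bin_fact (leq_addr l l); rewrite addnK => ->.
have bin4 : ('C(l + l, l) <= 4 ^ l)%N.
  have -> : (4 ^ l = (1 + 1) ^ (l + l))%N by rewrite expnD -expnMn.
  rewrite expnDn (bigD1 (Ordinal (leq_addr l l : l < (l + l).+1)%N)) //=.
  by rewrite !exp1n !muln1 leq_addr.
rewrite -natr_prod Pl -natrX -natrM ler_nat leq_mul2r bin4 orbT//.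
Qed.

End Riesz.

(** * Independence of lacunary cosines and exponential moments *)

Section Independence.
Variable R : realType.
Implicit Types (f g h u : R -> R) (x y z t c q D H s e : R) (n : int) (m : nat) (a b : nat -> R).

Definition pt a x : R := \sum_(l < 5) a l * cos (l%:Z%:~R * x).

Definition hp a m t : R := \prod_(k < m) pt a ((9 ^ k)%:Z%:~R * t).

Lemma cont_hp a m : cont (hp a m).
Proof. by rewrite /hp /pt; cts. Qed.

Lemma hat_hpS a m n : hat (hp a m.+1) n = \sum_(l < 5) a l *
  (2^-1 * (hat (hp a m) (n + (l * 9 ^ m)%:Z) + hat (hp a m) (n - (l * 9 ^ m)%:Z))).
Proof.
have ch := @cont_hp a m.
have -> : hp a m.+1 = (fun t => \sum_(l < 5) a l * (hp a m t * cos ((l * 9 ^ m)%:Z%:~R * t))).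
  apply/funext => t; rewrite /hp big_ord_recr /= -/(hp a m t) mulr_sumr.
  by apply: eq_bigr => l _; rewrite mulrCA; congr (_ * (_ * cos _)); rewrite PoszM intrM mulrA.
rewrite hat_sum; last by move=> l; cts.
by apply: eq_bigr => l _; rewrite hatZ ?hat_cosM//; cts.
Qed.

(** The factor of index [k] contributes at most [4 * 9 ^ k], and these add up to [(9 ^ m - 1) / 2].
    The base 9 is [2 * 4 + 1], just enough for polynomials of degree four. *)
Lemma hp_spec a m n : (9 ^ m <= 2 * `|n|)%N -> hat (hp a m) n = 0.
Proof.
elim: m n => [|m IH] n hn.
  have -> : hp a 0 = (fun=> 1) by apply/funext => t; rewrite /hp big_ord0.
  by rewrite hat1; case: eqP => // n0; rewrite n0 in hn.
rewrite hat_hpS big1// => -[l l5] _ /=; rewrite !IH ?addr0 ?mulr0//;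
  move: hn; rewrite expnS; move: (9 ^ m)%N => w; nia.
Qed.

(* The frequencies of [hp a m] stay below [9 ^ m / 2], so the factors
   [pt a (9 ^ k t)] behave as independent random variables. *)
Lemma av_hp a m : av (hp a m) = a 0%N ^+ m.
Proof.
rewrite -hat0; elim: m => [|m IH].
  have -> : hp a 0 = (fun=> 1) by apply/funext => t; rewrite /hp big_ord0.
  by rewrite hat1 expr0.
rewrite hat_hpS big_ord_recl /= mul0n -[Posz 0]/(0 : int) oppr0 !addr0 IH exprS.
have -> : 2^-1 * (a 0%N ^+ m + a 0%N ^+ m) = a 0%N ^+ m :> R by field.
rewrite big1 ?addr0// => -[l l5] _ /=.
rewrite !hp_spec ?addr0 ?mulr0//; have := expn_gt0 9 m; rewrite /bump leq0n /=;
  move: (9 ^ m)%N => w; nia.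
Qed.

(** The constant term is the mean: the square and the fourth power of a cosine have means 1/2 and
    3/8. *)
Lemma quartic_pt b : exists a, a 0%N = b 0%N + b 2 / 2 + 3 * b 4 / 8 /\
  forall x, \sum_(l < 5) b l * cos x ^+ l = pt a x.
Proof.
exists (fun l => match l with
  | 0%N => b 0%N + b 2 / 2 + 3 * b 4 / 8 | 1%N => b 1%N + 3 * b 3 / 4
  | 2 => b 2 / 2 + b 4 / 2 | 3 => b 3 / 4 | _ => b 4 / 8 end).
split=> // x; rewrite /pt !big_ord_recr !big_ord0 /=.
have c2 : cos (2 * x) = 2 * cos x ^+ 2 - 1.
  by rewrite mulr_natl cos_mulr2n -[_ *+ 2]mulr_natl.
have s2 : sin (2 * x) = 2 * (cos x * sin x) by rewrite !mulr_natl sin_mulr2n.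
have c3 : cos (3 * x) = 4 * cos x ^+ 3 - 3 * cos x.
  have -> : 3 * x = 2 * x + x by ring.
  rewrite cosD c2 s2 -mulrA -[_ * sin x * sin x]mulrA -expr2 sin2cos2; ring.
have c4 : cos (4 * x) = 8 * cos x ^+ 4 - 8 * cos x ^+ 2 + 1.
  have -> : 4 * x = 2 * (2 * x) by ring.
  by rewrite mulr_natl cos_mulr2n c2 mulr2n; ring.
rewrite -!pmulrn mul0r cos0 mul1r c2 c3 c4; by field.
Qed.

(** A quadratic majorant keeps [(1 + s c)^2 expR (e c)] below a quartic in the cosine [c]. It
    follows from [expR (- v) >= 1 - v] with [v = u / 4], raised to the power [- 4]. *)
Lemma expR_le_quad (u : R) : `|u| <= 10^-1 -> expR u <= 1 + u + 2 / 3 * u ^+ 2.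
Proof.
rewrite ler_norml => /andP[u1 u2].
pose v := u / 4; have v1 : - 40^-1 <= v by rewrite /v; lra.
have v2 : v <= 40^-1 by rewrite /v; lra.
have uE : u = 4 * v by rewrite /v; field.
have e1 : 1 - v <= expR (- v) by exact: expR_ge1Dx.
have w0 : 0 < 1 - v by lra.
have eu : expR u = (expR (- v))^-1 ^+ 4.
  by rewrite -expRN opprK -expRM_natl uE; congr expR; ring.
have h : expR u <= (1 - v)^-1 ^+ 4.
  by rewrite eu lerXn2r ?nnegrE ?invr_ge0 ?expR_ge0 ?(ltW w0)// lef_pV2 ?posrE ?expR_gt0.
apply: le_trans h _; rewrite exprVn -div1r ler_pdivrMr ?exprn_gt0// uE.
have v20 := sqr_ge0 v.
have p : 0 <= 2 / 3 - 68 / 3 * v + 49 * v ^+ 2 - 116 / 3 * v ^+ 3 + 32 / 3 * v ^+ 4.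
  have v3 : v ^+ 3 <= 40^-1 * v ^+ 2 by rewrite exprS ler_wpM2r.
  have v4 : 0 <= v ^+ 4 by rewrite (exprM v 2 2) sqr_ge0.
  lra.
have := mulr_ge0 v20 p; lra.
Qed.

Definition cs m t : R := \sum_(k < m) cos ((9 ^ k)%:Z%:~R * t).

Lemma cont_cs m : cont (cs m).
Proof. by rewrite /cs; cts. Qed.

Lemma av_rp_expR m s e : `|e| <= 10^-1 ->
  av (fun t => rp m s t ^+ 2 * expR (e * cs m t)) <=
  (1 + 2^-1 * (s ^+ 2 + 2 * s * e + 2 / 3 * e ^+ 2) + 4^-1 * s ^+ 2 * e ^+ 2) ^+ m.
Proof.
move=> e1.
(* The coefficients of [(1 + s c)^2 (1 + e c + 2/3 e^2 c^2)]. *)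
pose b l : R := match l with 0%N => 1 | 1%N => 2 * s + e
  | 2 => s ^+ 2 + 2 * s * e + 2 / 3 * e ^+ 2
  | 3 => s ^+ 2 * e + 4 / 3 * s * e ^+ 2 | _ => 2 / 3 * s ^+ 2 * e ^+ 2 end.
have [a [a0 ha]] := quartic_pt b.
have -> : 1 + 2^-1 * (s ^+ 2 + 2 * s * e + 2 / 3 * e ^+ 2) + 4^-1 * s ^+ 2 * e ^+ 2 = a 0%N.
  by rewrite a0 /b /=; field.
have cr := @cont_rp R m s; have cc := @cont_cs m.
rewrite -av_hp; apply: av_le => [||t]; [by cts|exact: cont_hp|].
rewrite /rp /cs /hp -prodrXl mulr_sumr expR_sum -big_split.
apply: ler_prod => k _ /=; set x := _ * t; rewrite -ha.
rewrite !big_ord_recr big_ord0 /= /b.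
have ex : expR (e * cos x) <= 1 + e * cos x + 2 / 3 * (e * cos x) ^+ 2.
  apply: expR_le_quad; rewrite normrM; apply: le_trans e1.
  by rewrite ler_piMr// cos_max.
rewrite mulr_ge0 ?sqr_ge0 ?expR_ge0//=.
apply: le_trans (ler_wpM2l (sqr_ge0 _) ex) _.
by rewrite le_eqVlt; apply/orP; left; apply/eqP; field.
Qed.

(** A Chernoff bound for the event that [cs m] is below [s0 m / 16], under the weight [rp m s ^+ 2].
    The exponent [- 3/2 s] minimises [s^2 + 2 s e + 2/3 e^2] over [e]; the resulting rate, nearly
    [- s^2 / 4] per factor, outweighs the growth of the weight. *)
Lemma av_tail_low m s s0 : 0 < s0 -> s0 <= s -> s <= 15^-1 ->
  av (fun t => rp m s t ^+ 2 * expR (- (3 / 2 * s) * (cs m t - s0 * m%:R / 16)))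
    <= expR (- (s0 ^+ 2 * m%:R / 8)).
Proof.
move=> s00 ss s1; have sp : 0 < s by apply: lt_le_trans ss.
have cr := @cont_rp R m s; have cc := @cont_cs m.
have -> : (fun t => rp m s t ^+ 2 * expR (- (3 / 2 * s) * (cs m t - s0 * m%:R / 16))) =
  (fun t => expR (3 / 2 * s * (s0 * m%:R / 16)) * (rp m s t ^+ 2 * expR (- (3 / 2 * s) * cs m t))).
  apply/funext => t; rewrite mulrCA -expRD; congr (_ * expR _); ring.
rewrite avZ; last by cts.
have := @av_rp_expR m s (- (3 / 2 * s)).
rewrite normrN ger0_norm; last by lra.
have -> : 3 / 2 * s <= 10^-1 by lra.
move=> /(_ isT) h; apply: le_trans (ler_wpM2l (expR_ge0 _) h) _.
set z := _ ^+ m.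
have s225 : s ^+ 2 <= 225^-1.
  have -> : 225^-1 = 15^-1 ^+ 2 :> R by field.
  by rewrite lerXn2r ?nnegrE ?invr_ge0// ltW.
have s2 := sqr_ge0 s.
have hz : z <= expR (- (6 / 25 * s ^+ 2 * m%:R)).
  rewrite -mulNr expRM_natr; apply: lerXn2r; rewrite ?nnegrE ?expR_ge0//.
    have := mulr_ge0 s2 s2; lra.
  apply: le_trans (expR_ge1Dx _).
  have := ler_wpM2l s2 s225; lra.
apply: le_trans (ler_wpM2l (expR_ge0 _) hz) _.
rewrite -expRD ler_expR.
have m0 : 0 <= m%:R :> R by [].
have a1 : s0 * s <= s ^+ 2 by rewrite expr2 ler_wpM2r ?(ltW sp).
have a2 : s0 ^+ 2 <= s ^+ 2 by rewrite lerXn2r ?nnegrE ?(ltW sp) ?(ltW s00).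
have := ler_wpM2r m0 a1; have := ler_wpM2r m0 a2; have := mulr_ge0 (sqr_ge0 s) m0; lra.
Qed.

(** With the exponent [s] the moment grows by at most [2 s^2] per factor, while the threshold [8 s0]
    lowers the rate by [8 s s0 >= 4 s^2], thanks to [s <= 2 * s0]. *)
Lemma av_tail_up m s s0 : 0 < s0 -> s0 <= s -> s <= 2 * s0 -> s <= 15^-1 ->
  av (fun t => rp m s t ^+ 2 * expR (s * (cs m t - 8 * s0 * m%:R)))
    <= expR (- (s0 ^+ 2 * m%:R / 8)).
Proof.
move=> s00 ss s2s s1; have sp : 0 < s by apply: lt_le_trans ss.
have cr := @cont_rp R m s; have cc := @cont_cs m.
have -> : (fun t => rp m s t ^+ 2 * expR (s * (cs m t - 8 * s0 * m%:R))) =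
  (fun t => expR (- (s * (8 * s0 * m%:R))) * (rp m s t ^+ 2 * expR (s * cs m t))).
  apply/funext => t; rewrite mulrCA -expRD; congr (_ * expR _); ring.
rewrite avZ; last by cts.
have := @av_rp_expR m s s; rewrite ger0_norm ?(ltW sp)//.
have -> : s <= 10^-1 by lra.
move=> /(_ isT) h; apply: le_trans (ler_wpM2l (expR_ge0 _) h) _.
set z := _ ^+ m.
have s225 : s ^+ 2 <= 225^-1.
  have -> : 225^-1 = 15^-1 ^+ 2 :> R by field.
  by rewrite lerXn2r ?nnegrE ?invr_ge0// ltW.
have s2 := sqr_ge0 s.
have hz : z <= expR (2 * s ^+ 2 * m%:R).
  rewrite expRM_natr; apply: lerXn2r; rewrite ?nnegrE ?expR_ge0//.
    have := mulr_ge0 s2 s2; lra.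
  apply: le_trans (expR_ge1Dx _).
  have := ler_wpM2l s2 s225; lra.
apply: le_trans (ler_wpM2l (expR_ge0 _) hz) _.
rewrite -expRD ler_expR.
have m0 : 0 <= m%:R :> R by [].
have a1 : s ^+ 2 <= 2 * (s * s0) by rewrite expr2 mulrCA ler_wpM2l ?(ltW sp).
have a2 : s0 ^+ 2 <= s ^+ 2 by rewrite lerXn2r ?nnegrE ?(ltW sp) ?(ltW s00).
have := ler_wpM2r m0 a1; have := ler_wpM2r m0 a2; have := mulr_ge0 (sqr_ge0 s) m0; lra.
Qed.

End Independence.

(** * A C^2 cutoff function *)

Section Cutoff.
Variable R : realType.
Implicit Types (f g h u : R -> R) (x y z t c q D H s e : R) (n : int) (m : nat).

Definition pos y : R := Num.max 0 y.

(** A quadratic remainder lets the powers of [pos] be differentiated by cases on signs, without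
    one-sided derivatives at 0. *)
Lemma dv_quad f f' : (forall y, exists C : R, forall h : R, `|h| <= 1 ->
    `|f (h + y) - f y - h * f' y| <= C * h ^+ 2) -> dv f f'.
Proof.
move=> H y; have [C hC] := H y.
have cv : h^-1 *: (f (h *: 1 + y) - f y) @[h --> 0^'] --> f' y.
  apply/cvgrPdist_le => e e0; near=> h.
  have h0 : h != 0 by near: h; exact: nbhs_dnbhs_neq.
  have h1 : `|h| <= 1 by near: h; apply: dnbhs0_le.
  have he : `|h| <= e / (`|C| + 1).
    by near: h; apply: dnbhs0_le; rewrite divr_gt0// ltr_wpDl.
  have := hC h h1; rewrite /GRing.scale /= mulr1.
  have -> : f' y - h^-1 * (f (h + y) - f y) = - (h^-1 * (f (h + y) - f y - h * f' y)).
    by field.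
  rewrite normrN normrM normfV => hh.
  rewrite ler_pdivrMl ?normr_gt0//; apply: le_trans hh _.
  rewrite -sqr_abs expr2 mulrCA ler_wpM2l//.
  rewrite ler_pdivlMr ?ltr_wpDl// in he.
  apply: le_trans he; rewrite mulrC ler_wpM2l//.
  by rewrite (le_trans (ler_norm _))// lerDl.
by split; [apply/cvg_ex; exists (f' y)|exact/cvg_lim].
Unshelve. all: by end_near.
Qed.

Lemma posE y : (0 <= y /\ pos y = y) \/ (y < 0 /\ pos y = 0).
Proof.
rewrite /pos; case: (leP 0 y) => y0; [left; split=> //|right; split=> //].
Qed.

Lemma dv_pos2 : dv (fun y => pos y ^+ 2) (fun y => 2 * pos y).
Proof.
apply: dv_quad => y; exists 1 => h _; rewrite mul1r.
have h2 := sqr_ge0 h.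
case: (posE (h + y)) => -[p1 ->]; case: (posE y) => -[p2 ->]; rewrite ler_norml; apply/andP; split; nra.
Qed.

Lemma dv_pos3 : dv (fun y => pos y ^+ 3) (fun y => 3 * pos y ^+ 2).
Proof.
apply: dv_quad => y; exists (3 * `|y| + 4) => h h1.
have h2 := sqr_ge0 h; have := normr_ge0 y.
move: h1; rewrite ler_norml => /andP[ha hb].
case: (posE (h + y)) => -[p1 ->]; case: (posE y) => -[p2 ->].
- rewrite (ger0_norm p2) => _.
  have -> : (h + y) ^+ 3 - y ^+ 3 - h * (3 * y ^+ 2) = (3 * y + h) * h ^+ 2 by ring.
  rewrite normrM (ger0_norm h2) ler_wpM2r// ler_norml; apply/andP; split; lra.
- move=> y0; rewrite !expr0n /= !mulr0 !subr0.
  have hy : h + y <= h by lra.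
  rewrite ger0_norm ?exprn_ge0//.
  have : (h + y) ^+ 3 <= h ^+ 3 by apply: lerXn2r; rewrite ?nnegrE; lra.
  have : h ^+ 3 <= h ^+ 2 by rewrite exprSr ler_piMr.
  have := mulr_ge0 y0 h2; lra.
- rewrite (ger0_norm p2) => _; rewrite expr0n /= sub0r.
  have y2 : y ^+ 2 <= h ^+ 2 by rewrite -[h ^+ 2]sqrrN; apply: lerXn2r; rewrite ?nnegrE; lra.
  have := sqr_ge0 y; have -> : - y ^+ 3 - h * (3 * y ^+ 2) = (- y - 3 * h) * y ^+ 2 by ring.
  move=> y20; rewrite normrM (ger0_norm y20).
  have : `|- y - 3 * h| <= 3 * y + 4 by rewrite ler_norml; apply/andP; split; lra.
  move=> hn; apply: le_trans (ler_wpM2r y20 hn) _.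
  by rewrite ler_wpM2l//; lra.
- move=> y0; rewrite !expr0n /= !mulr0 !subr0 normr0.
  have := mulr_ge0 y0 h2; lra.
Qed.

Lemma cont_pos : cont pos.
Proof.
have -> : pos = (fun y => 2^-1 * (y + `|y|)).
  apply/funext => y; case: (posE y) => -[p ->].
    by rewrite ger0_norm//; field.
  by rewrite ltr0_norm// subrr mulr0.
by cts.
Qed.

Definition pos3 y : R := pos y ^+ 3.

Lemma D2_pos3 : D2 pos3.
Proof.
have d := dv_pos2; exists (fun y => 3 * pos y ^+ 2), (fun y => 3 * (2 * pos y)); split.
- exact: dv_pos3.
- by apply: dv_eq (dvM (dvC 3) d) _ => y /=; rewrite mulr0 addr0.
- by have := cont_pos => ?; cts.
Qed.

Lemma pos_ge0 y : 0 <= pos y. Proof. by rewrite /pos le_max lexx. Qed.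
Lemma pos3_ge0 y : 0 <= pos3 y. Proof. by rewrite exprn_ge0// pos_ge0. Qed.
Lemma pos3_0 y : y <= 0 -> pos3 y = 0.
Proof. by move=> y0; rewrite /pos3 /pos max_l// expr0n. Qed.
Lemma pos3_gt0 y : pos3 y != 0 -> 0 < y.
Proof. by rewrite ltNge; apply: contra => /pos3_0 ->. Qed.

(** The cube of the positive part is C^2, so composing it with its reflection gives a C^2 transition
    from 0 to 1 that is flat at both ends. *)
Definition step y : R := 1 - pos3 (1 - pos3 y).

Lemma step0 y : y <= 0 -> step y = 0.
Proof. by move=> /pos3_0 e; rewrite /step e subr0 /pos3 /pos max_r// expr1n subrr. Qed.

Lemma step1 y : 1 <= y -> step y = 1.
Proof.
move=> y1; rewrite /step (pos3_0 (_ : _ <= 0)) ?subr0// subr_le0 /pos3 /pos max_r ?exprn_ege1//.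
by rewrite (le_trans _ y1).
Qed.

Lemma step_itv y : 0 <= step y <= 1.
Proof.
rewrite /step lerBlDr lerDl pos3_ge0 andbT subr_ge0 /pos3 exprn_ile1 ?pos_ge0//.
by rewrite /pos ge_max ler01 lerBlDr lerDl exprn_ge0// pos_ge0.
Qed.

Lemma D2_step : D2 step.
Proof.
apply: D2D; first exact: D2C.
apply: D2N; apply: (@D2_comp _ (fun y => 1 - pos3 y)); last exact: D2_pos3.
by apply: D2D; [exact: D2C|apply: D2N; exact: D2_pos3].
Qed.

Definition cutoff y : R := step (y - 1) * step (2 - y / 256).

Lemma D2_cutoff : D2 cutoff.
Proof.
apply: D2M; apply: D2_comp; try exact: D2_step.
  by apply: D2D; [exact: D2I|exact: D2C].
apply: D2D; first exact: D2C.
by apply: D2N; apply: D2M; [exact: D2I|exact: D2C].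
Qed.

Lemma cutoff_itv y : 0 <= cutoff y <= 1.
Proof.
have /andP[a b] := step_itv (y - 1); have /andP[c d] := step_itv (2 - y / 256).
by rewrite /cutoff mulr_ge0// mulr_ile1.
Qed.

Lemma cutoff_supp y : cutoff y != 0 -> 1 <= y <= 512.
Proof.
rewrite mulf_eq0 negb_or => /andP[h1 h2].
have [a|a] := leP (y - 1) 0; first by rewrite step0 ?eqxx in h1.
have [b|b] := leP (2 - y / 256) 0; first by rewrite step0 ?eqxx in h2.
by apply/andP; split; lra.
Qed.

Lemma cutoff1 y : 2 <= y <= 256 -> cutoff y = 1.
Proof. by move=> /andP[a b]; rewrite /cutoff !step1 ?mulr1//; lra. Qed.

End Cutoff.

(** * Even periodic C^2 functions and finite differences *)

Section Good.
Variable R : realType.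
Implicit Types (f g h u : R -> R) (x y z t c q D E H s e X : R) (n : int) (m : nat).

Definition good u := [/\ D2 u, periodic2pi u & forall x, u (- x) = u x].

Lemma good_cst c : good (fun=> c).
Proof. by split=> //; exact: D2C. Qed.

Lemma goodD f g : good f -> good g -> good (fun t => f t + g t).
Proof.
move=> [df pf ef] [dg pg eg]; split; first exact: D2D.
  by move=> k x; rewrite pf pg.
by move=> x; rewrite ef eg.
Qed.

Lemma goodM f g : good f -> good g -> good (fun t => f t * g t).
Proof.
move=> [df pf ef] [dg pg eg]; split; first exact: D2M.
  by move=> k x; rewrite pf pg.
by move=> x; rewrite ef eg.
Qed.

Lemma good_comp f g : good f -> D2 g -> good (fun t => g (f t)).
Proof.
move=> [df pf ef] dg; split; first exact: D2_comp.
  by move=> k x; rewrite pf.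
by move=> x; rewrite ef.
Qed.

Lemma good_cosn n : good (fun t => cos (n%:~R * t)).
Proof.
split; last by move=> x; rewrite mulrN cosN.
  by apply: D2_comp; [apply: D2M; [exact: D2C|exact: D2I]|exact: D2_cos].
by move=> k x; rewrite mulrDr mulrA -intrM cos_per.
Qed.

Lemma good_sum (I : Type) (r : seq I) (F : I -> R -> R) :
  (forall i, good (F i)) -> good (fun t => \sum_(i <- r) F i t).
Proof.
move=> gF; elim: r => [|i r IH].
  by under eq_fun do rewrite big_nil; exact: good_cst.
by under eq_fun do rewrite big_cons; exact: goodD.
Qed.

Lemma good_prod (I : Type) (r : seq I) (F : I -> R -> R) :
  (forall i, good (F i)) -> good (fun t => \prod_(i <- r) F i t).
Proof.
move=> gF; elim: r => [|i r IH].
  by under eq_fun do rewrite big_nil; exact: good_cst.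
by under eq_fun do rewrite big_cons; exact: goodM.
Qed.

Lemma good_cont f : good f -> cont f.
Proof. by move=> [df _ _]; exact: D2_cont. Qed.

Lemma good_rp m s : good (rp m s).
Proof.
by apply: good_prod => k; apply: goodD; [exact: good_cst|apply: goodM; [exact: good_cst|exact: good_cosn]].
Qed.

Lemma good_cs m : good (@cs R m).
Proof. by apply: good_sum => k; exact: good_cosn. Qed.

(** All coefficients are at most 1 in modulus, so their [q]-th powers are dominated by squares and
    Bessel's inequality applies. *)
Lemma lq_of_L2 q f E : 2 <= q -> cont f -> av (fun t => f t ^+ 2) <= E -> E <= 1 ->
  lq q f E.
Proof.
move=> q2 cf fE E1 r ur.
apply: le_trans (le_trans (hat_bessel cf ur) fE); apply: ler_sum => n _.
have h1 : hat f n ^+ 2 <= 1.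
  have := @hat_bessel R f [:: n] cf isT; rewrite big_seq1 => h.
  exact: le_trans (le_trans h fE) E1.
rewrite -sqr_abs -powR_mulrn//.
have [->|h0] := eqVneq (hat f n) 0.
  by rewrite normr0 !powR0// gt_eqF// (lt_le_trans _ q2).
by rewrite ger_powR// normr_gt0 h0 -(@expr_le1 _ 2)// sqr_abs.
Qed.

Lemma eq_fd_ge l (F G : nat -> R) j : (forall i, (j <= i)%N -> F i = G i) ->
  fd l F j = fd l G j.
Proof.
elim: l j => [|l IH] j FG /=; first exact: FG.
by rewrite !IH// => i ji; apply: FG => //; exact: ltnW.
Qed.

Lemma fd_abs l (F : nat -> R) j X : (forall i, (j <= i <= j + l)%N -> `|F i| <= X) ->
  `|fd l F j| <= 2 ^+ l * X.
Proof.
elim: l j => [|l IH] j FX /=; first by rewrite mul1r FX// addn0 leqnn.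
apply: le_trans (ler_normB _ _) _; rewrite exprS -mulrA mulr_natl mulr2n.
by apply: lerD; apply: IH => i /andP[a b]; apply: FX; lia.
Qed.

Lemma cont_fd l (F : nat -> R -> R) j : (forall i, cont (F i)) ->
  cont (fun t => fd l (fun i => F i t) j).
Proof.
move=> cF; elim: l j => [|l IH] j /=; first exact: cF.
by have := IH j; have := IH j.+1 => *; cts.
Qed.

Lemma good_fd l (F : nat -> R -> R) j : (forall i, good (F i)) ->
  good (fun t => fd l (fun i => F i t) j).
Proof.
move=> cF; elim: l j => [|l IH] j /=; first exact: cF.
have -> : (fun t => fd l (fun i => F i t) j - fd l (fun i => F i t) j.+1) =
  (fun t => fd l (fun i => F i t) j + (-1) * fd l (fun i => F i t) j.+1).
  by apply/funext => t; rewrite mulN1r.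
by apply: goodD => //; apply: goodM => //; exact: good_cst.
Qed.

Lemma av_fd_sqr l w (F : nat -> R -> R) j X : cont w -> (forall i, cont (F i)) ->
  (forall i, (j <= i <= j + l)%N -> av (fun t => w t ^+ 2 * F i t ^+ 2) <= X) ->
  av (fun t => w t ^+ 2 * fd l (fun i => F i t) j ^+ 2) <= 4 ^+ l * X.
Proof.
move=> cw cF; elim: l j => [|l IH] j FX /=; first by rewrite mul1r FX// addn0 leqnn.
have c1 := @cont_fd l F j cF; have c2 := @cont_fd l F j.+1 cF.
apply: (@le_trans _ _ (av (fun t => 2 * (w t ^+ 2 * fd l (fun i => F i t) j ^+ 2) +
    2 * (w t ^+ 2 * fd l (fun i => F i t) j.+1 ^+ 2)))).
  apply: av_le => [||t]; [by cts|by cts|].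
  rewrite -subr_ge0 (_ : _ - _ = (w t * (fd l (F^~ t) j + fd l (F^~ t) j.+1)) ^+ 2).
    exact: sqr_ge0.
  by ring.
rewrite avD ?avZ; [|by cts..].
have h1 : av (fun t => w t ^+ 2 * fd l (fun i => F i t) j ^+ 2) <= 4 ^+ l * X.
  by apply: IH => i ij; apply: FX; lia.
have h2 : av (fun t => w t ^+ 2 * fd l (fun i => F i t) j.+1 ^+ 2) <= 4 ^+ l * X.
  by apply: IH => i ij; apply: FX; lia.
by rewrite exprS -mulrA; move: h1 h2; move: (4 ^+ l * X) (av _) (av _) => a b d; lra.
Qed.

End Good.

(** * The signed and the positive Riesz factor *)

Section RieszLayer.
Variable R : realType.
Implicit Types (f g h u : R -> R) (x y z t c q D E H s e X w : R) (n : int) (m M : nat).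

Lemma powR_expn x q k : 0 <= x -> (x ^+ k) `^ q = (x `^ q) ^+ k.
Proof.
move=> x0; rewrite -[x ^+ k]powR_mulrn// powRAC powR_mulrn//; exact: powR_ge0.
Qed.

(** The scaling turns the interval [[2, 256]] on which [cutoff] is 1 into
    [s0 m / 16 <= cs m t <= 8 s0 m], the range between the two tail bounds. *)
Definition cut m s0 t : R := cutoff (32 / (s0 * m%:R) * cs m t).

Lemma good_cut m s0 : good (cut m s0).
Proof.
apply: (@good_comp _ (fun t => 32 / (s0 * m%:R) * cs m t)); last exact: D2_cutoff.
by apply: goodM; [exact: good_cst|exact: good_cs].
Qed.

(** Where [cut] differs from 1, one of the two exponentials of the tail lemmas is at least 1. *)
Lemma cut_tail m s0 s : 0 < s0 -> (0 < m)%N -> s0 <= s -> s <= 2 * s0 -> s <= 15^-1 ->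
  av (fun t => (1 - cut m s0 t) ^+ 2 * rp m s t ^+ 2) <= 2 * expR (- (s0 ^+ 2 * m%:R / 8)).
Proof.
move=> s00 m0 ss s2 s15; have sp : 0 < s := lt_le_trans s00 ss.
have h1 := av_tail_low m s00 ss s15; have h2 := av_tail_up m s00 ss s2 s15.
have cr := @cont_rp R m s; have cc := @cont_cs R m; have cu := good_cont (good_cut m s0).
rewrite mulr_natl mulr2n; apply: le_trans (lerD h1 h2).
rewrite -avD; [|by cts|by cts].
apply: av_le => [||t]; [by cts|by cts|].
rewrite -mulrDr mulrC ler_wpM2l ?sqr_ge0// /cut.
set F := cs m t.
have mR : 0 < m%:R :> R by rewrite ltr0n.
have sm : 0 < s0 * m%:R by rewrite mulr_gt0.
set y := 32 / (s0 * m%:R) * F.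
have yE : y * (s0 * m%:R) = 32 * F by rewrite /y; field; rewrite !gt_eqF.
have /andP[c0 c1] := cutoff_itv y.
have le1 : (1 - cutoff y) ^+ 2 <= 1.
  by move: (cutoff y) c0 c1 => v v0 v1; rewrite exprn_ile1 ?subr_ge0// gerBl.
have e1 := expR_ge0 (- (3 / 2 * s) * (F - s0 * m%:R / 16)).
have e2 := expR_ge0 (s * (F - 8 * s0 * m%:R)).
have [y2|y2] := ltP y 2.
  apply: le_trans le1 _; rewrite -[leLHS]addr0; apply: lerD => //; apply: le_trans (expR_ge1Dx _); rewrite lerDl.
  have hF : 32 * F < 2 * (s0 * m%:R) by rewrite -yE ltr_pM2r.
  rewrite mulNr -mulrN mulr_ge0//; first by rewrite mulr_ge0 ?ltW.
  by clear -hF; clearbody F; lra.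
have [y3|y3] := leP y 256.
  by rewrite cutoff1 ?y2// subrr expr0n /= addr_ge0.
apply: le_trans le1 _; rewrite -[leLHS]add0r; apply: lerD => //; apply: le_trans (expR_ge1Dx _); rewrite lerDl.
have hF : 256 * (s0 * m%:R) < 32 * F by rewrite -yE ltr_pM2r.
rewrite mulr_ge0 ?(ltW sp)// -mulrA.
by clear -hF; clearbody F; lra.
Qed.

Definition nrm M : R := fd M (fun i => i%:R^-1) M.

(** The coefficients of order [d] of the [i]-th term are [i^-1 (s0 i / (2 M))^d]. For [1 <= d <= M]
    this is a polynomial in [i] of degree below [M], which the [M]-th difference kills; for [d = 0]
    it is [i^-1], whose difference is [nrm M]. As [i] runs from [M] to [2 M], all parameters lie in
    [[s0, 2 s0]]. *)
Definition psi m M s0 t : R :=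
  (nrm M)^-1 * fd M (fun i => i%:R^-1 * rp m (s0 * i%:R / M%:R) t) M.

Lemma good_psi m M s0 : good (psi m M s0).
Proof.
apply: goodM; first exact: good_cst.
by apply: good_fd => i; apply: goodM; [exact: good_cst|exact: good_rp].
Qed.

Lemma nrm_bound M : (0 < M)%N -> 0 < nrm M /\ (nrm M)^-1 <= M%:R * 4 ^+ M.
Proof.
move=> M0; have := fd_inv_ge R M0; rewrite -/(nrm M) => h.
have Mp : 0 < M%:R * 4 ^+ M :> R by rewrite mulr_gt0 ?ltr0n// exprn_gt0.
have n0 : 0 < nrm M by rewrite -(pmulr_rgt0 _ Mp) (lt_le_trans ltr01 h).
by split=> //; rewrite -[leLHS]mul1r ler_pdivrMr.
Qed.

(** The constant is [4 ^ M] from the differences of squares times the square of [4 ^ M] from [nrm];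
    the factor [M] in the bound of [(nrm M)^-1] is absorbed by [i^-1 <= M^-1]. *)
Lemma psi_tail m M s0 : 0 < s0 -> (0 < m)%N -> (0 < M)%N -> 2 * s0 <= 15^-1 ->
  av (fun t => (psi m M s0 t * (cut m s0 t - 1)) ^+ 2) <=
  64 ^+ M * (2 * expR (- (s0 ^+ 2 * m%:R / 8))).
Proof.
move=> s00 m0 M0 s1; have [n0 nM] := nrm_bound M0.
have MR : 0 < M%:R :> R by rewrite ltr0n.
set X := 2 * expR _.
have cu := good_cont (good_cut m s0).
pose F i t := i%:R^-1 * rp m (s0 * i%:R / M%:R) t.
have cF i : cont (F i) by have := @cont_rp R m (s0 * i%:R / M%:R) => ?; rewrite /F; cts.
have cfd := @cont_fd R M F M cF.
have -> : (fun t => (psi m M s0 t * (cut m s0 t - 1)) ^+ 2) =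
  (fun t => (nrm M)^-1 ^+ 2 * ((1 - cut m s0 t) ^+ 2 * fd M (fun i => F i t) M ^+ 2)).
  by apply/funext => t; rewrite /psi -/(F _ t); ring.
rewrite avZ; last by cts.
have h : av (fun t => (1 - cut m s0 t) ^+ 2 * fd M (fun i => F i t) M ^+ 2)
    <= 4 ^+ M * (M%:R^-1 ^+ 2 * X).
  apply: (@av_fd_sqr R M (fun t => 1 - cut m s0 t)) => [|//|i /andP[i1 i2]]; first by cts.
  have cr := @cont_rp R m (s0 * i%:R / M%:R).
  have -> : (fun t => (1 - cut m s0 t) ^+ 2 * F i t ^+ 2) =
    (fun t => i%:R^-1 ^+ 2 * ((1 - cut m s0 t) ^+ 2 * rp m (s0 * i%:R / M%:R) t ^+ 2)).
    by apply/funext => t; rewrite /F; ring.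
  have iM : M%:R <= i%:R :> R by rewrite ler_nat.
  have i2M : i%:R <= 2 * M%:R :> R by rewrite -natrM ler_nat mul2n -addnn.
  have iR : 0 < i%:R :> R by apply: lt_le_trans iM.
  rewrite avZ; last by cts.
  apply: ler_pM; rewrite ?sqr_ge0//.
  - by apply: av_ge0 => [|t]; [cts|rewrite mulr_ge0// sqr_ge0].
  - by rewrite lerXn2r ?nnegrE ?invr_ge0// lef_pV2.
  - have a1 : s0 <= s0 * i%:R / M%:R by rewrite ler_pdivlMr// ler_wpM2l// ltW.
    have a2 : s0 * i%:R / M%:R <= 2 * s0.
      by rewrite ler_pdivrMr// [2 * s0]mulrC -mulrA ler_wpM2l// ltW.
    by apply: cut_tail => //; apply: le_trans s1.
apply: le_trans (ler_wpM2l (sqr_ge0 _) h) _.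
have X0 : 0 <= X by rewrite mulr_ge0// expR_ge0.
have hn : (nrm M)^-1 ^+ 2 <= (M%:R * 4 ^+ M) ^+ 2.
  by rewrite lerXn2r ?nnegrE ?invr_ge0 ?(ltW n0)// mulr_ge0// exprn_ge0.
have p0 : 0 <= 4 ^+ M * (M%:R^-1 ^+ 2 * X).
  by rewrite mulr_ge0 ?exprn_ge0// mulr_ge0// sqr_ge0.
apply: le_trans (ler_wpM2r p0 hn) _.
have -> : (64 : R) ^+ M = 4 ^+ M * 4 ^+ M * 4 ^+ M.
  by rewrite -!exprMn; congr (_ ^+ _); ring.
by rewrite le_eqVlt; apply/orP; left; apply/eqP; field; rewrite gt_eqF.
Qed.

Definition psic m M s0 (d : nat) : R :=
  (nrm M)^-1 * fd M (fun i => i%:R^-1 * (s0 * i%:R / M%:R / 2) ^+ d) M - (d == 0)%:R.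

Lemma psiE m M s0 t : psi m M s0 t - 1 = rz m (psic m M s0) t.
Proof.
rewrite rzB rz_delta rzZ rz_fd; congr (_ * _ - _).
by apply: eq_fd => i; rewrite rzZ -rpE.
Qed.

Lemma psic_small m M s0 d : (0 < M)%N -> (d <= M)%N -> psic m M s0 d = 0.
Proof.
move=> M0 dM; have [n0 _] := nrm_bound M0; rewrite /psic.
case: d dM => [|d] dM.
  rewrite (@eq_fd _ _ _ (fun i => i%:R^-1)); last by move=> i; rewrite expr0 mulr1.
  by rewrite mulVf ?subrr// gt_eqF.
rewrite subr0 (@eq_fd_ge _ _ _ (fun i => (s0 / M%:R / 2) ^+ d.+1 * i%:R ^+ d)).
  by rewrite fdZ fd_pow// mulr0 mulr0.
move=> i Mi; have iR : i%:R != 0 :> R by rewrite pnatr_eq0 -lt0n (leq_trans M0).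
rewrite !exprMn [i%:R ^+ d.+1]exprS; have := exprn_gt0.
by move: (s0 ^+ d.+1) (M%:R^-1 ^+ d.+1) (2^-1 ^+ d.+1) (i%:R ^+ d) => a b c e _; field.
Qed.

Lemma psic_bound m M s0 d : 0 <= s0 -> (0 < M)%N -> (0 < d)%N ->
  `|psic m M s0 d| <= 8 ^+ M * s0 ^+ d.
Proof.
move=> s00 M0 d0; have [n0 nM] := nrm_bound M0.
have MR : 0 < M%:R :> R by rewrite ltr0n.
rewrite /psic gtn_eqF// subr0 normrM gtr0_norm ?invr_gt0//.
have -> : (8 : R) ^+ M * s0 ^+ d = (M%:R * 4 ^+ M) * (2 ^+ M * (M%:R^-1 * s0 ^+ d)).
  have -> : (8 : R) ^+ M = 4 ^+ M * 2 ^+ M by rewrite -exprMn; congr (_ ^+ _); ring.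
  by field; rewrite gt_eqF.
apply: ler_pM => //; first by rewrite invr_ge0 ltW.
apply: fd_abs => i /andP[i1 i2].
have iM : M%:R <= i%:R :> R by rewrite ler_nat.
have i2M : i%:R <= 2 * M%:R :> R by rewrite -natrM ler_nat mul2n -addnn.
have iR : 0 < i%:R :> R by apply: lt_le_trans iM.
have b0 : 0 <= s0 * i%:R / M%:R / 2 by rewrite !divr_ge0// ?mulr_ge0// ?ltW.
rewrite ger0_norm ?mulr_ge0 ?invr_ge0 ?exprn_ge0// ?(ltW iR)//.
apply: ler_pM; rewrite ?invr_ge0 ?exprn_ge0// ?(ltW iR)//.
  by rewrite lef_pV2.
apply: lerXn2r; rewrite ?nnegrE//.
rewrite ler_pdivrMr// ler_pdivrMr// -!mulrA ler_wpM2l//.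
Qed.

Lemma psi_lq q m M s0 : 1 < q -> 0 < s0 -> (0 < M)%N ->
  lq q (fun t => psi m M s0 t - 1)
    (2 ^- M * expR (4 * 8 `^ q * (s0 `^ q * m%:R))).
Proof.
move=> q1 s00 M0; have q0 : 0 < q by rewrite (lt_trans _ q1).
rewrite (_ : (fun t => _) = rz m (psic m M s0)); last by apply/funext => t; rewrite psiE.
(* Only the orders [d > M] survive, so [(8 ^ M) ^ q = 2 ^- M * w ^ M] is at most [2 ^- M * w ^ d]:
   enlarging the base of the geometric bound buys the factor [2 ^- M]. *)
pose w : R := 2 * 8 `^ q.
have e8 : 1 <= (8 : R) `^ q.
  apply: (@le_trans _ _ 8); first by rewrite ler1n.
  by apply: le1r_powR; [rewrite ler1n|exact: ltW].
have w1 : 1 <= w by rewrite /w; lra.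
have y0 : 0 <= w * s0 `^ q by rewrite mulr_ge0 ?powR_ge0// (le_trans _ w1).
have hd d : `|psic m M s0 d| `^ q <= 2 ^- M * (w * s0 `^ q) ^+ d.
  have [dM|dM] := leqP d M.
    rewrite psic_small// normr0 powR0 ?gt_eqF//.
    by rewrite mulr_ge0 ?invr_ge0 ?exprn_ge0.
  apply: (@le_trans _ _ ((8 ^+ M * s0 ^+ d) `^ q)).
    apply: ge0_ler_powR; rewrite ?nnegrE ?(ltW q0)//.
      by rewrite mulr_ge0// exprn_ge0// ltW.
    by apply: psic_bound; [exact: ltW|exact: M0|exact: leq_ltn_trans dM].
  rewrite powRM ?exprn_ge0 ?(ltW s00)//.
  rewrite !powR_expn ?(ltW s00)// exprMn mulrA ler_wpM2r ?exprn_ge0 ?powR_ge0//.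
  have -> : (8 `^ q) ^+ M = 2 ^- M * w ^+ M.
    by rewrite /w exprMn mulrA mulVf ?mul1r// expf_neq0.
  by rewrite ler_wpM2l ?invr_ge0 ?exprn_ge0// ler_weXn2l// ltnW.
apply: lq_le (rz_lq m q1 y0 hd).
rewrite ler_wpM2l ?invr_ge0 ?exprn_ge0//.
apply: (@le_trans _ _ (expR (2 * (w * s0 `^ q)) ^+ m)).
  by apply: lerXn2r; rewrite ?nnegrE ?expR_ge0 ?expR_ge1Dx// addr_ge0// mulr_ge0.
by rewrite -expRM_natr ler_expR /w le_eqVlt; apply/orP; left; apply/eqP; ring.
Qed.

(** The same exchange with only the order 0 cancelled. The free [w] may be taken large as soon as
    [s ^ r * m] is small. *)
Lemma rp_lq r m s w : 1 < r -> 0 < s -> 1 <= w ->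
  lq r (fun t => rp m s t - 1) (w^-1 * expR (2 * w * (s `^ r * m%:R))).
Proof.
move=> r1 s0 w1; have r0 : 0 < r by rewrite (lt_trans _ r1).
have w0 : 0 < w by rewrite (lt_le_trans _ w1).
have -> : (fun t => rp m s t - 1) = rz m (fun d => (s / 2) ^+ d - (d == 0)%:R).
  by apply/funext => t; rewrite rzB rz_delta rpE.
have y0 : 0 <= w * s `^ r by rewrite mulr_ge0 ?powR_ge0// ltW.
have hd d : `|(s / 2) ^+ d - (d == 0)%:R| `^ r <= w^-1 * (w * s `^ r) ^+ d.
  case: d => [|d].
    by rewrite subrr normr0 powR0 ?gt_eqF// mulr1 invr_ge0 ltW.
  rewrite subr0 ger0_norm; last by rewrite exprn_ge0// divr_ge0// ltW.
  apply: (@le_trans _ _ ((s ^+ d.+1) `^ r)).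
    apply: ge0_ler_powR; rewrite ?nnegrE ?(ltW r0) ?exprn_ge0 ?divr_ge0 ?(ltW s0)//.
    by apply: lerXn2r; rewrite ?nnegrE; lra.
  rewrite powR_expn ?(ltW s0)// exprMn [w ^+ _]exprS -[w * _ * _]mulrA mulKf ?gt_eqF//.
  by rewrite -[leLHS]mul1r ler_wpM2r ?mulr_ge0 ?exprn_ge0 ?powR_ge0// exprn_ege1.
apply: lq_le (rz_lq m r1 y0 hd).
rewrite ler_wpM2l ?invr_ge0 ?(ltW w0)//.
apply: (@le_trans _ _ (expR (2 * (w * s `^ r)) ^+ m)).
  by apply: lerXn2r; rewrite ?nnegrE ?expR_ge0 ?expR_ge1Dx// addr_ge0// mulr_ge0.
by rewrite -expRM_natr ler_expR le_eqVlt; apply/orP; left; apply/eqP; ring.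
Qed.

End RieszLayer.

(** * Choice of the parameters of the Riesz factors *)

Section RieszLayerExists.
Variable R : realType.
Implicit Types (f g h u : R -> R) (x y z t c q D E H s e X w : R) (n : int) (m M : nat).

Lemma powR_unbounded (a X : R) : 0 < a -> exists N, forall m, (N <= m)%N -> X <= m%:R `^ a.
Proof.
move=> a0; pose Y : R := Num.max 1 X.
have Y1 : 1 <= Y by rewrite le_max lexx.
have Y0 : 0 < Y by rewrite (lt_le_trans ltr01).
exists (Num.truncn (Y `^ a^-1)).+1 => m Nm.
have h : Y `^ a^-1 <= m%:R.
  by apply: le_trans (ltW (truncnS_gt _)) _; rewrite ler_nat.
apply: (@le_trans _ _ Y); first by rewrite le_max lexx orbT.
have -> : Y = (Y `^ a^-1) `^ a by rewrite -powRrM mulVf ?gt_eqF// powRr1// ltW.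
by apply: ge0_ler_powR; rewrite ?nnegrE ?powR_ge0 ?(ltW a0).
Qed.

Lemma expRN_le_inv y : 0 < y -> expR (- y) <= y^-1.
Proof.
move=> y0; rewrite expRN lef_pV2 ?posrE ?expR_gt0//.
by apply: le_trans (expR_ge1Dx y); rewrite lerDr.
Qed.

(* With [s = (K / m)^(1/q)] the Riesz product [rp m s] has [lq]-norm of order one,
   while the function [c * cs m] has the dual norm of order [K^(-1/q)]. *)
Lemma riesz_layer q r e : 2 < q -> q < r -> 0 < e -> exists G Q c m,
  [/\ [/\ good G, good Q & forall t, 0 <= Q t],
      lq q (fun t => G t - 1) e, lq r (fun t => Q t - 1) e,
      0 < c /\ c `^ q * m%:R `^ (q - 1) <= e &
      forall t, (G t != 0) || (Q t != 0) -> 1 <= c * cs m t <= 512].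
Proof.
move=> q2 qr e0.
have q1 : 1 < q by lra.
have q0 : 0 < q by lra.
have r1 : 1 < r by lra.
have r2 : 2 <= r by lra.
have r0 : 0 < r by lra.
pose e' := Num.min e 1.
have e'0 : 0 < e' by rewrite lt_min e0 ltr01.
have e'e : e' <= e by rewrite ge_min lexx.
have e'1 : e' <= 1 by rewrite ge_min lexx orbT.
have t1 : 1 <= (2 : R) `^ r.
  apply: (@le_trans _ _ 2); first by rewrite ler1n.
  by apply: le1r_powR; [rewrite ler1n|exact: ltW].
have tqr : (2 : R) `^ q <= 2 `^ r by apply: ler_powR; [rewrite ler1n|exact: ltW].
pose bb := e' / (2 * 2 `^ r).
have bb0 : 0 < bb by rewrite divr_gt0// mulr_gt0// (lt_le_trans ltr01).
have bb1 : bb <= 1.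
  rewrite ler_pdivrMr; last by rewrite mulr_gt0// (lt_le_trans ltr01).
  by apply: le_trans e'1 _; lra.
have bbr : 2 `^ r * (bb + bb) <= e.
  apply: le_trans e'e; rewrite le_eqVlt; apply/orP; left; apply/eqP.
  by rewrite /bb; field; rewrite gt_eqF// powR_gt0.
have bbq : 2 `^ q * (bb + bb) <= e.
  by apply: le_trans bbr; rewrite ler_wpM2r// addr_ge0 ?(ltW bb0).
(* With [s0 ^ q * m = Kq] and [c = 32 / (s0 * m)] one gets [c ^ q * m ^ (q - 1) = 32 ^ q / Kq = e'].
   This fixes [Kq] before [M], and [M] before [m]. *)
pose Kq := 32 `^ q / e'.
have Kq0 : 0 < Kq by rewrite divr_gt0// powR_gt0.
pose Y := expR (4 * 8 `^ q * Kq).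
have Y0 : 0 < Y by exact: expR_gt0.
have [M0' hM'] := @powR_unbounded 1 (Y / bb) ltr01.
pose M := M0'.+1.
have hM : 2 ^- M * Y <= bb.
  have h1 : Y / bb <= M%:R by have := hM' M (leqnSn _); rewrite powRr1.
  have h2 : (M%:R : R) <= 2 ^+ M by rewrite -natrX ler_nat ltnW// ltn_expl.
  rewrite ler_pdivrMl ?exprn_gt0// -ler_pdivrMr//; exact: le_trans h1 h2.
pose w := expR 1 / bb.
have w1 : 1 <= w.
  rewrite ler_pdivlMr// mul1r; apply: le_trans bb1 _.
  by apply: le_trans (expR_ge1Dx 1); rewrite lerDl.
have w0 : 0 < w := lt_le_trans ltr01 w1.
pose X2 := 64 ^+ M * 16 / (bb * Kq `^ (2 / q)).
have p2 : 0 < 1 - 2 / q by rewrite subr_gt0 ltr_pdivrMr// mul1r.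
have p3 : 0 < r / q - 1 by rewrite subr_gt0 ltr_pdivlMr// mul1r.
(* The three lower bounds on [m] secure [s0 <= 30^-1], a small Chernoff tail ([s0 ^ 2 * m] is
   unbounded because [q > 2]), and [2 * w * s0 ^ r * m <= 1] (because [r > q]). *)
have [N1 hN1] := powR_unbounded (Kq * 30 `^ q) ltr01.
have [N2 hN2] := powR_unbounded X2 p2.
have [N3 hN3] := powR_unbounded (2 * w * Kq `^ (r / q)) p3.
pose m := (N1 + N2 + N3).+1.
have m0 : (0 < m)%N by [].
have mR : 0 < m%:R :> R by rewrite ltr0n.
have m1 : (N1 <= m)%N by rewrite /m -!addnA leqW// leq_addr.
have m2 : (N2 <= m)%N by rewrite /m addnAC leqW// leq_addl.
have m3 : (N3 <= m)%N by rewrite /m leqW// leq_addl.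
clearbody m.
have h1 : Kq * 30 `^ q <= m%:R by have := hN1 m m1; rewrite (powRr1 (ler0n _ m)).
have h2 := hN2 m m2; have h3 := hN3 m m3.
have M0 : (0 < M)%N by [].
clearbody M.
pose s0 := (Kq / m%:R) `^ q^-1.
have Km0 : 0 < Kq / m%:R by rewrite divr_gt0.
have s00 : 0 < s0 by rewrite powR_gt0.
have scaleE p : s0 `^ p * m%:R = Kq `^ (p / q) * m%:R `^ (1 - p / q).
  rewrite /s0 -powRrM (mulrC q^-1) powRM ?invr_ge0 ?(ltW Kq0) ?(ltW mR)// -mulrA.
  congr (_ * _); rewrite -{1}(powR_inv1 (ltW mR)) -powRrM -{2}(powRr1 (ltW mR)) -powRD.
    by congr (_ `^ _); rewrite mulN1r addrC.
  by rewrite (gt_eqF mR) implybT.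
have s0q : s0 `^ q * m%:R = Kq.
  by rewrite scaleE divff ?gt_eqF// subrr powRr0 powRr1 ?mulr1// ltW.
have s0s : s0 <= 30^-1.
  have -> : 30^-1 = ((30^-1) `^ q) `^ q^-1 :> R.
    by rewrite -powRrM mulfV ?gt_eqF// powRr1.
  apply: ge0_ler_powR; rewrite ?nnegrE ?invr_ge0 ?powR_ge0 ?(ltW q0) ?(ltW Km0)//.
  rewrite ler_pdivrMr// mulrC -ler_pdivrMr ?powR_gt0//.
  rewrite -(powR_inv1 (powR_ge0 _ _)) -powRAC (powR_inv1 (_ : 0 <= 30^-1))// invrK.
  exact: h1.
have s15 : 2 * s0 <= 15^-1 by lra.
have s2E : s0 ^+ 2 * m%:R = Kq `^ (2 / q) * m%:R `^ (1 - 2 / q).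
  by rewrite -scaleE powR_mulrn// ltW.
have tail : 64 ^+ M * (2 * expR (- (s0 ^+ 2 * m%:R / 8))) <= bb.
  have K2 : 0 < Kq `^ (2 / q) by rewrite powR_gt0.
  have y0 : 0 < s0 ^+ 2 * m%:R / 8 by rewrite divr_gt0// mulr_gt0// exprn_gt0.
  have h64 : 0 < (64 : R) ^+ M by rewrite exprn_gt0.
  apply: (@le_trans _ _ (64 ^+ M * (2 * (s0 ^+ 2 * m%:R / 8)^-1))).
    by rewrite ler_wpM2l ?(ltW h64)// ler_wpM2l// expRN_le_inv.
  rewrite /X2 ler_pdivrMr ?mulr_gt0// in h2.
  have -> : 64 ^+ M * (2 * (s0 ^+ 2 * m%:R / 8)^-1) = 64 ^+ M * 16 / (s0 ^+ 2 * m%:R).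
    by field; rewrite !gt_eqF.
  rewrite ler_pdivrMr ?mulr_gt0 ?exprn_gt0// s2E; apply: le_trans h2 _.
  by rewrite le_eqVlt; apply/orP; left; apply/eqP; ring.
have tail1 : 2 * expR (- (s0 ^+ 2 * m%:R / 8)) <= bb.
  apply: le_trans tail; apply: ler_peMl; first by rewrite mulr_ge0 ?expR_ge0.
  by rewrite exprn_ege1 ?ler1n.
have gcut := good_cut m s0; have gps := good_psi m M s0; have grp := good_rp m s0.
have ccut := good_cont gcut; have cps := good_cont gps; have crp := good_cont grp.
pose c := 32 / (s0 * m%:R).
have sm0 : 0 < s0 * m%:R by rewrite mulr_gt0.
exists (fun t => psi m M s0 t * cut m s0 t), (fun t => rp m s0 t * cut m s0 t), c, m.
have c0 : 0 < c by rewrite divr_gt0.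
have cut0 t : 0 <= cut m s0 t by have /andP[] := cutoff_itv (c * cs m t).
split.
- split; [exact: goodM|exact: goodM|move=> t].
  rewrite mulr_ge0// prodr_ge0// => k _.
  have := cos_geN1 ((9 ^ k)%:Z%:~R * t); move: (cos _) => v v1.
  have : s0 * (-1) <= s0 * v by rewrite ler_wpM2l// ltW.
  lra.
- have -> : (fun t => psi m M s0 t * cut m s0 t - 1) =
    (fun t => (psi m M s0 t - 1) + psi m M s0 t * (cut m s0 t - 1)).
    by apply/funext => t; ring.
  apply: lq_le bbq _; apply: lqD => //; [by cts|by cts| |].
    by have := @psi_lq R q m M s0 q1 s00 M0; rewrite s0q; apply: lq_le.
  apply: lq_of_L2 => //; [lra|by cts|].
  exact: le_trans (psi_tail _ _ _ _) tail.
- have -> : (fun t => rp m s0 t * cut m s0 t - 1) =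
    (fun t => (rp m s0 t - 1) + rp m s0 t * (cut m s0 t - 1)).
    by apply/funext => t; ring.
  apply: lq_le bbr _; apply: lqD => //; [by cts|by cts| |].
    have := @rp_lq R r m s0 w r1 s00 w1; apply: lq_le.
    rewrite /w invf_div mulrAC ler_pdivrMr ?expR_gt0// ler_wpM2l ?(ltW bb0)// ler_expR.
    rewrite scaleE mulrA -ler_pdivlMr ?powR_gt0// mul1r -powRN opprB.
    exact: h3.
  apply: lq_of_L2 => //; [by cts|].
  apply: le_trans tail1.
  have -> : (fun t => (rp m s0 t * (cut m s0 t - 1)) ^+ 2) =
    (fun t => (1 - cut m s0 t) ^+ 2 * rp m s0 t ^+ 2).
    by apply/funext => t; ring.
  by apply: cut_tail => //; lra.
- split=> //; apply: le_trans e'e.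
  have e1 : c `^ q * m%:R `^ (q - 1) * (s0 `^ q * m%:R) = 32 `^ q.
    have -> : 32 `^ q = (c * (s0 * m%:R)) `^ q by rewrite /c divfK// gt_eqF.
    rewrite (powRM q (ltW c0) (ltW sm0)) (powRM q (ltW s00) (ltW mR)).
    by rewrite -(mulr_powRB1 (ltW mR) q0); ring.
  move: e1; rewrite s0q => e1.
  have -> : c `^ q * m%:R `^ (q - 1) = 32 `^ q / Kq by rewrite -e1 mulfK// gt_eqF.
  by rewrite /Kq invf_div mulrCA divff ?mulr1// gt_eqF// powR_gt0.
- move=> t h; have : cut m s0 t != 0.
    by case/orP: h; rewrite mulf_eq0 negb_or => /andP[].
  exact: cutoff_supp.
Qed.

End RieszLayerExists.
(** * Short arcs at random-like points *)

Section ArcLayer.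
Variable R : realType.
Implicit Types (f g h u : R -> R) (x y z t c q D E s e d lam : R) (n : int) (m M : nat).

(** For cosine polynomials this is the addition formula; Fejer means carry it to [u] without any
    change of variables in [av]. Both translates are averaged to stay among even functions. *)
Lemma hat_translate u x n : good u ->
  hat (fun t => 2^-1 * (u (t - x) + u (t + x))) n = hat u n * cos (n%:~R * x).
Proof.
move=> [du up ue]; have cu := D2_cont du.
have [L L0 uL] := D2_lipc du up.
have hs0 k : hats u k = 0 by apply: av_odd => t; rewrite ue mulrN sinN mulrN.
apply/eqP; rewrite -subr_eq0 -normr_le0; apply/ler_addgt0Pr => e e0; rewrite add0r.
have [K K0 hK] := sig_unif cu uL L0 (divr_gt0 e0 (ltr0n _ 2)).
have csg := @cont_sig _ K _ cu.
have sE t : sig K u t = \sum_(p <- index_enum ('I_K * 'I_K)%type)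
    (K%:R^-1 * hat u (p.1%:Z - p.2%:Z)) * cos ((p.1%:Z - p.2%:Z)%:~R * t).
  rewrite sigE// pair_bigA mulr_sumr.
  by apply: eq_bigr => p _ /=; rewrite hs0 mul0r addr0; ring.
have key : hat (fun t => 2^-1 * (sig K u (t - x) + sig K u (t + x))) n =
    hat (sig K u) n * cos (n%:~R * x).
  have -> : (fun t => 2^-1 * (sig K u (t - x) + sig K u (t + x))) =
    (fun t => \sum_(p <- index_enum ('I_K * 'I_K)%type)
    (K%:R^-1 * hat u (p.1%:Z - p.2%:Z) * cos ((p.1%:Z - p.2%:Z)%:~R * x))
      * cos ((p.1%:Z - p.2%:Z)%:~R * t)).
    apply/funext => t; rewrite !sE -big_split mulr_sumr; apply: eq_bigr => p _ /=.
    by rewrite [_ * (t - x)]mulrBr [_ * (t + x)]mulrDr cosB cosD; field; rewrite pnatr_eq0 -lt0n.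
  rewrite (funext sE) !hat_sum; [|by move=> p; cts..].
  rewrite mulr_suml; apply: eq_bigr => p _.
  rewrite !hatZ; [|by cts..].
  rewrite hat_cos; case: eqP => [k1|_]; last case: eqP => [k2|_].
  - have -> : n = - (p.1%:Z - p.2%:Z) by apply/eqP; rewrite -addr_eq0; apply/eqP.
    by rewrite intrN mulNr cosN; ring.
  - have -> : n = p.1%:Z - p.2%:Z by apply/eqP; rewrite -subr_eq0; apply/eqP.
    by rewrite mulrAC.
  - by rewrite addr0 !mulr0 mul0r.
have c1 : cont (fun t => u (t - x)) by apply: (@cts_comp _ (fun t => t - x) u) => //; cts.
have c2 : cont (fun t => u (t + x)) by apply: (@cts_comp _ (fun t => t + x) u) => //; cts.
have c3 : cont (fun t => sig K u (t - x)) by apply: (@cts_comp _ (fun t => t - x) (sig K u)) => //; cts.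
have c4 : cont (fun t => sig K u (t + x)) by apply: (@cts_comp _ (fun t => t + x) (sig K u)) => //; cts.
have e1 : `|hat (fun t => 2^-1 * (u (t - x) + u (t + x))) n -
     hat (fun t => 2^-1 * (sig K u (t - x) + sig K u (t + x))) n| <= e / 2.
  rewrite -hatB; [|by cts|by cts].
  apply: hat_le_cst => [|t]; first by cts.
  rewrite -mulrBr opprD addrACA normrM ger0_norm ?invr_ge0//.
  rewrite ler_pdivrMl//; apply: le_trans (ler_normD _ _) _.
  rewrite [2 * _]mulr_natl mulr2n; apply: lerD; rewrite distrC; exact: hK.
have e2 : `|hat (sig K u) n * cos (n%:~R * x) - hat u n * cos (n%:~R * x)| <= e / 2.
  rewrite -mulrBl normrM -[leRHS]mulr1 ler_pM ?cos_max//.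
  rewrite -hatB//; apply: hat_le_cst => [|t]; [by cts|exact: hK].
rewrite -(subrK (hat (fun t => 2^-1 * (sig K u (t - x) + sig K u (t + x))) n) (hat _ n)).
rewrite -addrA key in e1 *; apply: le_trans (ler_normD _ _) _.
by rewrite [e]splitr lerD.
Qed.

Lemma good_translate u x : good u -> good (fun t => 2^-1 * (u (t - x) + u (t + x))).
Proof.
move=> [du up ue]; split.
- apply: D2M; first exact: D2C.
  by apply: D2D; apply: D2_comp => //; apply: D2D; [exact: D2I|exact: D2C|exact: D2I|exact: D2C].
- by move=> k y; rewrite addrAC up [y + _ + x]addrAC up.
- move=> y; rewrite -(ue (- y - x)) -(ue (- y + x)) !opprD !opprK.
  by rewrite [u _ + _]addrC.
Qed.

(* One step of the method of conditional expectations. *)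
Lemma choose_point lam (r : seq int) (A B : int -> R) : 0 < lam -> lam <= 10^-1 ->
  (forall n, n \in r -> n != 0) -> (forall n, 0 <= A n) -> (forall n, 0 <= B n) ->
  exists x, \sum_(n <- r) (A n * expR (lam * cos (n%:~R * x)) + B n * expR (- (lam * cos (n%:~R * x))))
   <= (1 + lam ^+ 2) * \sum_(n <- r) (A n + B n).
Proof.
move=> l0 l1 r0 A0 B0; set W := \sum_(n <- r) (A n + B n).
pose U x := \sum_(n <- r) (A n * expR (lam * cos (n%:~R * x)) + B n * expR (- (lam * cos (n%:~R * x)))).
have cU : cont U by rewrite /U; cts.
have W0 : 0 <= W by apply: sumr_ge0 => n _; rewrite addr_ge0.
have one (l : R) n : `|l| <= 10^-1 -> n != 0 ->
    av (fun x => expR (l * cos (n%:~R * x))) <= 1 + 2 / 3 * l ^+ 2.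
  move=> hl n0.
  apply: (@le_trans _ _ (av (fun x => (1 + 2 / 3 * l ^+ 2) + l * cos (n%:~R * x)))).
    apply: av_le => [||x]; [by cts|by cts|].
    set c := cos _.
    have hc : c ^+ 2 <= 1 by rewrite -sqr_abs exprn_ile1// cos_max.
    have := @expR_le_quad R (l * c).
    have -> : `|l * c| <= 10^-1.
      by apply: le_trans hl; rewrite normrM ler_piMr// cos_max.
    move=> /(_ isT) h; apply: le_trans h _.
    by have := ler_wpM2l (sqr_ge0 l) hc; rewrite exprMn; lra.
  rewrite avD ?av_cst ?avZ ?av_cosn ?(negPf n0) ?mulr0 ?addr0//; by cts.
have avU : av U <= (1 + 2 / 3 * lam ^+ 2) * W.
  rewrite /U av_sum; last by move=> n; cts.
  rewrite mulr_sumr big_seq [leRHS]big_seq; apply: ler_sum => n nr.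
  rewrite avD; [|by cts|by cts]. rewrite !avZ; [|by cts|by cts].
  have h1 := one lam n; have h2 := one (- lam) n.
  rewrite ger0_norm ?(ltW l0)// in h1.
  rewrite normrN ger0_norm ?(ltW l0)// sqrrN in h2.
  have {}h2 : av (fun t => expR (- (lam * cos (n%:~R * t)))) <= 1 + 2 / 3 * lam ^+ 2.
    rewrite (_ : (fun t => _) = (fun t => expR (- lam * cos (n%:~R * t)))).
      exact: h2 l1 (r0 _ nr).
    by apply/funext => t; rewrite mulNr.
  rewrite mulrC [X in _ + X]mulrC mulrDr.
  by apply: lerD; apply: ler_wpM2r => //; exact: h1 l1 (r0 _ nr).
(* Were [U] above the bound everywhere, so would be its mean. The slack between [2 / 3 * lam ^+ 2]
   and [lam ^+ 2] then leaves only [W = 0], where [U] vanishes. *)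
have [[x hx]|H] := pselect (exists x, U x <= (1 + lam ^+ 2) * W); first by exists x.
have lt x : (1 + lam ^+ 2) * W < U x.
  by rewrite ltNge; apply/negP => h; apply: H; exists x.
have h : (1 + lam ^+ 2) * W <= av U.
  rewrite -[leLHS]av_cst; apply: av_le => // [|t]; first by cts.
  exact: ltW.
have := le_trans h avU; rewrite -subr_ge0 -mulrBl.
have l2 : 0 < lam ^+ 2 by rewrite exprn_gt0.
have -> : 1 + 2 / 3 * lam ^+ 2 - (1 + lam ^+ 2) = - (3^-1 * lam ^+ 2) by field.
rewrite mulNr oppr_ge0 pmulr_rle0; last by rewrite mulr_gt0// invr_gt0.
move=> Wle; have WE : W = 0 by apply/eqP; rewrite eq_le Wle W0.
exfalso; have := lt 0; rewrite WE mulr0 ltNge => /negP; apply.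
rewrite /U big_seq; apply: sumr_le0 => n nr.
have : A n + B n = 0.
  apply/eqP; move: WE => /eqP; rewrite /W psumr_eq0; last by move=> k _; rewrite addr_ge0.
  by move=> /allP /(_ n nr).
have := A0 n; have := B0 n => b a ab.
have -> : A n = 0 by lra. have -> : B n = 0 by lra.
by rewrite !mul0r addr0.
Qed.

(** Each new point costs a factor [1 + lam ^+ 2] when [choose_point] is applied to the current
    weights. Both exponentials are carried along because the modulus of the cosine sums is to be
    controlled. *)
Lemma choose_points lam (r : seq int) (w : int -> R) M : 0 < lam -> lam <= 10^-1 ->
  (forall n, n \in r -> n != 0) -> (forall n, 0 <= w n) ->
  exists2 xs : seq R, size xs = M & forall X, X = (fun n => lam * \sum_(x <- xs) cos (n%:~R * x)) ->
    \sum_(n <- r) w n * (expR (X n) + expR (- X n)) <=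
      (1 + lam ^+ 2) ^+ M * (2 * \sum_(n <- r) w n).
Proof.
move=> l0 l1 r0 w0; elim: M => [|M [xs sx hx]].
  exists [::] => // X ->; rewrite mul1r mulr_sumr; apply: ler_sum => n _.
  by rewrite big_nil mulr0 oppr0 expR0 mulrC.
pose X n := lam * \sum_(x <- xs) cos (n%:~R * x).
have [||x h] := @choose_point lam r (fun n => w n * expR (X n)) (fun n => w n * expR (- X n)) l0 l1 r0.
- by move=> n; rewrite mulr_ge0 ?expR_ge0.
- by move=> n; rewrite mulr_ge0 ?expR_ge0.
exists (x :: xs); first by rewrite /= sx.
move=> Y ->; apply: le_trans (_ : _ <= (1 + lam ^+ 2) * \sum_(n <- r) w n * (expR (X n) + expR (- X n))) _.
  apply: le_trans (le_trans _ h) _.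
    apply: ler_sum => n _; rewrite /= big_cons [lam * (_ + _)]mulrDr opprD !expRD -/(X n).
    by rewrite le_eqVlt; apply/orP; left; apply/eqP; ring.
  by rewrite ler_wpM2l ?addr_ge0 ?sqr_ge0//; apply: ler_sum => n _; rewrite mulrDr.
rewrite [_ ^+ M.+1]exprS -mulrA ler_wpM2l ?addr_ge0 ?sqr_ge0//; exact: hx.
Qed.

Lemma powR_le_expR q y : 0 < q -> `|y| `^ q <= q `^ q * (expR y + expR (- y)).
Proof.
move=> q0; have pos z : 0 <= z -> z `^ q <= q `^ q * expR z.
  move=> z0; have -> : z = q * (z / q) by rewrite mulrCA divff ?mulr1// gt_eqF.
  have zq : 0 <= z / q by rewrite divr_ge0// ltW.
  rewrite powRM ?(ltW q0)// ler_wpM2l ?powR_ge0// [q * _]mulrC expRM.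
  apply: ge0_ler_powR; rewrite ?nnegrE ?(ltW q0) ?expR_ge0//.
  by apply: le_trans (expR_ge1Dx _); rewrite lerDr.
have [y0|y0] := leP 0 y.
  rewrite ger0_norm//; apply: le_trans (pos _ y0) _.
  by rewrite ler_wpM2l ?powR_ge0// lerDl expR_ge0.
rewrite ltr0_norm//; apply: le_trans (pos _ _) _; first by rewrite oppr_ge0 ltW.
by rewrite ler_wpM2l ?powR_ge0// lerDr expR_ge0.
Qed.

Definition zball m : seq int := [seq Posz i | i <- iota 0 m] ++ [seq Negz i | i <- iota 0 m].

Lemma zball_uniq m : uniq (zball m).
Proof.
rewrite cat_uniq; apply/and3P; split.
- by rewrite map_inj_uniq ?iota_uniq// => ? ? [].
- by apply/hasPn => _ /mapP[j _ ->]; apply/negP => /mapP[? _].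
- by rewrite map_inj_uniq ?iota_uniq// => ? ? [].
Qed.

Lemma mem_zball m n : (`|n| < m)%N -> n \in zball m.
Proof.
rewrite mem_cat; case: n => k km; apply/orP; [left|right].
  by apply/mapP; exists k => //; rewrite mem_iota leq0n add0n; exact: km.
by apply/mapP; exists k => //; rewrite mem_iota leq0n add0n; exact: ltnW km.
Qed.

End ArcLayer.
Section ArcLayerExists.
Variable R : realType.
Implicit Types (f g h u : R -> R) (x y z t c q D E s e d lam : R) (n : int) (m M : nat).

(** The normalised cube of the positive part of [cos t - cos d]: it is at most [(d^2 / 2)^3], and at
    least [(3 d^2 / 128)^3] for [|t| <= d / 8], so its maximum exceeds its mean by at most
    [C / d]. *)
Lemma kernel : exists2 C : R, 0 < C & forall d, 0 < d -> d <= 1 -> exists k : R -> R,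
  [/\ good k, forall t, 0 <= k t, av k = 1, forall t, k t <= C / d &
      forall t, k t != 0 -> cos d < cos t].
Proof.
have p0 := @pi_gt0 R.
exists (pi * 128 ^+ 3 / 27); first by rewrite divr_gt0// mulr_gt0// exprn_gt0.
move=> d d0 d1; pose L t := pos3 (cos t - cos d).
have gL : good L.
  apply: (@good_comp _ (fun t => cos t - cos d)); last exact: D2_pos3.
  apply: goodD; last exact: good_cst.
  have := @good_cosn R 1; congr good; apply/funext => t; by rewrite mul1r.
have cL := good_cont gL.
have L0 t : 0 <= L t by exact: pos3_ge0.
have dpi : d <= pi by apply: le_trans d1 (le_trans _ (pi_ge2 R)); rewrite ler1n.
have cd : cos d <= 1 - d ^+ 2 / 32.
  have := @sqr_le_cos R d; rewrite ger0_norm ?(ltW d0)// => /(_ dpi); lra.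
have cd2 : 1 - d ^+ 2 / 2 <= cos d := cos_ge_sqr d.
pose v := 3 * d ^+ 2 / 128.
have v0 : 0 < v by rewrite divr_gt0// mulr_gt0// exprn_gt0.
have low t : `|t| <= d / 8 -> v ^+ 3 <= L t.
  move=> td; have ct : 1 - d ^+ 2 / 128 <= cos t.
    apply: le_trans (cos_ge_sqr t).
    have : `|t| ^+ 2 <= (d / 8) ^+ 2 by rewrite lerXn2r ?nnegrE ?divr_ge0 ?(ltW d0).
    rewrite sqr_abs expr_div_n; lra.
  have vc : v <= cos t - cos d by rewrite /v; lra.
  have c0 : 0 <= cos t - cos d by apply: le_trans vc; exact: ltW.
  rewrite /L /pos3 /pos max_r// lerXn2r ?nnegrE//; exact: ltW.
have avL : v ^+ 3 * (d / 8) / pi <= av L.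
  apply: av_ge_on => //; first by rewrite divr_gt0.
  by apply: le_trans dpi; rewrite ler_pdivrMr// ler_peMr ?(ltW d0)// ler1n.
have A0 : 0 < av L.
  by apply: lt_le_trans avL; rewrite divr_gt0// mulr_gt0 ?exprn_gt0// divr_gt0.
have up t : L t <= (d ^+ 2 / 2) ^+ 3.
  rewrite /L /pos3; apply: lerXn2r; rewrite ?nnegrE ?pos_ge0 ?divr_ge0 ?sqr_ge0//.
  by rewrite /pos ge_max divr_ge0 ?sqr_ge0//=; have := cos_le1 t; lra.
exists (fun t => (av L)^-1 * L t); split.
- by apply: goodM => //; exact: good_cst.
- by move=> t; rewrite mulr_ge0// invr_ge0 ltW.
- by rewrite avZ// mulVf// gt_eqF.
- move=> t; rewrite ler_pdivrMl//; apply: le_trans (up t) _.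
  apply: le_trans (ler_wpM2r _ avL); last by rewrite !divr_ge0 ?mulr_ge0 ?exprn_ge0 ?ltW.
  rewrite le_eqVlt; apply/orP; left; apply/eqP; rewrite /v.
  by move: pi p0 => p p1; field; rewrite !gt_eqF.
- move=> t; rewrite mulf_eq0 negb_or => /andP[_ /pos3_gt0]; by rewrite subr_gt0.
Qed.

(** At [n] the coefficient is [hat k n] times a mean of cosines at the points. The mean is exactly 1
    at 0, is made small for [0 < |n| < N] by the choice of the points, and is bounded by 1 beyond,
    where the C^2 decay of [k] suffices. *)
Lemma arc_layer_core q e d k C M : 2 < q -> 0 < e -> 0 < M%:R :> R -> 0 < d ->
  good k -> (forall t, 0 <= k t) -> av k = 1 -> (forall t, k t <= C / d) ->
  (10 * q) `^ q * (6 * C) / d / M%:R `^ (q / 2) <= e / 2 ->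
  exists2 xs : seq R, size xs = M &
    lq q (fun t => M%:R^-1 * (\sum_(x <- xs) 2^-1 * (k (t - x) + k (t + x))) - 1) e.
Proof.
move=> q2 e0 M0 d0 gk k0 k1 kC hM.
have q0 : 0 < q by lra.
have ck := good_cont gk; have [dk pk ek] := gk.
have Mn : M%:R != 0 :> R by rewrite gt_eqF.
have C0 : 0 <= C.
  have := le_trans (k0 0) (kC 0); by rewrite pmulr_lge0// invr_gt0.
have hk1 n : `|hat k n| <= 1.
  apply: le_trans (hat_le_av n ck) _; rewrite -k1; apply: av_le => [||t] //; first by cts.
  by rewrite ger0_norm.
have bes (r : seq int) : uniq r -> \sum_(n <- r) hat k n ^+ 2 <= C / d.
  move=> ur; apply: le_trans (hat_bessel ck ur) _.
  apply: (@le_trans _ _ (av (fun t => C / d * k t))).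
    by apply: av_le => [||t]; [cts|cts|rewrite expr2 ler_wpM2r].
  by rewrite avZ// k1 mulr1.
have [B B0 hB] := D2_coef dk pk.
(* [N] depends on [k] through [B], which is harmless: by Bessel the weights below [N] sum to at most
   [C / d] whatever [N] is. *)
pose N := (Num.truncn (10 * B ^+ 2 / e)).+1.
have hN : 10 * B ^+ 2 / e < N%:R by rewrite /N truncnS_gt.
have N0 : (0 < N)%N by [].
clearbody N.
have NR : 1 <= N%:R :> R by rewrite ler1n.
(* The natural scale of a sum of [M] random cosines; it keeps [(1 + lam ^+ 2) ^+ M] bounded. *)
pose lam : R := (10 * Num.sqrt M%:R)^-1.
have sM : 0 < Num.sqrt M%:R :> R by rewrite sqrtr_gt0.
have sM1 : 1 <= Num.sqrt M%:R :> R.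
  by rewrite -[leLHS]sqrtr1 ler_wsqrtr// ler1n -(ltr0n R).
have l0 : 0 < lam by rewrite invr_gt0 mulr_gt0.
have l1 : lam <= 10^-1 by rewrite lef_pV2 ?posrE ?mulr_gt0// ler_peMr.
pose s0 := [seq n <- zball N | n != 0].
have s00 n : n \in s0 -> n != 0 by rewrite mem_filter => /andP[].
have us0 : uniq s0 by rewrite filter_uniq// zball_uniq.
have [xs sxs hx] := @choose_points R lam s0 (fun n => hat k n ^+ 2) M l0 l1 s00 (fun n => sqr_ge0 _).
exists xs => //.
pose X n := lam * \sum_(x <- xs) cos (n%:~R * x).
have {hx} hx := hx X erefl.
have lM : lam ^+ 2 * M%:R = 100^-1.
  rewrite /lam exprVn exprMn sqr_sqrtr ?(ltW M0)//.
  by field.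
have hx' : \sum_(n <- s0) hat k n ^+ 2 * (expR (X n) + expR (- X n)) <= 6 * C / d.
  apply: le_trans hx _.
  have h1 : (1 + lam ^+ 2) ^+ M <= 3.
    apply: (@le_trans _ _ (expR (lam ^+ 2) ^+ M)).
      by apply: lerXn2r; rewrite ?nnegrE ?addr_ge0 ?sqr_ge0 ?expR_ge0 ?expR_ge1Dx.
    rewrite -expRM_natr lM; apply: le_trans (expR_le_quad _) _; last by lra.
    by rewrite ger0_norm; lra.
  have h2 := bes _ us0.
  have S0 : 0 <= \sum_(n <- s0) hat k n ^+ 2 by apply: sumr_ge0 => n _; exact: sqr_ge0.
  apply: (@le_trans _ _ (3 * (2 * (C / d)))); last by rewrite le_eqVlt; apply/orP; left; apply/eqP; field; rewrite gt_eqF.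
  apply: ler_pM => //; [by rewrite exprn_ge0// addr_ge0// sqr_ge0|by rewrite mulr_ge0|].
  by rewrite ler_wpM2l.
pose G t := M%:R^-1 * (\sum_(x <- xs) 2^-1 * (k (t - x) + k (t + x))).
have gG x : good (fun t => 2^-1 * (k (t - x) + k (t + x))) := good_translate x gk.
have cG x : cont (fun t => 2^-1 * (k (t - x) + k (t + x))) := good_cont (gG x).
have csG : cont (fun t => \sum_(x <- xs) 2^-1 * (k (t - x) + k (t + x))) := cts_sum cG.
have hG n : hat (fun t => G t - 1) n = hat k n * (M%:R^-1 * \sum_(x <- xs) cos (n%:~R * x)) - (n == 0)%:R.
  rewrite /G hatB; [|by cts|by cts].
  rewrite hat1 hatZ// hat_sum//; congr (_ - _).
  rewrite mulrCA; congr (_ * _); rewrite mulr_sumr; apply: eq_bigr => x _.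
  exact: hat_translate.
have X1 n : `|M%:R^-1 * \sum_(x <- xs) cos (n%:~R * x)| <= 1.
  rewrite normrM ger0_norm ?invr_ge0 ?(ltW M0)// ler_pdivrMl// mulr1.
  apply: le_trans (ler_norm_sum _ _ _) _.
  apply: le_trans (ler_sum _ (fun x _ => cos_max _)) _.
  by rewrite big_const_seq count_predT iter_addr_0 sxs.
have z0 : (0 : R) `^ q = 0 by rewrite powR0 // gt_eqF.
have p2 x : `|x| <= 1 -> `|x| `^ q <= x ^+ 2.
  move=> x1; have [->|h0] := eqVneq x 0; first by rewrite normr0 z0 sqr_ge0.
  rewrite -sqr_abs -powR_mulrn//; apply: ger_powR; last exact: ltW.
  by rewrite normr_gt0 h0.
have term n : n != 0 -> hat (fun t => G t - 1) n = hat k n * (M%:R^-1 * \sum_(x <- xs) cos (n%:~R * x)).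
  by move=> n0; rewrite hG (negPf n0) subr0.
pose Q := (10 * q) `^ q / M%:R `^ (q / 2).
have Q0 : 0 <= Q by rewrite divr_ge0 ?powR_ge0.
have small n : n != 0 -> `|hat (fun t => G t - 1) n| `^ q <=
    Q * (hat k n ^+ 2 * (expR (X n) + expR (- X n))).
  move=> n0; rewrite term// normrM powRM//.
  rewrite mulrCA; apply: ler_pM; rewrite ?powR_ge0//; first exact: p2.
  have -> : M%:R^-1 * \sum_(x <- xs) cos (n%:~R * x) = (10 / Num.sqrt M%:R) * X n.
    rewrite /X mulrA; congr (_ * _); rewrite /lam -{1}(sqr_sqrtr (ltW M0)).
    by field; rewrite gt_eqF.
  rewrite normrM powRM// ger0_norm ?divr_ge0 ?(ltW sM)//.
  apply: le_trans (ler_wpM2l (powR_ge0 _ _) (powR_le_expR _ q0)) _.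
  rewrite mulrA ler_wpM2r ?addr_ge0 ?expR_ge0// /Q le_eqVlt; apply/orP; left; apply/eqP.
  have e1 : (10 / Num.sqrt M%:R) `^ q * M%:R `^ (q / 2) = 10 `^ q.
    have -> : M%:R `^ (q / 2) = (Num.sqrt M%:R) `^ q.
      by rewrite -powR12_sqrt ?(ltW M0)// -powRrM mulrC.
    by rewrite -powRM ?divr_ge0 ?(ltW sM)// divfK// gt_eqF.
  rewrite powRM ?(ltW q0)// -e1; move: (M%:R `^ (q / 2)) (powR_gt0 (q / 2) M0) => v v0.
  by rewrite mulrAC mulrK// unitfE gt_eqF.
move=> s us.
have F0 : `|hat (fun t => G t - 1) 0| `^ q = 0.
  rewrite hG hat0 k1 mul1r (_ : \sum_(x <- xs) _ = M%:R).
    by rewrite mulVf// eqxx subrr normr0 z0.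
  under eq_bigr do rewrite mul0r cos0.
  by rewrite big_const_seq count_predT iter_addr_0 sxs.
apply: (@le_trans _ _ (\sum_(n <- s) ((if n \in s0 then Q * (hat k n ^+ 2 * (expR (X n) + expR (- X n))) else 0)
   + B ^+ 2 / N%:R * wt R n))).
  apply: ler_sum => n _; rewrite -/(G _).
  have w0 : 0 <= B ^+ 2 / N%:R * wt R n by rewrite mulr_ge0 ?wt_ge0// divr_ge0 ?sqr_ge0.
  case: ifP => ns0.
    by apply: le_trans (small n (s00 n ns0)) _; rewrite lerDl.
  have [->|n0] := eqVneq n 0.
    by rewrite F0 add0r mulr_ge0 ?wt_ge0// divr_ge0 ?sqr_ge0.
  have nN : (N <= `|n|)%N.
    by rewrite leqNgt; apply/negP => h; move: ns0; rewrite mem_filter n0 mem_zball.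
  rewrite add0r term//; apply: le_trans (p2 _ _) _.
    by rewrite normrM mulr_ile1.
  have [hBn _] := hB n.
  rewrite -sqr_abs normrM exprMn.
  apply: (@le_trans _ _ (`|hat k n| ^+ 2 * 1)).
    by rewrite ler_wpM2l ?sqr_ge0// exprn_ile1.
  rewrite mulr1; apply: (@le_trans _ _ ((B * wt R n) ^+ 2)).
    by rewrite lerXn2r ?nnegrE// mulr_ge0 ?wt_ge0.
  rewrite exprMn -mulrA ler_wpM2l ?sqr_ge0// expr2 ler_wpM2r ?wt_ge0//.
  rewrite /wt (negPf n0) lef_pV2 ?posrE ?exprn_even_gt0 ?intr_eq0//=; last exact: lt_le_trans NR.
  have nR : N%:R <= `|n%:~R| :> R.
    have -> : `|n%:~R| = (`|n|%N)%:R :> R by rewrite natr_absz intr_norm.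
    by rewrite ler_nat.
  rewrite -sqr_abs expr2; apply: le_trans (nR) _.
  by rewrite ler_peMl// (le_trans NR nR).
rewrite big_split [e]splitr; apply: lerD => /=; last first.
  rewrite -mulr_sumr; apply: (@le_trans _ _ (B ^+ 2 / N%:R * 5)).
    by rewrite ler_wpM2l ?sum_wt// divr_ge0 ?sqr_ge0.
  rewrite mulrAC ler_pdivrMr ?(lt_le_trans ltr01 NR)//.
  by rewrite ltr_pdivrMr// in hN; move: hN; clear; lra.
rewrite -big_mkcond -big_filter; apply: (@le_trans _ _ (Q * (6 * C / d))); last first.
  apply: le_trans hM; rewrite le_eqVlt /Q; apply/orP; left; apply/eqP; ring.
apply: le_trans (ler_wpM2l Q0 hx'); rewrite -mulr_sumr ler_wpM2l//.
apply: ler_sum_subset => //; first exact: filter_uniq.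
  by move=> n; rewrite mem_filter => /andP[].
by move=> n; rewrite mulr_ge0 ?sqr_ge0// addr_ge0 ?expR_ge0.
Qed.

(* Random-like points: [N] arcs of length [d] with [N ~ d^(-2/q)] already have
   Fourier coefficients of size [N^(-1/2)]. *)
Lemma arc_layer q s e : 2 < q -> 2 / q < s -> 0 < e -> exists G xs d,
  [/\ good G, forall t, 0 <= G t, lq q (fun t => G t - 1) e,
      [/\ 0 < d, d <= e & (size xs)%:R * (2 * d) `^ s <= e] &
      forall t, G t != 0 -> exists2 x, x \in xs & cos d < cos (t - x)].
Proof.
move=> q2 qs e0; have q0 : 0 < q by lra.
have [C C0 hC] := kernel.
pose E := 2 * ((10 * q) `^ q * (6 * C)) / e.
have E0 : 0 < E by rewrite divr_gt0 ?mulr_gt0 ?powR_gt0 ?mulr_gt0.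
have a0 : 0 < s - 2 / q by rewrite subr_gt0.
have s0 : 0 < s by apply: lt_trans qs; rewrite divr_gt0.
pose E2 := E `^ (2 / q).
have E20 : 0 < E2 by rewrite powR_gt0.
have [N1 hN1] := powR_unbounded (4 * 2 `^ s * (E2 + 1) / e) a0.
have [N2 hN2] := powR_unbounded e^-1 ltr01.
pose N := (N1 + N2).+1.
have h1 : 4 * 2 `^ s * (E2 + 1) / e <= N%:R `^ (s - 2 / q).
  by apply: hN1; rewrite /N leqW// leq_addr.
have h2 : e^-1 <= N%:R.
  have := hN2 N; rewrite powRr1//; apply; by rewrite /N leqW// leq_addl.
have NR : 1 <= N%:R :> R by rewrite ler1n.
have NR0 : 0 < N%:R :> R := lt_le_trans ltr01 NR.
clearbody N.
pose d : R := N%:R^-1.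
have d0 : 0 < d by rewrite invr_gt0.
have d1 : d <= 1 by rewrite invf_le1.
have [k [gk k0 k1 kC ks]] := hC d d0 d1.
(* With [d = N^-1], [arc_layer_core] asks for [M ^ (q / 2) >= E * N]. This [M] leaves [M * d ^ s] of
   order [N ^ (2 / q - s)], which is small since [s > 2 / q]. *)
pose M := (Num.truncn ((E * N%:R) `^ (2 / q))).+1.
have M1 : (E * N%:R) `^ (2 / q) <= M%:R by rewrite ltW// truncnS_gt.
have M2 : M%:R <= (E * N%:R) `^ (2 / q) + 1.
  by rewrite /M -natr1 lerD2r truncn_le powR_ge0.
have M0 : 0 < M%:R :> R by rewrite ltr0n.
clearbody M.
have hM : (10 * q) `^ q * (6 * C) / d / M%:R `^ (q / 2) <= e / 2.
  rewrite ler_pdivrMr ?powR_gt0// /d invrK.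
  have : E * N%:R <= M%:R `^ (q / 2).
    have -> : E * N%:R = ((E * N%:R) `^ (2 / q)) `^ (q / 2).
      rewrite -powRrM (_ : 2 / q * (q / 2) = 1); last by field; rewrite gt_eqF.
      by rewrite powRr1// mulr_ge0 ?(ltW E0) ?(ltW NR0).
    by apply: ge0_ler_powR; rewrite ?nnegrE ?powR_ge0 ?divr_ge0 ?(ltW q0) ?(ltW M0).
  move=> h; have e2 : 0 <= e / 2 by rewrite divr_ge0 ?(ltW e0).
  apply: le_trans (ler_wpM2l e2 h).
  by rewrite le_eqVlt; apply/orP; left; apply/eqP; rewrite /E; field; rewrite gt_eqF.
have [xs sxs hxs] := arc_layer_core q2 e0 M0 d0 gk k0 k1 kC hM.
exists (fun t => M%:R^-1 * (\sum_(x <- xs) 2^-1 * (k (t - x) + k (t + x)))), (xs ++ [seq - x | x <- xs]), d.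
split=> //.
- apply: goodM; first exact: good_cst.
  by apply: good_sum => x; exact: good_translate.
- by move=> t; rewrite mulr_ge0 ?invr_ge0 ?(ltW M0)// sumr_ge0// => x _; rewrite mulr_ge0 ?invr_ge0// addr_ge0.
- split=> //; first by rewrite /d -[e]invrK lef_pV2 ?posrE ?invr_gt0.
  rewrite size_cat size_map sxs natrD (_ : M%:R + M%:R = 2 * M%:R); last by ring.
  have dP p : d `^ p = N%:R `^ (- p).
    by rewrite /d -(powR_inv1 (ltW NR0)) -powRrM mulN1r.
  rewrite powRM ?(ltW d0)//.
  have h3 : M%:R <= (E2 + 1) * N%:R `^ (2 / q).
    have e3 : (E * N%:R) `^ (2 / q) = E2 * N%:R `^ (2 / q) by rewrite powRM ?(ltW E0) ?(ltW NR0).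
    rewrite e3 in M2; apply: le_trans M2 _; rewrite [leRHS]mulrDl mul1r; apply: lerD => //.
    apply: (@le_trans _ _ (1 `^ (2 / q))); first by rewrite powR1.
    by apply: ge0_ler_powR; rewrite ?nnegrE ?divr_ge0 ?(ltW q0) ?(ltW NR0)//.
  have p0 : 0 <= 2 `^ s * d `^ s by rewrite mulr_ge0 ?powR_ge0.
  apply: (@le_trans _ _ (2 * ((E2 + 1) * N%:R `^ (2 / q)) * (2 `^ s * d `^ s))).
    by rewrite ler_wpM2r// ler_wpM2l.
  have -> : 2 * ((E2 + 1) * N%:R `^ (2 / q)) * (2 `^ s * d `^ s) =
     2 * 2 `^ s * (E2 + 1) * (N%:R `^ (s - 2 / q))^-1.
    rewrite dP -powRN opprB [in RHS]powRD; last by rewrite (gt_eqF NR0) implybT.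
    by ring.
  rewrite ler_pdivrMr ?powR_gt0//.
  rewrite ler_pdivrMr// in h1.
  have : 0 <= 2 `^ s * (E2 + 1) by rewrite mulr_ge0 ?powR_ge0// addr_ge0 ?(ltW E20).
  move: h1; rewrite [e * _]mulrC; move: (N%:R `^ _) => v; lra.
- move=> t; rewrite mulf_eq0 negb_or => /andP[_ S0].
  have [/hasP[x xx /orP[hx|hx]]|/hasPn h] := boolP (has (fun x => (k (t - x) != 0) || (k (t + x) != 0)) xs).
  - by exists x; [rewrite mem_cat xx|exact: ks].
  - exists (- x); last by rewrite opprK; exact: ks.
    by rewrite mem_cat map_f ?orbT.
  - move: S0; rewrite big1_seq ?eqxx// => x /= xx; have := h x xx.
    by rewrite negb_or !negbK => /andP[/eqP -> /eqP ->]; rewrite addr0 mulr0.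
Qed.

End ArcLayerExists.
(** * The sequence of densities *)

Section Sequence.
Variable R : realType.
Implicit Types (f g h u S nu : R -> R) (x y t c q r D E s e d : R) (n : int) (m M j k : nat).

Lemma lq_const1 q : 1 < q -> lq q (fun=> 1 : R) 1.
Proof.
move=> q1 r ur; apply: le_trans (_ : _ <= \sum_(n <- r) (1 : R) * (n == 0)%:R) _; last first.
  exact: sum_delta.
apply: ler_sum => n _; rewrite hat1 mul1r; case: eqP => _.
  by rewrite normr1 powR1.
by rewrite normr0 powR0// gt_eqF// (lt_trans _ q1).
Qed.

Lemma lq_good q u : 1 < q -> good u -> exists D, lq q u D.
Proof.
move=> q1 [du up ue]; have [C C0 hC] := C2_multiplier q1 du up ue.
exists (C * 1); have -> : u = (fun t => u t * 1) by apply/funext => t; rewrite mulr1.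
exact: hC (@ctsC R 1) (lq_const1 q1).
Qed.

Lemma lqZ q f c D : 0 <= c -> cont f -> lq q f D -> lq q (fun t => c * f t) (c `^ q * D).
Proof.
move=> c0 cf fD s us; rewrite (eq_bigr (fun n => c `^ q * `|hat f n| `^ q)).
  by rewrite -mulr_sumr ler_wpM2l ?powR_ge0//; exact: fD.
by move=> n _; rewrite hatZ// normrM (ger0_norm c0) powRM.
Qed.

Lemma lq_exponent q r f e : 0 < q -> q <= r -> e <= 1 -> lq q f e -> lq r f e.
Proof.
move=> q0 qr e1 fe s us; apply: le_trans (fe s us); apply: ler_sum => n _.
have h1 : `|hat f n| <= 1.
  by apply: (lq1 n q0 ler01); rewrite powR1; apply: lq_le fe.
have [->|h0] := eqVneq (hat f n) 0.
  by rewrite normr0 !powR0// gt_eqF// (lt_le_trans q0).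
by apply: ger_powR => //; rewrite normr_gt0 h0.
Qed.

Lemma multiplier_small q u e : 1 < q -> good u -> 0 < e -> exists2 d, 0 < d &
  forall h, cont h -> lq q h d -> lq q (fun t => u t * h t) e.
Proof.
move=> q1 [du up ue] e0; have [C C0 hC] := C2_multiplier q1 du up ue.
have C1 : 0 < C + 1 by rewrite ltr_wpDl.
exists (e / (C + 1)); first by rewrite divr_gt0.
move=> h ch hd; apply: lq_le (hC h _ ch hd).
by rewrite mulrA ler_pdivrMr// mulrC ler_wpM2l ?(ltW e0)// lerDl.
Qed.

(** Weak inequalities, so that a stage is closed although the densities live on a set given by
    strict ones. *)
Definition layer c m (xs : seq R) d t : Prop :=
  1 <= c * cs m t <= 512 /\ exists2 x, x \in xs & cos d <= cos (t - x).

(** The tolerance of a factor depends on the multiplier norms of the densities it multiplies, so the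
    arcs are chosen after the Riesz factors. One arc factor [P] serves both densities, as a small
    [l_q] bound is also an [l_r] bound. *)
Lemma refine q r s e S nu : 2 < q -> q < r -> 2 / q < s -> 0 < e ->
  good S -> good nu -> (forall t, 0 <= nu t) ->
  exists S' nu' c m xs d,
  [/\ [/\ good S', good nu' & forall t, 0 <= nu' t],
      lq q (fun t => S' t - S t) e, lq r (fun t => nu' t - nu t) e,
      [/\ 0 < c, c `^ q * m%:R `^ (q - 1) <= e, 0 < d, d <= e & (size xs)%:R * (2 * d) `^ s <= e] &
      forall t, (S' t != 0) || (nu' t != 0) ->
        ((S t != 0) || (nu t != 0)) /\ layer c m xs d t].
Proof.
move=> q2 qr qs e0 gS gn n0.
have q1 : 1 < q by lra.
have r1 : 1 < r by lra.
have q0 : 0 < q by lra.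
have [cS cn] := (good_cont gS, good_cont gn).
have split_e p : exists2 b, 0 < b & (2 : R) `^ p * (b + b) <= e.
  have t0 : 0 < (2 : R) `^ p by rewrite powR_gt0.
  exists (e / (2 * 2 `^ p)); first by rewrite divr_gt0// mulr_gt0.
  by rewrite le_eqVlt; apply/orP; left; apply/eqP; field; rewrite gt_eqF.
have [bq bq0 hbq] := split_e q; have [br br0 hbr] := split_e r.
have [d1 d10 hd1] := multiplier_small q1 gS bq0.
have [d2 d20 hd2] := multiplier_small r1 gn br0.
have mn (a b : R) : 0 < a -> 0 < b -> 0 < Num.min a b by move=> *; rewrite lt_min; apply/andP.
have [G [Q [c [m [[gG gQ Q0] lG lQ [c0 cm] suppA]]]]] :=
  riesz_layer q2 qr (mn _ _ e0 (mn _ _ d10 d20)).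
have [cG cQ] := (good_cont gG, good_cont gQ).
have gSG : good (fun t => S t * G t) by exact: goodM.
have gnQ : good (fun t => nu t * Q t) by exact: goodM.
have [cSG cnQ] := (good_cont gSG, good_cont gnQ).
have [d3 d30 hd3] := multiplier_small q1 gSG bq0.
have [d4 d40 hd4] := multiplier_small r1 gnQ br0.
have [P [xs [d [gP P0 lP [d0 de size_e] suppB]]]] :=
  arc_layer q2 qs (mn _ _ (mn _ _ e0 ltr01) (mn _ _ d30 d40)).
have cP := good_cont gP.
have [min_e min_l min_r] : [/\ forall a b, Num.min a b <= a :> R, forall a b, Num.min a b <= a :> R
   & forall a b, Num.min a b <= b :> R].
  by split=> a b; rewrite ge_min lexx ?orbT.
have lPr : lq r (fun t => P t - 1) (Num.min (Num.min e 1) (Num.min d3 d4)).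
  apply: lq_exponent lP => //; first exact: ltW.
  exact: le_trans (min_l _ _) (min_r _ _).
exists (fun t => S t * G t * P t), (fun t => nu t * Q t * P t), c, m, xs, d; split.
- split; [exact: goodM|exact: goodM|by move=> t; rewrite !mulr_ge0].
- have -> : (fun t => S t * G t * P t - S t) =
    (fun t => S t * (G t - 1) + (S t * G t) * (P t - 1)) by apply/funext => t; ring.
  apply: lq_le hbq _; apply: lqD => //; [by cts|by cts| |].
    apply: hd1; first by cts.
    by apply: lq_le lG; exact: le_trans (min_r _ _) (min_l _ _).
  apply: hd3; first by cts.
  by apply: lq_le lP; exact: le_trans (min_r _ _) (min_l _ _).
- have -> : (fun t => nu t * Q t * P t - nu t) =
    (fun t => nu t * (Q t - 1) + (nu t * Q t) * (P t - 1)) by apply/funext => t; ring.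
  apply: lq_le hbr _; apply: lqD => //; [by cts|by cts| |].
    apply: hd2; first by cts.
    by apply: lq_le lQ; exact: le_trans (min_r _ _) (min_r _ _).
  apply: hd4; first by cts.
  by apply: lq_le lPr; exact: le_trans (min_r _ _) (min_r _ _).
- split=> //.
  + exact: le_trans cm (min_l _ _).
  + exact: le_trans de (le_trans (min_l _ _) (min_l _ _)).
  + exact: le_trans size_e (le_trans (min_l _ _) (min_l _ _)).
- move=> t; rewrite !mulf_eq0 !negb_or => h; split.
    by case/orP: h => /andP[/andP[h _] _]; rewrite h ?orbT.
  split.
    by apply: suppA; case/orP: h => /andP[/andP[_ h] _]; rewrite h ?orbT.
  have : P t != 0 by case/orP: h => /andP[].
  by move=> /suppB[x xx hx]; exists x => //; exact: ltW.
Qed.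

(** The exponent [q + 1] makes [tol q j] at most the [r]-th power of [2^-(j+2)] for every
    [r <= q + 1] at once. *)
Definition tol q j : R := (2^-1 ^+ (j + 2)) `^ (q + 1).

Lemma half_itv k : 0 < (2^-1 ^+ k : R) <= 1.
Proof. by apply/andP; split; [rewrite exprn_gt0// invr_gt0|apply: exprn_ile1; lra]. Qed.

Lemma tol_gt0 q j : 0 < tol q j.
Proof. by rewrite powR_gt0//; case/andP: (half_itv (j + 2)). Qed.

Lemma tol_le q r j : r <= q + 1 -> tol q j <= (2^-1 ^+ (j + 2)) `^ r.
Proof. by move=> rq; apply: ger_powR => //; exact: half_itv. Qed.

(* [ch_S] and [ch_nu] are the densities [S_j] and [nu_j]; [ch_c] and [ch_m] describe
   the lacunary sum of stage [j], and [ch_xs] and [ch_d] its arcs. *)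
Record chain q := Chain {
  ch_S : nat -> R -> R; ch_nu : nat -> R -> R; ch_c : nat -> R; ch_m : nat -> nat;
  ch_xs : nat -> seq R; ch_d : nat -> R;
  ch_S0 : ch_S 0 = (fun=> 1); ch_nu0 : ch_nu 0 = (fun=> 1);
  ch_goodS : forall j, good (ch_S j); ch_goodnu : forall j, good (ch_nu j);
  ch_nu_ge0 : forall j t, 0 <= ch_nu j t;
  ch_lqS : forall j, lq q (fun t => ch_S j.+1 t - ch_S j t) (tol q j);
  ch_lqnu : forall j, lq (q + j.+1%:R^-1) (fun t => ch_nu j.+1 t - ch_nu j t) (tol q j);
  ch_c_gt0 : forall j, 0 < ch_c j;
  ch_cm : forall j, ch_c j `^ q * (ch_m j)%:R `^ (q - 1) <= tol q j;
  ch_d_gt0 : forall j, 0 < ch_d j; ch_d_le : forall j, ch_d j <= tol q j;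
  ch_size : forall j, (size (ch_xs j))%:R * (2 * ch_d j) `^ (2 / q + j.+1%:R^-1) <= tol q j;
  ch_supp : forall j t, (ch_S j.+1 t != 0) || (ch_nu j.+1 t != 0) ->
    ((ch_S j t != 0) || (ch_nu j t != 0)) /\
    layer (ch_c j) (ch_m j) (ch_xs j) (ch_d j) t }.

Lemma chain_exists q : 2 < q -> inhabited (chain q).
Proof.
move=> q2.
pose St := ((R -> R) * (R -> R))%type.
pose ok (st : St) := [/\ good st.1, good st.2 & forall t, 0 <= st.2 t].
pose Dt := (St * (R * nat * (seq R * R)))%type.
pose spec j (st : St) (o : Dt) :=
  [/\ ok o.1, lq q (fun t => o.1.1 t - st.1 t) (tol q j),
      lq (q + j.+1%:R^-1) (fun t => o.1.2 t - st.2 t) (tol q j),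
      [/\ 0 < o.2.1.1, o.2.1.1 `^ q * o.2.1.2%:R `^ (q - 1) <= tol q j, 0 < o.2.2.2,
        o.2.2.2 <= tol q j & (size o.2.2.1)%:R * (2 * o.2.2.2) `^ (2 / q + j.+1%:R^-1) <= tol q j] &
      forall t, (o.1.1 t != 0) || (o.1.2 t != 0) ->
        ((st.1 t != 0) || (st.2 t != 0)) /\ layer o.2.1.1 o.2.1.2 o.2.2.1 o.2.2.2 t].
have [F hF] : {F : nat * St -> Dt & forall p, ok p.2 -> spec p.1 p.2 (F p)}.
  apply: (@boolp.choice _ _ (fun p o => ok p.2 -> spec p.1 p.2 o)) => -[j [S nu]]; have [[gS gn n0]|nok] := pselect (ok (S, nu)).
    have qr : q < q + j.+1%:R^-1 by rewrite ltrDl invr_gt0.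
    have qs : 2 / q < 2 / q + j.+1%:R^-1 by rewrite ltrDl invr_gt0.
    have [S' [nu' [c [m [xs [d [h1 h2 h3 h4 h5]]]]]]] := refine q2 qr qs (tol_gt0 q j) gS gn n0.
    exists ((S', nu'), ((c, m), (xs, d))) => _.
    by split; [exact: h1|exact: h2|exact: h3|exact: h4|exact: h5].
  (* An arbitrary value for inadmissible states, which are never reached. *)
  by exists ((S, nu), ((0, 0%N), ([::], 0))).
pose st := fix st j : St := if j is j'.+1 then (F (j', st j')).1 else ((fun=> 1), (fun=> 1)).
have stok j : ok (st j).
  elim: j => [|j IH] /=; first by split=> //; exact: good_cst.
  by have [] := hF (j, st j) IH.
have H j := hF (j, st j) (stok j).
constructor; apply: (@Chain q (fun j => (st j).1) (fun j => (st j).2)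
  (fun j => (F (j, st j)).2.1.1) (fun j => (F (j, st j)).2.1.2)
  (fun j => (F (j, st j)).2.2.1) (fun j => (F (j, st j)).2.2.2)).
- exact: erefl.
- exact: erefl.
- by move=> j; have [g1 g2 g3] := stok j; exact: g1.
- by move=> j; have [g1 g2 g3] := stok j; exact: g2.
- by move=> j; have [g1 g2 g3] := stok j; exact: g3.
- by move=> j; have [h1 h2 h3 h4 h5] := H j; exact: h2.
- by move=> j; have [h1 h2 h3 h4 h5] := H j; exact: h3.
- by move=> j; have [h1 h2 h3 [e1 e2 e3 e4 e5] h5] := H j; exact: e1.
- by move=> j; have [h1 h2 h3 [e1 e2 e3 e4 e5] h5] := H j; exact: e2.
- by move=> j; have [h1 h2 h3 [e1 e2 e3 e4 e5] h5] := H j; exact: e3.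
- by move=> j; have [h1 h2 h3 [e1 e2 e3 e4 e5] h5] := H j; exact: e4.
- by move=> j; have [h1 h2 h3 [e1 e2 e3 e4 e5] h5] := H j; exact: e5.
- by move=> j; have [h1 h2 h3 h4 h5] := H j; exact: h5.
Qed.

(** Each increment is [2^-(i+2)] times a function whose [l_r] norm is at most 1, so the telescoping
    sum is a combination with total weight at most 1, whatever [k]. *)
Lemma lq_telescope r (f : nat -> R -> R) D j0 : 1 < r -> (forall j, cont (f j)) ->
  lq r (f j0) D ->
  (forall j, (j0 <= j)%N -> lq r (fun t => f j.+1 t - f j t) ((2^-1 ^+ (j + 2)) `^ r)) ->
  forall k, (j0 <= k)%N -> lq r (f k) (2 `^ r * (D + 1)).
Proof.
move=> r1 cf f0 fj k jk.
have r0 : 0 < r by lra.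
have -> : f k = (fun t => f j0 t + 1 * (\sum_(i <- index_iota j0 k) 2^-1 ^+ (i + 2) *
    ((2 ^+ (i + 2)) * (f i.+1 t - f i t)))).
  apply/funext => t; rewrite mul1r.
  rewrite (eq_bigr (fun i => f i.+1 t - f i t)); last first.
    by move=> i _; rewrite mulrA -exprMn mulVf ?expr1n ?mul1r// pnatr_eq0.
  by rewrite telescope_sumr// addrC subrK.
have cF i : cont (fun t => 2 ^+ (i + 2) * (f i.+1 t - f i t)) by cts.
apply: lqD => //; first by cts.
under eq_fun do rewrite mul1r.
(* [lq_comb] wants a bound for every index, while the increments are controlled from [j0] on
   only. *)
have -> : (fun t => \sum_(i <- index_iota j0 k) 2^-1 ^+ (i + 2) * (2 ^+ (i + 2) * (f i.+1 t - f i t)))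
  = (fun t => \sum_(i <- index_iota j0 k) 2^-1 ^+ (i + 2) * (if (j0 <= i)%N then 2 ^+ (i + 2) * (f i.+1 t - f i t) else 0)).
  apply/funext => t; rewrite [LHS]big_seq [RHS]big_seq; apply: eq_bigr => i.
  by rewrite mem_index_iota => /andP[-> _].
have h := @lq_comb R r _ (index_iota j0 k) (fun i => 2^-1 ^+ (i + 2))
  (fun i t => if (j0 <= i)%N then 2 ^+ (i + 2) * (f i.+1 t - f i t) else 0) 1 1 r1 ltr01 ler01.
rewrite powR1 mul1r in h; apply: h => [i|i|].
- by case: (j0 <= i)%N; [exact: cF|exact: ctsC].
- case: (boolP (j0 <= i)%N) => [ji|_]; last first.
    move=> s us; rewrite big1 ?ler01// => n _.
    by rewrite hat_cst mul0r normr0 powR0// gt_eqF.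
  have e1 : (2 ^+ (i + 2)) `^ r * (2^-1 ^+ (i + 2)) `^ r = 1 :> R.
    by rewrite -powRM ?exprn_ge0// -exprMn mulfV ?pnatr_eq0// expr1n powR1.
  have c0 : 0 <= (2 : R) ^+ (i + 2) by rewrite exprn_ge0.
  have ci : cont (fun t => f i.+1 t - f i t) by cts.
  by have := lqZ c0 ci (fj i ji); rewrite e1.
- have geo l : \sum_(i < l) `|2^-1 ^+ (i + 2)| <= 2^-1 - 2^-1 ^+ (l + 1) :> R.
    elim: l => [|l IH]; first by rewrite big_ord0 add0n expr1 subrr.
    rewrite big_ord_recr /= ger0_norm ?exprn_ge0//; move: IH; rewrite !addn1 addn2 !exprS.
    by move: (2^-1 ^+ l) (\sum_(i < l) _) => v w; lra.
  apply: (@le_trans _ _ (\sum_(i < k) `|2^-1 ^+ (i + 2)|)).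
    rewrite -(big_mkord predT (fun i => `|2^-1 ^+ (i + 2) : R|)) (@big_cat_nat _ _ _ j0 0 k)//=.
    by rewrite lerDr sumr_ge0.
  apply: le_trans (geo k) _; rewrite lerBlDr; apply: ler_wpDr; last by lra.
  by rewrite exprn_ge0.
Qed.

Section Chain.
Variables (q : R) (q2 : 2 < q) (ch : chain q).
Let q0 : 0 < q. Proof. exact: lt_trans q2. Qed.
Let q1 : 1 < q. Proof. by apply: lt_trans q2; rewrite ltr1n. Qed.

Lemma chain_contS j : cont (ch_S ch j). Proof. exact: good_cont (ch_goodS ch j). Qed.
Lemma chain_contnu j : cont (ch_nu ch j). Proof. exact: good_cont (ch_goodnu ch j). Qed.

Lemma chain_lqS j : lq q (ch_S ch j) (2 `^ q * (1 + 1)).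
Proof.
apply: (@lq_telescope q (ch_S ch) 1 0) => //.
- exact: chain_contS.
- rewrite ch_S0; exact: lq_const1.
- by move=> i _; apply: lq_le (ch_lqS ch i); apply: tol_le; rewrite lerDl.
Qed.

Lemma chain_hatS j n : `|hat (ch_S ch j.+1) n - hat (ch_S ch j) n| <= 2^-1 ^+ (j + 2).
Proof.
have [cj cj1] := (chain_contS (j := j), chain_contS (j := j.+1)).
rewrite -hatB//; apply: (lq1 n q0); first by rewrite exprn_ge0.
by apply: lq_le (ch_lqS ch j); apply: tol_le; rewrite lerDl.
Qed.

Lemma chain_hatnu j n : `|hat (ch_nu ch j.+1) n - hat (ch_nu ch j) n| <= 2^-1 ^+ (j + 2).
Proof.
have [cj cj1] := (chain_contnu (j := j), chain_contnu (j := j.+1)).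
have q' : 0 < q + j.+1%:R^-1 by rewrite addr_gt0// invr_gt0.
rewrite -hatB//; apply: (lq1 n q'); first by rewrite exprn_ge0.
by apply: lq_le (ch_lqnu ch j); apply: tol_le; rewrite lerD2l invf_le1 ?ler1n.
Qed.

(* The exponents [q + 1 / (j + 1)] decrease to [q], so every [r > q] eventually
   controls the increments. *)
Lemma chain_lqnu r : q < r -> r <= q + 1 ->
  exists D j0, forall j, (j0 <= j)%N -> lq r (ch_nu ch j) D.
Proof.
move=> qr rq1; have r1 : 1 < r := lt_trans q1 qr.
pose j0 := Num.truncn (r - q)^-1.
have hj0 : (r - q)^-1 < j0.+1%:R by exact: truncnS_gt.
have rq0 : 0 < r - q by rewrite subr_gt0.
have [D hD] := lq_good r1 (ch_goodnu ch j0).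
exists (2 `^ r * (D + 1)), j0; apply: lq_telescope => //; first exact: chain_contnu.
move=> j jj; apply: lq_exponent; last first.
- apply: lq_le (ch_lqnu ch j); exact: tol_le rq1.
- apply: (@le_trans _ _ (1 `^ r)); last by rewrite powR1.
  apply: ge0_ler_powR; rewrite ?nnegrE ?exprn_ge0//; first by rewrite (le_trans _ (ltW r1)).
  by case/andP: (half_itv (j + 2)).
- have : (r - q)^-1 <= j.+1%:R by apply: le_trans (ltW hj0) _; rewrite ler_nat ltnS.
  rewrite -[in X in X -> _](invrK j.+1%:R) lef_pV2 ?posrE ?invr_gt0// => h.
  by rewrite -lerBrDl.
- by rewrite addr_gt0// invr_gt0.
Qed.

(** The increments add up to at most 1/2; this is what keeps both limits from vanishing. *)
Lemma half_telescope (a : nat -> R) : a 0%N = 1 ->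
  (forall j, `|a j.+1 - a j| <= 2^-1 ^+ (j + 2)) -> forall j, 2^-1 <= a j.
Proof.
move=> a0 ha j; have h : 2^-1 + 2^-1 ^+ (j + 1) <= a j.
  elim: j => [|j IH]; first by rewrite a0 add0n expr1; lra.
  have := ha j; rewrite ler_norml => /andP[h _].
  move: IH h; rewrite !addn1 addn2 !exprS; move: (2^-1 ^+ j) => v; lra.
by apply: le_trans h; rewrite lerDl exprn_ge0.
Qed.

Lemma chain_avS j : 2^-1 <= hat (ch_S ch j) 0.
Proof.
apply: (@half_telescope (fun j => hat (ch_S ch j) 0)) => [|i]; last exact: chain_hatS.
by rewrite ch_S0 hat1 eqxx.
Qed.

Lemma chain_avnu j : 2^-1 <= hat (ch_nu ch j) 0.
Proof.
apply: (@half_telescope (fun j => hat (ch_nu ch j) 0)) => [|i]; last exact: chain_hatnu.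
by rewrite ch_nu0 hat1 eqxx.
Qed.

Lemma chain_supp j t : (ch_S ch j t != 0) || (ch_nu ch j t != 0) ->
  forall i, (i < j)%N -> layer (ch_c ch i) (ch_m ch i) (ch_xs ch i) (ch_d ch i) t.
Proof.
elim: j => [//|j IH] h i; rewrite ltnS leq_eqVlt; have [h1 h2] := ch_supp h.
by move=> /predU1P[->//|]; exact: IH.
Qed.

End Chain.

End Sequence.
(** * The limit set and its dimension *)

Section Content.
Variable R : realType.
Implicit Types (f g h u : R -> R) (x y t c q r D E s e d : R) (n : int) (m M j k : nat).

Lemma sum_partition (F : nat -> R) m :
  \sum_(i < m) F i * \prod_(k < i) (1 - F k) = 1 - \prod_(k < m) (1 - F k).
Proof.
elim: m => [|m IH]; first by rewrite !big_ord0 subrr.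
by rewrite big_ord_recr [in RHS]big_ord_recr /= IH; ring.
Qed.

Lemma cos_lt_arc x d : 0 <= d -> d <= pi -> cos d <= cos x ->
  exists k : int, `|x - k%:~R * (2 * pi)| <= d.
Proof.
move=> d0 dpi h; have [k kx] := per_reduce x; exists k.
set z := x - _ in kx *.
have zp : `|z| <= pi by rewrite ler_norml.
have cz : cos x = cos `|z|.
  by rewrite cos_norm /z -mulNr -intrN cos_per.
rewrite leNgt; apply/negP => dz; move: h; rewrite cz leNgt ltr_cos ?dz//.
  by rewrite in_itv/= d0.
by rewrite in_itv/= normr_ge0.
Qed.

Lemma fej_near K x t y d : (0 < K)%N -> 0 <= d -> d <= pi -> K%:R * (2 * d) <= 1 ->
  cos d <= cos (t - x) -> cos d <= cos (y - x) -> K%:R / 4 <= fej K (t - y).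
Proof.
move=> K0 d0 dpi Kd ht hy.
have [k1 h1] := cos_lt_arc d0 dpi ht; have [k2 h2] := cos_lt_arc d0 dpi hy.
rewrite -(fej_per K (k2 - k1) (t - y)); apply: fej_lower => //.
have -> : t - y + (k2 - k1)%:~R * (2 * pi) =
  (t - x - k1%:~R * (2 * pi)) - (y - x - k2%:~R * (2 * pi)) by rewrite intrB; ring.
apply: le_trans (ler_normB _ _) _; apply: le_trans (lerD h1 h2) _.
have KR : 0 < K%:R :> R by rewrite ltr0n.
rewrite -[leRHS]mul1r ler_pdivlMr//; apply: le_trans Kd.
by rewrite le_eqVlt; apply/orP; left; apply/eqP; ring.
Qed.

Lemma dyadic_scale d : 0 < d -> d <= 4^-1 ->
  exists j, (2 ^ j)%:R * (4 * d) <= 1 /\ 1 <= (2 ^ j)%:R * (8 * d).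
Proof.
move=> d0 d4; pose y := (4 * d)^-1.
have y0 : 0 < 4 * d by rewrite mulr_gt0.
have y1 : 1 <= y by rewrite -[leLHS]invr1 lef_pV2 ?posrE//; lra.
pose N := Num.truncn y.
have N1 : (0 < N)%N by rewrite truncn_gt0.
have Ny : N%:R <= y by rewrite truncn_le// (le_trans ler01).
have yN : y < N.+1%:R by exact: truncnS_gt.
exists (trunc_log 2 N).
have /andP[a b] := trunc_log_bounds (isT : (1 < 2)%N) N1.
split.
  rewrite -ler_pdivlMr// div1r; apply: le_trans Ny; rewrite ler_nat; exact: a.
have -> : (2 ^ trunc_log 2 N)%:R * (8 * d) = (2 ^ (trunc_log 2 N).+1)%:R * (4 * d) :> R.
  by rewrite expnS natrM; ring.
rewrite -ler_pdivrMr// div1r; apply: le_trans (ltW yN) _; rewrite ler_nat; exact: b.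
Qed.

(** The left side is [K^-1] times the sum of [hat g (j - k) ^+ 2] over [j, k < K]. For each [j],
    Hoelder with exponent [r / 2] bounds the sum over the [K] values of [k]. *)
Lemma energy_le K g r D : (0 < K)%N -> 2 < r -> good g -> lq r g D ->
  av (fun t => g t * sig K g t) <= K%:R `^ (1 - 2 / r) * D `^ (2 / r).
Proof.
move=> K0 r2 gg gD; have cg := good_cont gg; have [_ _ eg] := gg.
have r0 : 0 < r by lra.
have D0 := lq_ge0 gD.
have hs0 n : hats g n = 0 by apply: av_odd => t; rewrite eg mulrN sinN mulrN.
have KR : 0 < K%:R :> R by rewrite ltr0n.
have -> : (fun t => g t * sig K g t) = (fun t => K%:R^-1 * \sum_(j < K) \sum_(k < K)
   hat g (j%:Z - k%:Z) * (g t * cos ((j%:Z - k%:Z)%:~R * t))).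
  apply/funext => t; rewrite sigE// mulrCA; congr (_ * _); rewrite mulr_sumr.
  apply: eq_bigr => j _; rewrite mulr_sumr; apply: eq_bigr => k _.
  by rewrite hs0 mul0r addr0 mulrCA.
rewrite avZ; last by cts.
rewrite av_sum; last by move=> j; cts.
rewrite ler_pdivrMl//.
apply: (@le_trans _ _ (\sum_(j < K) K%:R `^ (1 - 2 / r) * D `^ (2 / r))); last first.
  by rewrite sumr_const card_ord -[leLHS]mulr_natl.
apply: ler_sum => j _; rewrite av_sum; last by move=> k; cts.
rewrite (eq_bigr (fun k : 'I_K => 1 * hat g (j%:Z - k%:Z) ^+ 2)); last first.
  by move=> k _; rewrite avZ ?mul1r//; cts.
have r21 : 1 < r / 2 by rewrite ltr_pdivlMr// mul1r.
have := @powR_jensen R (r / 2) K%:R 'I_K (index_enum _) predT (fun=> 1)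
  (fun k : 'I_K => hat g (j%:Z - k%:Z) ^+ 2) r21 KR (fun=> ler01).
rewrite sumr_const card_ord => /(_ (lexx _)) h.
have {}h : `|\sum_(k < K) 1 * hat g (j%:Z - k%:Z) ^+ 2| `^ (r / 2) <= K%:R `^ (r / 2 - 1) * D.
  apply: le_trans h _; rewrite ler_wpM2l ?powR_ge0//.
  rewrite (eq_bigr (fun k : 'I_K => `|hat g (j%:Z - k%:Z)| `^ r)); last first.
    move=> k _; rewrite mul1r -sqr_abs -powR_mulrn// ger0_norm ?powR_ge0// -powRrM.
    by congr (_ `^ _); field.
  have := gD [seq j%:Z - (nat_of_ord m)%:Z | m : 'I_K <- index_enum 'I_K].
  rewrite big_map; apply.
  rewrite map_inj_uniq ?index_enum_uniq// => a b /addrI /oppr_inj [] ab.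
  exact: val_inj.
set Y := \sum_(k < K) _ in h *.
have Y0 : 0 <= Y by apply: sumr_ge0 => k _; rewrite mul1r sqr_ge0.
rewrite ger0_norm// in h.
have -> : Y = (Y `^ (r / 2)) `^ (2 / r).
  by rewrite -powRrM (_ : r / 2 * (2 / r) = 1) ?powRr1//; field; rewrite gt_eqF.
have -> : K%:R `^ (1 - 2 / r) * D `^ (2 / r) = (K%:R `^ (r / 2 - 1) * D) `^ (2 / r).
  rewrite powRM ?powR_ge0// -powRrM; congr (_ `^ _ * _); field; by rewrite gt_eqF.
apply: ge0_ler_powR => //.
- by rewrite divr_ge0// ltW.
- by rewrite nnegrE powR_ge0.
- by rewrite nnegrE mulr_ge0// powR_ge0.
Qed.

Lemma powR_expn_nat (a : nat) j e : ((a ^ j)%:R : R) `^ e = (a%:R `^ e) ^+ j.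
Proof. by rewrite natrX powR_expn. Qed.

(* Splitting the mass [av g] along a partition of unity subordinate to the arcs and
   applying Cauchy-Schwarz bounds it by an energy of [g], which is controlled
   scale by scale by [lq r g D]. *)
Lemma content_lower r s D : 2 < r -> 0 <= s -> s < 2 / r -> exists2 e0 : R, 0 < e0 &
  forall g, good g -> (forall t, 0 <= g t) -> lq r g D -> 2^-1 <= av g ->
  forall l : seq (R * R), (forall p, p \in l -> 0 < p.2 /\ p.2 <= 8^-1) ->
  (forall t, g t != 0 -> exists2 p, p \in l & cos p.2 <= cos (t - p.1)) ->
  e0 <= \sum_(p <- l) (16 * p.2) `^ s.
Proof.
move=> r2 s0 sr.
have r0 : 0 < r by lra.
pose b : R := 2 `^ (s - 2 / r).
have b0 : 0 < b by rewrite powR_gt0.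
have b1 : b < 1.
  have a0 : 0 < 2 / r - s by rewrite subr_gt0.
  have : (1 : R) `^ (2 / r - s) < 2 `^ (2 / r - s).
    by apply: gt0_ltr_powR; rewrite ?nnegrE ?ltr1n.
  by rewrite powR1 => h; rewrite /b -opprB powRN invf_lt1// (lt_trans ltr01).
pose E := 4 * (D `^ (2 / r) / (1 - b)) + 1.
have b1' : 0 < 1 - b by rewrite subr_gt0.
have E0 : 0 < E by rewrite ltr_wpDl// mulr_ge0// divr_ge0 ?powR_ge0// ltW.
exists (4 * E)^-1; first by rewrite invr_gt0 mulr_gt0.
move=> g gg g0 gD gav l hl cov.
have cg := good_cont gg.
pose p0 : R * R := (0, 8^-1).
pose N := size l.
pose P i := nth p0 l i.
have hP i : 0 < (P i).2 /\ (P i).2 <= 8^-1.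
  have [il|il] := ltnP i N; first by apply: hl; exact: mem_nth.
  by rewrite /P nth_default//; split => /=; lra.
have hP2 i : 2 * (P i).2 <= pi.
  by have [_ h] := hP i; have := @pi_ge2 R; lra.
have cosP i : cos (2 * (P i).2) < cos (P i).2.
  have [h1 h2] := hP i; have h3 := hP2 i.
  have -> : (cos (2 * (P i).2) < cos (P i).2) = ((P i).2 < 2 * (P i).2).
    by apply: ltr_cos; rewrite in_itv/=; apply/andP; split; lra.
  by lra.
pose phi i t := step ((cos (t - (P i).1) - cos (2 * (P i).2)) / (cos (P i).2 - cos (2 * (P i).2))).
have cphi i : cont (phi i).
  have cst := D2_cont (@D2_step R).
  by apply: (@cts_comp _ (fun t => (cos (t - (P i).1) - cos (2 * (P i).2)) / _) (@step R)) => //; cts.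
have phi01 i t : 0 <= phi i t <= 1 by exact: step_itv.
have phi1 i t : cos (P i).2 <= cos (t - (P i).1) -> phi i t = 1.
  move=> h; apply: step1; rewrite ler_pdivlMr ?subr_gt0// mul1r.
  by rewrite lerD2r.
have phi0 i t : phi i t != 0 -> cos (2 * (P i).2) <= cos (t - (P i).1).
  apply: contraR; rewrite -ltNge => h; apply/eqP; apply: step0.
  by rewrite pmulr_lle0 ?invr_gt0 ?subr_gt0// subr_le0 ltW.
(* The arcs may overlap in any way: the factor [1 - phi k] removes what earlier arcs have taken, so
   the [a i] add up to at most 1, and to 1 where [g] lives. *)
pose a i t := phi i t * \prod_(k < i) (1 - phi k t).
have ca i : cont (a i) by rewrite /a; cts.
have pr01 i t : 0 <= \prod_(k < i) (1 - phi k t) <= 1.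
  apply/andP; split.
    by apply: prodr_ge0 => k _; rewrite subr_ge0; case/andP: (phi01 k t).
  apply: prodr_ile1 => k _; have /andP[h1 h2] := phi01 k t.
  by rewrite subr_ge0 h2 gerBl.
have a0 i t : 0 <= a i t.
  by rewrite mulr_ge0//; [case/andP: (phi01 i t)|case/andP: (pr01 i t)].
have a1 i t : a i t <= 1.
  by rewrite mulr_ile1//; [case/andP: (phi01 i t)|case/andP: (pr01 i t)|case/andP: (phi01 i t)|case/andP: (pr01 i t)].
have asum t : \sum_(i < N) a i t <= 1.
  by rewrite /a (sum_partition (phi ^~ t) N) gerBl; case/andP: (pr01 N t).
have gsum t : g t = \sum_(i < N) g t * a i t.
  rewrite -mulr_sumr /a (sum_partition (phi ^~ t) N).
  have [->|gt0] := eqVneq (g t) 0; first by rewrite mul0r.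
  have [p pl hp] := cov t gt0.
  have il : (index p l < N)%N by rewrite index_mem.
  have Pp : P (index p l) = p by rewrite /P nth_index.
  rewrite (bigD1 (Ordinal il)) //= phi1 ?Pp// subrr mul0r subr0 mulr1.
  by [].
pose m i := av (fun t => g t * a i t).
have m0 i : 0 <= m i by apply: av_ge0 => [|t]; [cts|rewrite mulr_ge0].
have avg : av g = \sum_(i < N) m i.
  rewrite /m -av_sum; last by move=> i; cts.
  by congr av; apply/funext => t; exact: gsum.
have [J hJ] : {J : nat -> nat & forall i, (2 ^ J i)%:R * (4 * (2 * (P i).2)) <= 1 /\
     1 <= (2 ^ J i)%:R * (8 * (2 * (P i).2)) :> R}.
  apply: (@boolp.choice _ _ (fun i j => (2 ^ j)%:R * (4 * (2 * (P i).2)) <= 1 /\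
     1 <= (2 ^ j)%:R * (8 * (2 * (P i).2)) :> R)) => i.
  by have [h1 h2] := hP i; apply: dyadic_scale; lra.
pose K i := (2 ^ J i)%N.
have K0 i : (0 < K i)%N by rewrite expn_gt0.
have KR i : 0 < (K i)%:R :> R by rewrite ltr0n.
have csg i : cont (sig (K i) g) := @cont_sig _ _ _ cg.
have sg0 k t : 0 <= sig k g t.
  apply: av_ge0 => [|y]; last by rewrite mulr_ge0// fej_ge0.
  have := @cont_fej R k => cf.
  have : cont (fun y => fej k (t - y)) by apply: (@cts_comp _ (fun y => t - y) (fej k)) => //; cts.
  by move=> ?; cts.
(* [K i] is so adapted to the arc that the Fejer kernel is at least [K i / 4] between any two of its
   points; integrating this against [g] bounds the mass [m i]. *)
have mT i t : a i t != 0 -> m i <= 4 / (K i)%:R * sig (K i) g t.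
  move=> ait.
  have cf : cont (fun y => fej (K i) (t - y)).
    by apply: (@cts_comp _ (fun y => t - y) (fej (K i))); [exact: cont_fej|cts].
  rewrite /sig -avZ; last by cts.
  apply: av_le => [||y]; [by cts|by cts|].
  rewrite [leRHS]mulrCA ler_wpM2l//.
  have [->|aiy] := eqVneq (a i y) 0.
    by rewrite mulr_ge0 ?fej_ge0// divr_ge0.
  apply: le_trans (a1 i y) _.
  have pt : phi i t != 0 by apply: contraNneq ait => e; rewrite /a e mul0r.
  have py : phi i y != 0 by apply: contraNneq aiy => e; rewrite /a e mul0r.
  have [h1 _] := hJ i; have [p1 p2] := hP i.
  have := @fej_near (K i) (P i).1 t y (2 * (P i).2) (K0 i).
  have -> : 0 <= 2 * (P i).2 by rewrite mulr_ge0// ltW.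
  move=> /(_ isT (hP2 i)); have -> : (K i)%:R * (2 * (2 * (P i).2)) <= 1.
    by apply: le_trans h1; rewrite ler_wpM2l//; lra.
  move=> /(_ isT (phi0 _ _ pt) (phi0 _ _ py)) h.
  by rewrite mulrAC ler_pdivlMr// mul1r mulrC -ler_pdivrMr.
have m2 i : m i ^+ 2 <= 4 / (K i)%:R * av (fun t => g t * (a i t * sig (K i) g t)).
  rewrite expr2 {1}/m mulrC -avZ; last by cts.
  rewrite -avZ; last by cts.
  apply: av_le => [||t]; [by cts|by cts|].
  have [->|ait] := eqVneq (a i t) 0; first by rewrite mulr0 mulr0 mul0r !mulr0.
  rewrite mulrCA [X in _ <= X](_ : _ = g t * (a i t * (4 / (K i)%:R * sig (K i) g t))); last by ring.
  by rewrite ler_wpM2l// mulrC ler_wpM2l// mT.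
pose JJ := (\max_(i < N) J i).+1.
have JJi (i : 'I_N) : (J i < JJ)%N by rewrite ltnS; apply: (leq_bigmax i).
pose z := (2 : R) `^ (s - 1).
pose w j t := z ^+ j * sig (2 ^ j) g t.
have cw j : cont (w j) by have := @cont_sig _ (2 ^ j)%N _ cg => ?; rewrite /w; cts.
have w0 j t : 0 <= w j t by rewrite mulr_ge0// exprn_ge0// powR_ge0.
(* The sum over arcs is replaced by a sum over dyadic scales: as the [a i] add up to at most 1, each
   scale counts once however many arcs it has. At scale [2 ^ j] the energy contributes [b ^ j], and
   [b < 1] because [s < 2 / r]. *)
have energy : \sum_(i < N) (K i)%:R `^ s * m i ^+ 2 <= E.
  apply: (@le_trans _ _ (\sum_(i < N) 4 * av (fun t => g t * (a i t * w (J i) t)))).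
    apply: ler_sum => i _; apply: le_trans (ler_wpM2l (powR_ge0 _ _) (m2 i)) _.
    rewrite le_eqVlt; apply/orP; left; apply/eqP.
    have -> : (fun t => g t * (a i t * w (J i) t)) =
       (fun t => z ^+ J i * (g t * (a i t * sig (K i) g t))).
      by apply/funext => t; rewrite /w; ring.
    rewrite avZ; last by cts.
    have -> : z ^+ J i = (K i)%:R `^ s / (K i)%:R.
      rewrite -powR_expn_nat powRB; last by rewrite (gt_eqF (KR i)) implybT.
      by rewrite powRr1.
    by ring.
  rewrite -mulr_sumr -av_sum; last by move=> i; have := cw (J i) => ?; cts.
  apply: (@le_trans _ _ (4 * av (fun t => \sum_(j < JJ) z ^+ j * (g t * sig (2 ^ j) g t)))).
    rewrite ler_wpM2l//; apply: av_le => [||t].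
    - by apply: cts_sum => i; have := cw (J i) => ?; cts.
    - by apply: cts_sum => j; have := @cont_sig _ (2 ^ j)%N _ cg => ?; cts.
    rewrite -mulr_sumr; apply: (@le_trans _ _ (g t * \sum_(j < JJ) w j t)); last first.
      by rewrite mulr_sumr ler_sum// => j _; rewrite /w mulrCA.
    rewrite ler_wpM2l//; apply: (@le_trans _ _ (\sum_(i < N) a i t * \sum_(j < JJ) w j t)).
      apply: ler_sum => i _; rewrite ler_wpM2l// (bigD1 (Ordinal (JJi i)))//= lerDl.
      by rewrite sumr_ge0.
    rewrite -mulr_suml ler_piMl//; by rewrite sumr_ge0.
  rewrite av_sum; last by move=> j; have := @cont_sig _ (2 ^ j)%N _ cg => ?; cts.
  have geo k : \sum_(j < k) b ^+ j <= (1 - b)^-1.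
    have : (1 - b) * \sum_(j < k) b ^+ j <= 1.
      by rewrite -opprB mulNr -subrX1 opprB gerBl exprn_ge0// ltW.
    by rewrite mulrC -ler_pdivlMr// div1r.
  apply: (@le_trans _ _ (4 * \sum_(j < JJ) b ^+ j * D `^ (2 / r))).
    rewrite ler_wpM2l//; apply: ler_sum => j _.
    have csj := @cont_sig _ (2 ^ j)%N _ cg.
    rewrite avZ; last by cts.
    have j0 : (0 < 2 ^ j)%N by rewrite expn_gt0.
    have zj : 0 <= z ^+ j by rewrite exprn_ge0// powR_ge0.
    apply: le_trans (ler_wpM2l zj (energy_le j0 r2 gg gD)) _.
    rewrite mulrA ler_wpM2r ?powR_ge0// powR_expn_nat -exprMn /z -powRD; last by rewrite pnatr_eq0 implybT.
    by rewrite (_ : s - 1 + (1 - 2 / r) = s - 2 / r)//; ring.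
  rewrite -mulr_suml mulrC; apply: (@le_trans _ _ (4 * (D `^ (2 / r) / (1 - b)))); last by rewrite /E lerDl.
  by rewrite mulrC ler_wpM2l// mulrC ler_wpM2l ?powR_ge0.
(* With this weighting the energy term uses up at most 1/4 of the mass 1/2. *)
have amgm i : m i <= (4 * E)^-1 * ((K i)%:R `^ s * m i ^+ 2) + E * (K i)%:R `^ (- s).
  have A0 : 0 < (K i)%:R `^ s by rewrite powR_gt0.
  rewrite powRN -subr_ge0; move: ((K i)%:R `^ s) A0 (m i) => A A0 v.
  rewrite (_ : _ - _ = (4 * E * A)^-1 * (A * v - 2 * E) ^+ 2).
    by rewrite mulr_ge0 ?sqr_ge0// invr_ge0 mulr_ge0 ?(ltW A0)// mulr_ge0// ltW.
  have En : E != 0 by rewrite gt_eqF.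
  have An : A != 0 by rewrite gt_eqF.
  by move: E En {E0 energy} => E' En; field; rewrite En An.
have : 2^-1 <= (4 * E)^-1 * E + E * \sum_(i < N) (K i)%:R `^ (- s).
  apply: le_trans gav _; rewrite avg; apply: le_trans (ler_sum _ (fun (i : 'I_N) _ => amgm i)) _.
  have E40 : 0 <= (4 * E)^-1 by rewrite invr_ge0 mulr_ge0// ltW.
  by rewrite big_split -!mulr_sumr lerD2r; apply: ler_wpM2l E40 _ _ energy.
have -> : (4 * E)^-1 * E = 4^-1 by field; rewrite gt_eqF.
move=> h; have {}h : (4 * E)^-1 <= \sum_(i < N) (K i)%:R `^ (- s).
  have h4 : 4^-1 <= E * \sum_(i < N) (K i)%:R `^ (- s).
    by move: (E * _) h => v; clear; lra.
  by rewrite invfM ler_pdivrMr// mulrC.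
apply: le_trans h _; rewrite (big_nth p0) big_mkord; apply: ler_sum => i _.
have [p1 p2] := hP i; have [_ h8] := hJ i.
have A0 : 0 < (K i)%:R `^ s by rewrite powR_gt0.
have p16 : 0 <= 16 * (P i).2 by rewrite mulr_ge0// ltW.
rewrite powRN -[leLHS]mulr1 ler_pdivrMl// -powRM//.
have -> : 1 <= ((K i)%:R * (16 * (P i).2)) `^ s = (1 `^ s <= ((K i)%:R * (16 * (P i).2)) `^ s) by rewrite powR1.
apply: ge0_ler_powR => //; rewrite ?nnegrE//; first by rewrite mulr_ge0// ltW.
by rewrite (_ : 16 * (P i).2 = 8 * (2 * (P i).2)) //; ring.
Qed.

End Content.

(** * The circle and limit sets of closed stages *)

Section Circle.
Variable R : realType.
Implicit Types (x y t : R) (u v : circle R) (U V : set (circle R)) (k : int).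

Definition circ x : circle R := (\pi_(circle R) x)%qT.

Lemma circ_repr u : circ (repr u) = u.
Proof. exact: reprK. Qed.

Lemma circ_per k x : circ (x + k%:~R * (2 * pi)) = circ x.
Proof. by apply/eq_circleP; exists k; rewrite addrAC subrr add0r. Qed.

Lemma mdist_circ x y : mdist (circ x) (circ y) =
  inf [set `|x - y + k%:~R * (2 * pi)| | k in [set: int]].
Proof. exact: circle_distE. Qed.

Lemma mdist_circ_le k x y : mdist (circ x) (circ y) <= `|x - y + k%:~R * (2 * pi)|.
Proof.
rewrite mdist_circ; apply: ge_inf; last by exists k.
by exists 0 => _ [j _ <-].
Qed.

Lemma mdist_circ_lt x y e : mdist (circ x) (circ y) < e ->
  exists k, `|x - y + k%:~R * (2 * pi)| < e.
Proof.
rewrite mdist_circ => h; have e0 : 0 < e - inf [set `|x - y + k%:~R * (2 * pi)| | k in [set: int]].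
  by rewrite subr_gt0.
have hi : has_inf [set `|x - y + k%:~R * (2 * pi)| | k in [set: int]].
  by split; [exists `|x - y + 0%:~R * (2 * pi)|, 0|exists 0 => _ [j _ <-]].
have [_ [k _ <-] hk] := inf_adherent e0 hi; exists k; by rewrite subrKC in hk.
Qed.

Lemma circ_continuous : continuous circ.
Proof.
move=> x; apply/cvg_ballP => e e0.
apply/nbhs_ballP; exists e => //= y.
rewrite ballEmdist/= => h; apply: le_lt_trans h.
by have := mdist_circ_le 0 x y; rewrite mul0r addr0.
Qed.

Lemma mdist_circ_cos x y d : 0 < d -> d <= pi -> mdist (circ x) (circ y) < d ->
  cos d <= cos (x - y).
Proof.
move=> d0 dpi /mdist_circ_lt[k hk].
have [<- _] := cos_sin_period k (x - y).
have -> : cos (x - y + k%:~R * (2 * pi)) = cos `|x - y + k%:~R * (2 * pi)|.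
  by case: ger0P => _; rewrite ?cosN.
by rewrite leNgt ltr_cos -?leNgt ?in_itv/= ?normr_ge0 ?(ltW d0) ?(le_trans (ltW hk))//; exact: ltW.
Qed.

Lemma cos_mdist_circ x y d : 0 <= d -> d <= pi -> cos d <= cos (x - y) ->
  mdist (circ x) (circ y) <= d.
Proof.
move=> d0 dpi /(cos_lt_arc d0 dpi)[k hk].
by apply: le_trans hk; rewrite -mulNr -intrN; exact: mdist_circ_le.
Qed.

Section Stages.
Variable L : nat -> set R.
Hypothesis closedL : forall j, closed (L j).
Hypothesis perL : forall j k x, L j x -> L j (x + k%:~R * (2 * pi)).

Definition limit_set : set (circle R) := circ @` [set t | forall j, L j t].

Lemma limit_set_pi : limit_set = circ @` ([set t | forall j, L j t] `&` `[- pi, pi]).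
Proof.
apply/seteqP; split=> [_ [t ht <-]|_ [t [ht _] <-]]; last by exists t.
have [k hk] := per_reduce t; exists (t - k%:~R * (2 * pi)).
  split; last by rewrite /= in_itv.
  by move=> j; rewrite -mulNr -intrN; exact: perL.
by rewrite -mulNr -intrN circ_per.
Qed.

Lemma limit_set_compact : compact limit_set.
Proof.
rewrite limit_set_pi; apply: continuous_compact.
  by apply: continuous_subspaceT; exact: circ_continuous.
rewrite setIC; apply: compact_closedI; first exact: segment_compact.
rewrite (_ : [set _ | _] = \bigcap_j L j); last first.
  by apply/seteqP; split=> [t ht j _|t ht j]; exact: ht.
by apply: closed_bigI => j _.
Qed.

(** Compactness of [[- pi, pi]], covered by the preimages of the [V j] and the complements of the
    stages. It reduces both the dimension and the support to finite stages, where the densities are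
    functions. *)
Lemma limit_set_stage (V : nat -> set (circle R)) : (forall j, open (V j)) ->
  limit_set `<=` \bigcup_j V j ->
  exists N, forall t, (forall j, (j < N)%N -> L j t) -> exists2 j, (j < N)%N & V j (circ t).
Proof.
move=> oV KV; have := @segment_compact R (- pi) pi; rewrite compact_cover.
move=> /(_ nat setT (fun j => circ @^-1` V j `|` ~` L j)) []; first 2 last.
- move=> D _ hD.
  have [N hN] : exists N, forall j, j \in D -> (j < N)%N.
    exists (\max_(j <- enum_fset D) j).+1 => j jD; rewrite ltnS.
    exact: (@leq_bigmax_seq _ _ xpredT id).
  exists N => t ht; have [k hk] := per_reduce t.
  have [|j /= jD] := hD (t - k%:~R * (2 * pi)); first by rewrite /= in_itv.
  rewrite -mulNr -intrN /= circ_per => -[h|[]]; first by exists j => //; exact: hN.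
  by apply: perL; apply: ht; exact: hN.
- move=> j _; apply: openU; last by apply: closed_openC.
  by apply: open_comp => // x _; exact: circ_continuous.
- move=> t _; have [ht|] := pselect (forall j, L j t).
    by have [|j _ hj] := KV (circ t); [exists t|exists j => //; left].
  by move=> /existsNP[j hj]; exists j => //; right.
Qed.

End Stages.
End Circle.

(** * Hausdorff measures by finite covers and by balls *)

Section Hausdorff.
Context (R : realType) (T : metricType R).
Implicit Types (E U : set T) (s d e : R).

Lemma metric_ball_open (x : T) r : open (ball x r).
Proof.
rewrite openE => y; rewrite ballEmdist /= => yr.
apply/nbhs_ballP; exists (r - mdist x y) => [|z]; first by rewrite /= subr_gt0.
rewrite !ballEmdist /= => zr; apply: le_lt_trans (metric_triangle x y z) _; lra.
Qed.

Lemma diameter_ge0 U : (0 <= diameter U)%E.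
Proof. by apply: ereal_sup_ubound; left. Qed.

Lemma diameter_le U d : 0 <= d -> (forall x y, U x -> U y -> mdist x y <= d) ->
  (diameter U <= d%:E)%E.
Proof.
move=> d0 h; apply: ge_ereal_sup => _ [->|[[x y] [Ux Uy] <-]]; rewrite lee_fin//.
exact: h.
Qed.

Lemma mdist_le_diameter U x y : U x -> U y -> ((mdist x y)%:E <= diameter U)%E.
Proof. by move=> Ux Uy; apply: ereal_sup_ubound; right; exists (x, y). Qed.

Lemma diameter_pow_ge0 s U : (0 <= diameter_pow s U)%E.
Proof. by rewrite /diameter_pow; case: ifP => // _; exact: poweR_ge0. Qed.

Lemma diameter_pow_le s U d : 0 <= s -> 0 <= d -> (diameter U <= d%:E)%E ->
  (diameter_pow s U <= (d `^ s)%:E)%E.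
Proof.
move=> s0 d0 Ud; rewrite /diameter_pow; case: ifP => _.
  by rewrite lee_fin powR_ge0.
rewrite -poweR_EFin; apply: gt0_ler_poweR => //; rewrite in_itv/= ?diameter_ge0 ?leey//.
by rewrite lee_fin d0.
Qed.

Lemma hausdorff_content_ge0 s d E : (0 <= hausdorff_content s d E)%E.
Proof.
apply: le_ereal_inf_tmp => _ [U _ <-]; apply: nneseries_ge0 => i _ _.
exact: diameter_pow_ge0.
Qed.

Lemma hausdorff_measure_eq0 s E : 0 <= s ->
  (forall e, 0 < e -> exists n (F : nat -> set T) d,
    [/\ 0 <= d <= e, E `<=` \bigcup_(i in `I_n) F i,
        forall i x y, F i x -> F i y -> mdist x y <= d & n%:R * d `^ s <= e]) ->
  hausdorff_measure s E = 0%E.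
Proof.
move=> s0 h; apply/eqP; rewrite eq_le; apply/andP; split; last first.
  apply: (@le_trans _ _ (hausdorff_content s 1 E)); first exact: hausdorff_content_ge0.
  by apply: ereal_sup_ubound; exists 1 => /=.
apply: ge_ereal_sup => _ [d /= d0 <-]; apply/lee_addgt0Pr => e e0.
have m0 : 0 < Num.min d e by rewrite lt_min d0 e0.
have [n [F [r [/andP[r0 rd] EF dF nr]]]] := h _ m0.
move: rd nr; rewrite !le_min => /andP[rd _] /andP[_ nr].
rewrite add0e; pose U i := if (i < n)%N then F i else set0.
apply: (@le_trans _ _ (\sum_(0 <= i <oo) diameter_pow s (U i))%E).
  apply: ereal_inf_lbound; exists U => //; split.
    by move=> t /EF[i /= ni Fit]; exists i => //; rewrite /U ni.
  move=> i; apply: (@le_trans _ _ r%:E); last by rewrite lee_fin.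
  by apply: diameter_le => // x y; rewrite /U; case: ifP => // _; exact: dF.
rewrite (nneseries_split 0 n); last by move=> i _; exact: diameter_pow_ge0.
rewrite add0n eseries0 ?adde0; last first.
  by move=> i ni _; rewrite /U ltnNge ni /= /diameter_pow eqxx.
apply: (@le_trans _ _ (\sum_(0 <= i < n) (r `^ s)%:E)%E).
  apply: lee_sum => i _; apply: diameter_pow_le => //; apply: diameter_le => // x y.
  by rewrite /U; case: ifP => // _; exact: dF.
by rewrite sumEFin lee_fin sumr_const_nat subn0 -[leLHS]mulr_natl.
Qed.

(** Covering sets become open balls about one of their points, as compactness needs open sets. [b]
    discards the empty sets, which carry no weight even for [s = 0]. *)
Lemma hausdorff_measure0_cover (t0 : T) s E e : 0 <= s -> hausdorff_measure s E = 0%E -> 0 < e ->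
  exists (b : nat -> bool) (p : nat -> T) (r : nat -> R),
    [/\ E `<=` \bigcup_i (if b i then ball (p i) (r i) else set0),
        forall i, 0 < r i <= 8^-1 &
        forall n, \sum_(i < n | b i) r i `^ s <= e].
Proof.
move=> s0 H0 e0.
have c0 : (hausdorff_content s 32^-1 E <= 0)%E.
  by rewrite -H0; apply: ereal_sup_ubound; exists 32^-1 => //=; rewrite invr_gt0.
pose eta := e / 2 / 2 `^ s.
have eta0 : 0 < eta by rewrite !divr_gt0 ?powR_gt0.
have /ereal_inf_lt[_ [U [EU dU] <-] Ueta] : (hausdorff_content s 32^-1 E < eta%:E)%E.
  by apply: le_lt_trans c0 _; rewrite lte_fin.
pose D i := fine (diameter (U i)).
have DE i : diameter (U i) = (D i)%:E.
  rewrite /D fineK// fin_real//; apply/andP; split.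
    by apply: lt_le_trans (diameter_ge0 _); exact: ltNy0.
  by apply: le_lt_trans (dU i) _; exact: ltry.
have D0 i : 0 <= D i by rewrite -lee_fin -DE diameter_ge0.
have D32 i : D i <= 32^-1 by rewrite -lee_fin -DE.
have [r hr] : {r : nat -> R & forall i, [/\ 0 < r i <= 8^-1, D i < r i &
    r i `^ s <= 2 `^ s * D i `^ s + e / 2 * 2^-1 ^+ i.+1]}.
  apply: (@boolp.choice _ _ (fun i r => [/\ 0 < r <= 8^-1, D i < r &
    r `^ s <= 2 `^ s * D i `^ s + e / 2 * 2^-1 ^+ i.+1])) => i.
  have ei : 0 < e / 2 * 2^-1 ^+ i.+1 by rewrite mulr_gt0 ?exprn_gt0 ?invr_gt0// divr_gt0.
  (* The radius must exceed the diameter [v] strictly: [2 * v] does if [v > 0]; if [v = 0] the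
     summable budget [a] pays for a radius, and for [s = 0] any radius will do. *)
  move: (e / 2 * _) ei (D i) (D0 i) (D32 i) => a a0 v v0 v32.
  have [->|sn] := eqVneq s 0.
    exists 8^-1; rewrite !powRr0 mul1r lerDl (ltW a0); split=> //; last by lra.
    by apply/andP; split; lra.
  have sp : 0 < s by rewrite lt_def sn.
  have [->|vn] := eqVneq v 0.
    exists (Num.min 8^-1 (a `^ s^-1)).
    have m0 : 0 < Num.min 8^-1 (a `^ s^-1) by rewrite lt_min powR_gt0// invr_gt0 andbT.
    split => //; first by rewrite m0 ge_min lexx.
    rewrite powR0// mulr0 add0r.
    rewrite [leRHS](_ : a = (a `^ s^-1) `^ s); last by rewrite -powRrM mulVf// powRr1// ltW.
    by apply: ge0_ler_powR => //; rewrite ?nnegrE ?(ltW m0) ?powR_ge0// ge_min lexx orbT.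
  have vp : 0 < v by rewrite lt_def vn.
  exists (2 * v); split; [apply/andP; split; lra|lra|].
  by rewrite powRM// lerDl ltW.
have [p hp] : {p : nat -> T & forall i, U i !=set0 -> U i (p i)}.
  apply: (@boolp.choice _ _ (fun i p => U i !=set0 -> U i p)) => i.
  by have [[t Ut]|n0] := pselect (U i !=set0); [exists t|exists t0].
pose b i := U i != set0.
exists b, p, r; split.
- move=> t /EU[i _ Uit]; exists i => //.
  have ne : U i !=set0 by exists t.
  have -> : b i by apply/set0P.
  rewrite ballEmdist /=; apply: le_lt_trans (_ : D i < r i); last by have [] := hr i.
  by rewrite -lee_fin -DE; apply: mdist_le_diameter => //; exact: hp.
- by move=> i; have [] := hr i.
move=> n; have sumD : \sum_(i < n | b i) D i `^ s <= eta.
  rewrite -lee_fin; apply: le_trans (ltW Ueta).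
  apply: le_trans (nneseries_lim_ge n (fun i _ _ => diameter_pow_ge0 s (U i))).
  rewrite -sumEFin big_mkcond big_mkord; apply: lee_sum => i _.
  rewrite /b /diameter_pow; case: (U i == set0) => //=.
  by rewrite DE poweR_EFin.
have geo : \sum_(i < n) 2^-1 ^+ i.+1 <= 1 :> R.
  have -> : \sum_(i < n) 2^-1 ^+ i.+1 = 1 - 2^-1 ^+ n :> R.
    elim: n {sumD} => [|n IH]; first by rewrite big_ord0 subrr.
    by rewrite big_ord_recr /= IH exprS; field.
  by rewrite gerBl exprn_ge0.
apply: (@le_trans _ _ (\sum_(i < n | b i) (2 `^ s * D i `^ s + e / 2 * 2^-1 ^+ i.+1))).
  by apply: ler_sum => i _; have [] := hr i.
rewrite big_split -!mulr_sumr [leRHS](splitr e); apply: lerD.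
  apply: le_trans (ler_wpM2l (powR_ge0 _ _) sumD) _.
  by rewrite /eta mulrC divfK// gt_eqF// powR_gt0.
rewrite -[leRHS]mulr1 ler_wpM2l//; first by rewrite ltW// divr_gt0.
apply: le_trans geo; rewrite big_mkcond; apply: ler_sum => i _.
by case: ifP => // _; rewrite exprn_ge0.
Qed.

End Hausdorff.

(** * The dimension of the limit set *)

Section ChainSet.
Variables (R : realType) (q : R) (ch : chain q).
Hypothesis q2 : 2 < q.
Implicit Types (t x : R) (j : nat) (k : int).

Definition stage j : set R :=
  [set t | layer (ch_c ch j) (ch_m ch j) (ch_xs ch j) (ch_d ch j) t].

Definition chain_set : set (circle R) := limit_set stage.

Lemma stage_closed j : closed (stage j).
Proof.
have cm := @cont_cs R (ch_m ch j).
have -> : stage j = [set t | 1 <= ch_c ch j * cs (ch_m ch j) t] `&`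
   [set t | ch_c ch j * cs (ch_m ch j) t <= 512] `&`
   \big[setU/set0]_(x <- ch_xs ch j) [set t | cos (ch_d ch j) <= cos (t - x)].
  rewrite -bigcup_seq; apply/seteqP; split=> [t [/andP[h1 h2] [x xs hx]]|t [[h1 h2] [x xs hx]]].
    by split; [split|exists x].
  by split; [apply/andP|exists x].
have cl (f : R -> R) : cont f -> closed [set t | 0 <= f t].
  by move=> cf; apply: (@closed_comp _ _ f [set x | 0 <= x]) => [x _|]; [exact: cf|exact: closed_ge].
apply: closedI; first apply: closedI.
- rewrite (_ : [set _ | _] = [set t | 0 <= ch_c ch j * cs (ch_m ch j) t - 1]).
    by apply: cl; cts.
  by apply/funext => t /=; rewrite subr_ge0.
- rewrite (_ : [set _ | _] = [set t | 0 <= 512 - ch_c ch j * cs (ch_m ch j) t]).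
    by apply: cl; cts.
  by apply/funext => t /=; rewrite subr_ge0.
apply: closed_bigsetU => x _.
rewrite (_ : [set _ | _] = [set t | 0 <= cos (t - x) - cos (ch_d ch j)]).
  by apply: cl; cts.
by apply/funext => t /=; rewrite subr_ge0.
Qed.

Lemma stage_per j k t : stage j t -> stage j (t + k%:~R * (2 * pi)).
Proof.
have [_ pc _] := @good_cs R (ch_m ch j).
move=> [h1 [x xs hx]]; split; first by rewrite pc.
by exists x => //; rewrite addrAC cos_per.
Qed.

Lemma chain_set_compact : compact chain_set.
Proof. by apply: limit_set_compact => [j|j k x]; [exact: stage_closed|exact: stage_per]. Qed.

Lemma tol_small (e : R) : 0 < e -> exists j0, forall j, (j0 <= j)%N -> tol q j <= e.
Proof.
move=> e0; exists (Num.truncn e^-1) => j jj.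
apply: (@le_trans _ _ (2^-1 ^+ (j + 2))).
  have /andP[h0 h1] := @half_itv R (j + 2).
  have q1 : 1 <= q + 1 by rewrite lerDr ltW// (lt_trans _ q2).
  have := tol_le j q1.
  by rewrite powRr1// ltW.
rewrite exprVn -[leRHS]invrK lef_pV2 ?posrE ?invr_gt0 ?exprn_gt0//.
have h : e^-1 < (Num.truncn e^-1).+1%:R by exact: truncnS_gt.
apply: le_trans (ltW h) _; rewrite -natrX ler_nat.
apply: leq_trans (ltn_expl (j + 2) (isT : 1 < 2)%N).
by rewrite ltnS (leq_trans jj)// leq_addr.
Qed.

(** The arcs of one late stage form the cover: its exponent [2 / q + 1 / (j + 1)] is below [s], and
    [2 * d <= 1] permits raising the exponent. *)
Lemma chain_set_upper (s : R) : 2 / q < s -> hausdorff_measure s chain_set = 0%E.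
Proof.
move=> qs; have q2' := q2; have q0 : 0 < q by lra.
have s0 : 0 <= s by apply: ltW; apply: le_lt_trans qs; apply: ltW; rewrite divr_gt0.
apply: hausdorff_measure_eq0 => // e e0.
have m0 : 0 < Num.min (e / 2) 8^-1 by rewrite lt_min; apply/andP; split; lra.
have [j0 hj0] := tol_small m0.
have sq : 0 < s - 2 / q by rewrite subr_gt0.
pose j := maxn j0 (Num.truncn (s - 2 / q)^-1).
have := hj0 j (leq_maxl _ _); rewrite le_min => /andP[je j8].
have [dp dl] := (ch_d_gt0 ch j, ch_d_le ch j); have size_le := ch_size ch j.
have js : j.+1%:R^-1 <= s - 2 / q.
  rewrite -[leRHS]invrK lef_pV2 ?posrE ?invr_gt0//.
  have h : (s - 2 / q)^-1 < (Num.truncn (s - 2 / q)^-1).+1%:R by exact: truncnS_gt.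
  by apply: le_trans (ltW h) _; rewrite ler_nat ltnS leq_maxr.
set d := ch_d ch j in dp dl size_le.
have pi2 := @pi_ge2 R.
exists (size (ch_xs ch j)), (fun i => @circ R @` [set t | cos d <= cos (t - nth 0 (ch_xs ch j) i)]), (2 * d).
split.
- by apply/andP; split; lra.
- move=> _ [t ht <-]; have [_ [x xs hx]] := ht j.
  by exists (index x (ch_xs ch j)); rewrite /= ?index_mem//; exists t => //=; rewrite nth_index.
- move=> i _ _ [x hx <-] [y hy <-]; set c := nth 0 _ i in hx hy.
  have dc z : cos d <= cos (z - c) -> mdist (circ z) (circ c) <= d.
    by move=> hz; apply: cos_mdist_circ => //; lra.
  have h1 := dc _ hx; have h2 := dc _ hy.
  apply: le_trans (metric_triangle _ (circ c) _) _.
  by rewrite (metric_sym (circ c)); lra.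
apply: le_trans (_ : tol q j <= e); last by lra.
apply: le_trans size_le; rewrite ler_wpM2l//.
have d1 : 0 < 2 * d <= 1 by apply/andP; split; lra.
by apply: (ger_powR d1); rewrite addrC -lerBrDr.
Qed.

(** A cheap cover by balls would already cover a finite stage, hence the points where a late [nu_j]
    is nonzero. [content_lower] forbids this with a bound independent of [j], for an [r > q] with
    [s < 2 / r]. *)
Lemma chain_set_lower (s : R) : 0 <= s -> s < 2 / q -> hausdorff_measure s chain_set != 0%E.
Proof.
move=> s0 sq; apply/eqP => H0.
have q2' := q2; have q0 : 0 < q by lra.
have [r [qr rq1 sr]] : exists r, [/\ q < r, r <= q + 1 & s < 2 / r].
  have [sz|sn] := eqVneq s 0.
    by exists (q + 1); split; [lra|lra|rewrite sz divr_gt0//; lra].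
  have sp : 0 < s by rewrite lt_def sn.
  have qs : q < 2 / s by rewrite ltr_pdivlMr// mulrC -ltr_pdivlMr.
  exists (Num.min (q + 1) ((q + 2 / s) / 2)).
  rewrite lt_min ge_min lexx; split => //; first by apply/andP; split; lra.
  have m0 : 0 < Num.min (q + 1) ((q + 2 / s) / 2) by rewrite lt_min; apply/andP; split; lra.
  rewrite ltr_pdivlMr// mulrC -ltr_pdivlMr// gt_min; apply/orP; right; lra.
have [D [j0 hD]] := chain_lqnu q2 ch qr rq1.
have r2 : 2 < r by lra.
have [e0 e00 he0] := content_lower D r2 s0 sr.
have p16 : 0 < 2 * 16 `^ s :> R by rewrite mulr_gt0// powR_gt0.
have [b [p [rho [cov rho0 sum_rho]]]] :=
  hausdorff_measure0_cover (circ 0) s0 H0 (divr_gt0 e00 p16).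
have [|N hN] := limit_set_stage stage_closed stage_per _ cov.
  by move=> j; case: ifP => _; [exact: metric_ball_open|exact: open0].
pose j := maxn N j0.
pose l := [seq (repr (p i), rho i) | i <- iota 0 N & b i].
have le0 : e0 <= \sum_(p <- l) (16 * p.2) `^ s.
  apply: (he0 (ch_nu ch j) (ch_goodnu ch j) (ch_nu_ge0 ch j) (hD j (leq_maxr _ _))).
  - by rewrite -hat0; exact: chain_avnu.
  - by move=> _ /mapP[i _ ->] /=; apply/andP; exact: rho0.
  move=> t nt; have [|i iN] := hN t.
    move=> k kN; apply: (@chain_supp _ _ ch j t); first by rewrite nt orbT.
    exact: leq_trans kN (leq_maxl _ _).
  case: ifP => // bi; have /andP[r0 r8] := rho0 i.
  rewrite ballEmdist /= metric_sym -{1}(circ_repr (p i)) => h.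
  exists (repr (p i), rho i); last first.
    by apply: mdist_circ_cos h => //=; have := @pi_ge2 R; lra.
  by rewrite /l map_f// mem_filter bi mem_iota add0n.
move: le0; rewrite /l big_map big_filter -{1}(subn0 N) big_mkord.
rewrite (eq_bigr (fun i : 'I_N => 16 `^ s * rho i `^ s)); last first.
  by move=> i _; have /andP[/ltW r0 _] := rho0 i; rewrite powRM.
rewrite -mulr_sumr => h.
have := le_trans h (ler_wpM2l (powR_ge0 _ _) (sum_rho N)).
have p0 : 0 < 16 `^ s :> R by rewrite powR_gt0.
rewrite (_ : 16 `^ s * _ = e0 / 2); last by field; rewrite gt_eqF.
lra.
Qed.

Lemma chain_set_dim : hausdorff_dim chain_set = (2 / q)%:E.
Proof.
have q2' := q2; have q0 : 0 < 2 / q by rewrite divr_gt0//; lra.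
apply/eqP; rewrite eq_le; apply/andP; split.
  apply/lee_addgt0Pr => e e0; apply: ereal_inf_lbound; exists (2 / q + e) => //=.
  by split; [lra|apply: chain_set_upper; lra].
apply: le_ereal_inf_tmp => _ [s [s0 hs] <-]; rewrite lee_fin leNgt.
by apply/negP => sq; have /eqP := chain_set_lower s0 sq.
Qed.

End ChainSet.

(** * The distribution *)

Section Distribution.
Variable R : realType.
Implicit Types (u w : R -> R) (C e : R) (j k : nat) (n : int) (phi psi : circle R -> R[i]).
Local Open Scope complex_scope.

(** Duality between summable and bounded coefficients, shown on the Fejer means of [u]. The sine
    part drops out because [w] is even, and 5 is the bound of [sum_wt]. *)
Lemma av_mul_wiener w u C L e : good w -> cont u -> lipc L u -> 0 <= L ->
  (forall n, `|hat u n| <= C * wt R n) -> (forall n, `|hat w n| <= e) ->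
  `|av (fun t => w t * u t)| <= 5 * C * e.
Proof.
move=> gw cu lu L0 hu hw; have cw := good_cont gw; have [_ pw ew] := gw.
have C0 : 0 <= C.
  by have := le_trans (normr_ge0 _) (hu 0); rewrite /wt eqxx mulr1.
have e0 : 0 <= e := le_trans (normr_ge0 _) (hw 0).
have [M M0 hM] := per_bounded cw pw.
apply/ler_addgt0Pr => d d0.
have M1 : 0 < M + 1 by rewrite ltr_wpDl.
have [K K0 hK] := sig_unif cu lu L0 (divr_gt0 d0 M1).
have cs : cont (sig K u) := @cont_sig _ _ _ cu.
have -> : (fun t => w t * u t) = (fun t => w t * sig K u t - w t * (sig K u t - u t)).
  by apply/funext => t; ring.
rewrite avB; [|by cts|by cts].
apply: le_trans (ler_normB _ _) _; apply: lerD; last first.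
  apply: av_abs_cst => [|t]; first by cts.
  rewrite normrM; apply: le_trans (ler_pM _ _ (hM t) (hK t)) _ => //.
  by rewrite mulrA ler_pdivrMr// mulrDr mulr1 mulrC lerDl ltW.
have hs0 n : av (fun t => w t * sin (n%:~R * t)) = 0.
  by apply: av_odd => t; rewrite ew mulrN sinN mulrN.
have KR : 0 < K%:R :> R by rewrite ltr0n.
have -> : (fun t => w t * sig K u t) = (fun t => K%:R^-1 * \sum_(j < K) \sum_(k < K)
   (hat u (j%:Z - k%:Z) * (w t * cos ((j%:Z - k%:Z)%:~R * t)) +
    hats u (j%:Z - k%:Z) * (w t * sin ((j%:Z - k%:Z)%:~R * t)))).
  apply/funext => t; rewrite sigE// mulrCA; congr (_ * _); rewrite mulr_sumr.
  apply: eq_bigr => j _; rewrite mulr_sumr; apply: eq_bigr => k _.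
  by rewrite mulrDr !(mulrCA (w t)).
rewrite avZ; last by cts.
rewrite normrM (gtr0_norm (_ : 0 < K%:R^-1)) ?invr_gt0// ler_pdivrMl//.
rewrite av_sum; last by move=> j; cts.
apply: le_trans (ler_norm_sum _ _ _) _.
apply: (@le_trans _ _ (\sum_(j < K) 5 * C * e)); last by rewrite sumr_const card_ord -[leLHS]mulr_natl.
apply: ler_sum => j _; rewrite av_sum; last by move=> k; cts.
apply: le_trans (ler_norm_sum _ _ _) _.
apply: (@le_trans _ _ (\sum_(k < K) C * e * wt R (j%:Z - (k : nat)%:Z))).
  apply: ler_sum => k _; rewrite avD; [|by cts|by cts].
  rewrite avZ; last by cts.
  rewrite avZ; last by cts.
  rewrite hs0 mulr0 addr0 normrM mulrAC.
  by apply: ler_pM; [exact: normr_ge0|exact: normr_ge0|exact: hu|exact: hw].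
rewrite -mulr_sumr -[leRHS]mulrA mulrC; apply: ler_wpM2r; first exact: mulr_ge0.
have := @sum_wt R [seq j%:Z - (nat_of_ord m)%:Z | m : 'I_K <- index_enum 'I_K].
rewrite big_map; apply.
rewrite map_inj_uniq ?index_enum_uniq// => a b /addrI /oppr_inj [] ab.
exact: val_inj.
Qed.

(** With [g j] the tail of the geometric majorant, [a j - g j] increases and [a j + g j] decreases,
    which gives both the limit and the rate. *)
Lemma half_cvg (a : nat -> R) (B : R) : 0 <= B ->
  (forall j, `|a j.+1 - a j| <= B * 2^-1 ^+ (j + 2)) ->
  cvgn a /\ forall j, `|limn a - a j| <= B * 2^-1 ^+ (j + 1).
Proof.
move=> B0 ha.
pose g j := B * 2^-1 ^+ (j + 1).
have gS j : g j = g j.+1 + B * 2^-1 ^+ (j + 2).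
  by rewrite /g !addn1 addn2 !exprS; field.
have g0 j : 0 <= g j by rewrite mulr_ge0// exprn_ge0.
have lo : nondecreasing_seq (fun j => a j - g j).
  apply/nondecreasing_seqP => j; have := ha j; rewrite ler_norml => /andP[h _].
  by rewrite [g j]gS; lra.
have hi : nonincreasing_seq (fun j => a j + g j).
  apply/nonincreasing_seqP => j; have := ha j; rewrite ler_norml => /andP[_ h].
  by rewrite [g j]gS; lra.
have lohi i j : a i - g i <= a j + g j.
  apply: le_trans (lo _ _ (leq_maxl i j)) _; apply: le_trans (hi _ _ (leq_maxr i j)).
  by have := g0 (maxn i j); lra.
have cl : cvgn (fun j => a j - g j).
  apply: nondecreasing_is_cvgn => //; exists (a 0 + g 0) => _ [j _ <-]; exact: lohi.
have cg : g @ \oo --> (0 : R).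
  have -> : g = (fun j => B * 2^-1 * 2^-1 ^+ j).
    by apply/funext => j; rewrite /g addn1 exprS mulrA.
  rewrite -(mulr0 (B * 2^-1)); apply: cvgMl_tmp; apply: cvg_expr.
  by rewrite ger0_norm//; lra.
pose l : R := limn (fun j => a j - g j).
have ca : a @ \oo --> l.
  rewrite (_ : a = (fun j => (a j - g j) + g j)); last by apply/funext => j; rewrite subrK.
  rewrite -[l]addr0; apply: cvgD; last exact: cg.
  exact: cl.
split; first by apply/cvg_ex; eexists; exact: ca.
move=> j; rewrite (cvg_lim _ ca)//.
have h1 : a j - g j <= l.
  exact: (nondecreasing_cvgn_le lo cl j).
have h2 : l <= a j + g j.
  apply: limr_le => //; near=> i; exact: lohi.
rewrite ler_norml -/(g j); apply/andP; split; lra.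
Unshelve. all: by end_near. Qed.

Lemma cont_derivable u : (forall x, derivable u x 1) -> cont u.
Proof. by move=> du x; apply/differentiable_continuous/derivable1_diffP. Qed.

Lemma derivable_dv u : (forall x, derivable u x 1) -> dv u (derive1 u).
Proof. by move=> du x; rewrite derive1E; apply: DeriveDef. Qed.

Definition smooth_per u := [/\ dv u (derive1n 1 u), dv (derive1n 1 u) (derive1n 2 u),
  cont (derive1n 2 u) & periodic2pi u].

Lemma smooth_perP u : (forall k x, derivable (derive1n k u) x 1) -> periodic2pi u ->
  smooth_per u.
Proof.
move=> du pu; split; last exact: pu.
- exact: (derivable_dv (du 0)).
- exact: (derivable_dv (du 1)).
exact: cont_derivable (du 2).
Qed.

Lemma test_Re phi : test_function phi -> smooth_per (lift_Re phi).
Proof.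
move=> tp; apply: smooth_perP => [k x|k x]; first by have [] := tp k x.
by congr (complex.Re (phi _)); exact: circ_per.
Qed.

Lemma test_Im phi : test_function phi -> smooth_per (lift_Im phi).
Proof.
move=> tp; apply: smooth_perP => [k x|k x]; first by have [] := tp k x.
by congr (complex.Im (phi _)); exact: circ_per.
Qed.

Lemma normc_le (z : R[i]) : Normc.normc z <= `|complex.Re z| + `|complex.Im z|.
Proof.
case: z => a b /=; rewrite -[leRHS]ger0_norm ?addr_ge0// -sqrtr_sqr ler_wsqrtr//.
rewrite sqrrD !real_normK ?num_real// lerD2r lerDl mulrn_wge0// mulr_ge0//.
Qed.

Lemma norm_le_normc (a b : R) : `|a| <= Normc.normc (a +i* b) /\ `|b| <= Normc.normc (a +i* b).
Proof.
by rewrite /= -!sqrtr_sqr; split; apply: ler_wsqrtr; rewrite ?lerDl ?lerDr sqr_ge0.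
Qed.

Lemma le_seminorm phi k x : (k <= 2)%N -> test_function phi ->
  `|derive1n k (lift_Re phi) x| <= seminorm k phi /\
  `|derive1n k (lift_Im phi) x| <= seminorm k phi.
Proof.
move=> k2 tp; set a := derive1n k (lift_Re phi); set b := derive1n k (lift_Im phi).
have bnd u : smooth_per u -> exists2 B : R, 0 <= B & forall x, `|derive1n k u x| <= B.
  move=> [d1 d2 c2 pu]; have p1 := dv_per d1 pu; have p2 := dv_per d2 p1.
  case: k k2 {a b} => [|[|[|//]]] _; apply: per_bounded => //.
  - exact: dv_cts d1.
  - exact: dv_cts d2.
have [A A0 hA] := bnd _ (test_Re tp); have [B B0 hB] := bnd _ (test_Im tp).
have le : Normc.normc (a x +i* b x) <= seminorm k phi.
  apply: ub_le_sup; last by exists x.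
  exists (A + B) => _ [y _ <-]; apply: le_trans (normc_le _) _.
  by apply: lerD; [exact: hA|exact: hB].
by have [h1 h2] := norm_le_normc (a x) (b x); split; apply: le_trans le.
Qed.

End Distribution.

(** * Convergence of the signed densities to a distribution *)

Section ChainDistribution.
Variables (R : realType) (q : R) (ch : chain q).
Hypothesis q2 : 2 < q.
Implicit Types (u v w : R -> R) (j k : nat) (n : int) (phi psi : circle R -> R[i]).
Local Open Scope complex_scope.

Definition chain_pair u j := av (fun t => ch_S ch j t * u t).

(** Consecutive densities have coefficients within [2^-(j+2)], and those of [u] are summable with
    bounds from [u] and its second derivative only. The limit is therefore a distribution of order
    at most 2. *)
Lemma chain_pair_cvg u (B0 B2 : R) : smooth_per u ->
  (forall x, `|u x| <= B0) -> (forall x, `|derive1n 2 u x| <= B2) ->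
  cvgn (chain_pair u) /\ `|limn (chain_pair u)| <= 4 * (B0 + B2).
Proof.
move=> [d1 d2 c2 pu] h0 h2; have cu := dv_cts d1.
have B00 : 0 <= B0 := le_trans (normr_ge0 _) (h0 0).
have B20 : 0 <= B2 := le_trans (normr_ge0 _) (h2 0).
have [L L0 lu] : exists2 L : R, 0 <= L & lipc L u.
  by apply: D2_lipc => //; exists (derive1n 1 u), (derive1n 2 u).
have step j : `|chain_pair u j.+1 - chain_pair u j| <= 5 * (B0 + B2) * 2^-1 ^+ (j + 2).
  have cj := good_cont (ch_goodS ch j); have cj1 := good_cont (ch_goodS ch j.+1).
  rewrite -avB; [|by cts|by cts].
  have -> : (fun t => ch_S ch j.+1 t * u t - ch_S ch j t * u t) =
            (fun t => (ch_S ch j.+1 t + - 1 * ch_S ch j t) * u t).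
    by apply/funext => t; ring.
  apply: (@av_mul_wiener _ _ _ (B0 + B2) L) => //.
  - apply: goodD; first exact: ch_goodS.
    by apply: goodM; [exact: good_cst|exact: ch_goodS].
  - by move=> n; have [] := D2_coef_le n d1 d2 c2 pu h0 h2.
  move=> n; rewrite (_ : (fun t => _) = (fun t => ch_S ch j.+1 t - ch_S ch j t)).
    by rewrite hatB//; exact: chain_hatS.
  by apply/funext => t; rewrite mulN1r.
have [c h] := half_cvg (mulr_ge0 (ler0n _ 5) (addr_ge0 B00 B20)) step.
split; first exact: c.
have a0 : `|chain_pair u 0| <= B0.
  rewrite /chain_pair ch_S0; under eq_fun do rewrite mul1r.
  exact: av_abs_cst.
have := h 0; rewrite add0n expr1 !ler_norml in a0 *.
move: a0; move: (limn _) (chain_pair u 0) => l v /andP[h3 h4] /andP[h5 h6].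
apply/andP; split; lra.
Qed.

End ChainDistribution.

Section ChainSchwartz.
Variables (R : realType) (q : R) (ch : chain q).
Hypothesis q2 : 2 < q.
Implicit Types (u v w : R -> R) (j k : nat) (n : int) (phi psi : circle R -> R[i]).
Local Open Scope complex_scope.

Definition chain_lim u : R := limn (chain_pair ch u).

Lemma smooth_bounded u : smooth_per u -> exists B0 B2 : R,
  (forall x, `|u x| <= B0) /\ (forall x, `|derive1n 2 u x| <= B2).
Proof.
move=> [d1 d2 c2 pu]; have p2 := dv_per d2 (dv_per d1 pu).
have [A _ hA] := per_bounded (dv_cts d1) pu; have [B _ hB] := per_bounded c2 p2.
by exists A, B.
Qed.

Lemma chain_lim_cvg u : smooth_per u -> chain_pair ch u @ \oo --> chain_lim u.
Proof.
move=> su; have [A [B [hA hB]]] := smooth_bounded su.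
by have [] := chain_pair_cvg ch q2 su hA hB.
Qed.

Lemma chain_lim_eq u (l : R) : chain_pair ch u @ \oo --> l -> chain_lim u = l.
Proof. by move=> h; apply: cvg_lim. Qed.

Lemma chain_lim_linear (a b : R) u v w : smooth_per u -> smooth_per v -> smooth_per w ->
  chain_lim (fun t => a * u t + b * v t + w t) = a * chain_lim u + b * chain_lim v + chain_lim w.
Proof.
move=> su sv sw; apply: chain_lim_eq.
have [[cu _ _ _] [cv _ _ _]] := (su, sv); have [cw _ _ _] := sw.
move: (dv_cts cu) (dv_cts cv) (dv_cts cw) => {}cu {}cv {}cw.
rewrite (_ : chain_pair ch _ = (fun j => a * chain_pair ch u j + b * chain_pair ch v j + chain_pair ch w j)).
  apply: cvgD; last exact: chain_lim_cvg.
  by apply: cvgD; apply: cvgMl_tmp; exact: chain_lim_cvg.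
apply/funext => j; have cj := good_cont (ch_goodS ch j); rewrite /chain_pair.
rewrite -avZ; last by cts.
rewrite -avZ; last by cts.
rewrite -avD; [|by cts|by cts].
rewrite -avD; [|by cts|by cts].
by congr av; apply/funext => t; ring.
Qed.

Definition chain_pairing phi : R[i] :=
  chain_lim (lift_Re phi) +i* chain_lim (lift_Im phi).

Lemma chain_pairing_linear (a : R[i]) phi psi : test_function phi -> test_function psi ->
  chain_pairing (fun z => a * phi z + psi z) = a * chain_pairing phi + chain_pairing psi.
Proof.
move=> tphi tpsi; case: a => a b; rewrite /chain_pairing.
have [sr si sr' si'] := And4 (test_Re tphi) (test_Im tphi) (test_Re tpsi) (test_Im tpsi).
have -> : lift_Re (fun z => (a +i* b) * phi z + psi z) =
    (fun t => a * lift_Re phi t + (- b) * lift_Im phi t + lift_Re psi t).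
  apply/funext => t; rewrite /lift_Re /lift_Im.
  by case: (phi _) => x y; case: (psi _) => z w /=; rewrite mulNr.
have -> : lift_Im (fun z => (a +i* b) * phi z + psi z) =
    (fun t => b * lift_Re phi t + a * lift_Im phi t + lift_Im psi t).
  apply/funext => t; rewrite /lift_Re /lift_Im.
  by case: (phi _) => x y; case: (psi _) => z w /=; rewrite (addrC (a * y)).
rewrite !chain_lim_linear// mulNr; apply/eqP; rewrite eq_complex /=.
by rewrite eqxx (addrC (a * _) (b * _)) eqxx.
Qed.

Lemma chain_pairing_continuous : exists (C : R) (N : nat), forall phi,
  test_function phi -> Normc.normc (chain_pairing phi) <= C * \sum_(k < N.+1) seminorm k phi.
Proof.
exists 8, 2 => phi tp; apply: le_trans (normc_le _) _ => /=.
have h k (x : R) (k2 : (k <= 2)%N) := le_seminorm x k2 tp.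
have [_ hr] := chain_pair_cvg ch q2 (test_Re tp) (fun x => (h 0 x isT).1) (fun x => (h 2 x isT).1).
have [_ hi] := chain_pair_cvg ch q2 (test_Im tp) (fun x => (h 0 x isT).2) (fun x => (h 2 x isT).2).
have h1 : 0 <= seminorm 1 phi := le_trans (normr_ge0 _) (h 1 0 isT).1.
rewrite !big_ord_recl big_ord0 /=; move: hr hi; rewrite -/(chain_lim _) -/(chain_lim _).
move: (seminorm 0 phi) (seminorm 2 phi) (seminorm 1 phi) h1 `|_| `|_| => s0 s2 s1 h1 a b.
lra.
Qed.

Definition chain_schwartz : schwartz R :=
  Schwartz chain_pairing_linear chain_pairing_continuous.

Lemma hat_cvg n : exists2 l : R, (fun j => hat (ch_S ch j) n) @ \oo --> l &
  forall j, `|l - hat (ch_S ch j) n| <= 2^-1 ^+ (j + 1).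
Proof.
have h j : `|hat (ch_S ch j.+1) n - hat (ch_S ch j) n| <= 1 * 2^-1 ^+ (j + 2).
  by rewrite mul1r; exact: chain_hatS.
have [c hc] := half_cvg ler01 h.
by eexists; [exact: c|move=> j; have := hc j; rewrite mul1r].
Qed.

Lemma chain_fourier n : exists2 l : R, schwartz_fourier chain_schwartz n = l%:C &
  (forall j, `|l - hat (ch_S ch j) n| <= 2^-1 ^+ (j + 1)).
Proof.
have [l cl hl] := hat_cvg n; exists l => //.
rewrite /schwartz_fourier /= /chain_pairing.
have -> : lift_Re (circle_exp n) = (fun t : R => cos (n%:~R * t)).
  by apply/funext => t; rewrite /lift_Re circle_expE.
have -> : lift_Im (circle_exp n) = (fun t : R => - sin (n%:~R * t)).
  by apply/funext => t; rewrite /lift_Im circle_expE.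
rewrite (chain_lim_eq cl); congr (_ +i* _); apply: chain_lim_eq.
rewrite (_ : chain_pair ch _ = (fun=> 0)); first exact: cvg_cst.
apply/funext => j; apply: av_odd => t; have [_ _ e] := ch_goodS ch j.
by rewrite e (mulrN n%:~R) sinN !mulrN.
Qed.

Lemma chain_schwartz_nonzero : schwartz_nonzero chain_schwartz.
Proof.
exists (circle_exp 0).
  have cst (c : R) k x : derivable (derive1n k (fun=> c : R)) x 1.
    case: k => [|k]; first exact: derivable_cst.
    suff -> : derive1n k.+1 (fun=> c : R) = fun=> 0 by exact: derivable_cst.
    elim: k => [|k IH]; last rewrite derive1nS IH.
      by apply/funext => y; rewrite derive1n1 derive1_cst.
    by apply/funext => y; rewrite derive1_cst.
  move=> k x; rewrite (_ : lift_Re (circle_exp 0) = (fun _ : R => 1)); last first.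
    by apply/funext => t; rewrite /lift_Re circle_expE /= mul0r cos0.
  rewrite (_ : lift_Im (circle_exp 0) = (fun _ : R => 0)); last first.
    by apply/funext => t; rewrite /lift_Im circle_expE /= mul0r sin0 oppr0.
  by split; exact: cst.
have [l e cl] := chain_fourier 0; rewrite -/(schwartz_fourier chain_schwartz 0) e.
(* At stage 2 the mean is at least 1/2 and lies within 1/8 of the limit. *)
apply/eqP => -[l0]; have := cl 2; have := chain_avS q2 ch 2.
by rewrite l0 sub0r normrN !exprS expr0; move: (hat _ _) => v h; rewrite ger0_norm; lra.
Qed.

Lemma chain_schwartz_lq : in_lq q (schwartz_fourier chain_schwartz).
Proof.
have q2' := q2; have q0 : 0 < q by lra.
have q1 : 1 < q by lra.
apply: (@le_lt_trans _ _ (2 `^ q * (2 `^ q * (1 + 1) + 1))%:E); last exact: ltry.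
apply: ge_ereal_sup => _ [X [fX _] <-].
rewrite fsbig_finite// sumEFin lee_fin; set s := finmap.enum_fset _.
have us : uniq s by exact: finmap.fset_uniq.
(* The stage is chosen after [s], so that the errors [2^-(j+1)], one for each frequency, add up to
   at most 1. *)
pose j := size s.
apply: (@le_trans _ _ (\sum_(n <- s) 2 `^ q * (`|hat (ch_S ch j) n| `^ q + 2^-1 ^+ (j + 1)))).
  apply: ler_sum => n _; have [l -> /(_ j) hl] := chain_fourier n.
  rewrite /= expr0n addr0 sqrtr_sqr.
  have -> : l = hat (ch_S ch j) n + (l - hat (ch_S ch j) n) by rewrite addrC subrK.
  apply: le_trans (powR_normD_le _ _ q1) _; rewrite ler_wpM2l ?powR_ge0// lerD2l.
  have /andP[h0 h1] := @half_itv R (j + 1).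
  apply: (@le_trans _ _ ((2^-1 ^+ (j + 1)) `^ q)); last by rewrite ge1r_powR ?h0 ?(ltW q1).
  by apply: ge0_ler_powR; rewrite ?nnegrE ?(ltW q0) ?(ltW h0).
rewrite -mulr_sumr ler_wpM2l ?powR_ge0// big_split; apply: lerD.
  exact: (chain_lqS q2 ch j us).
rewrite big_const_seq count_predT iter_addr_0 -/j -[leLHS]mulr_natl exprVn ler_pdivrMr ?exprn_gt0// mul1r.
by rewrite -natrX ler_nat addn1 ltnW// (leq_trans (ltn_expl j (isT : 1 < 2)%N))// leq_exp2l.
Qed.

(** If the support of [phi] avoids the limit set, [phi] vanishes on an open neighbourhood of it,
    hence on a whole finite stage. The pairings are then zero from that stage on. *)
Lemma chain_schwartz_support : schwartz_support chain_schwartz `<=` chain_set ch.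
Proof.
have cK : closed (chain_set ch).
  by apply: compact_closed; [exact: metric_hausdorff|exact: chain_set_compact].
move=> z hz; apply: contrapT => Kz; apply: hz; exists (~` chain_set ch) => //.
split; first exact: closed_openC.
move=> phi tphi sphi; set W := ~` closure [set u | phi u != 0].
have oW : open W by apply: closed_openC; exact: closed_closure.
have phiW y : W y -> phi y = 0.
  by move=> Wu; apply/eqP; apply: contrapT => /negP p0; apply: Wu; exact: subset_closure.
have [|N hN] := limit_set_stage (@stage_closed _ _ ch) (@stage_per _ _ ch) (V := fun=> W) (fun=> oW).
  by move=> y Ky; exists 0 => // /sphi.
have zero (v : R -> R) : (forall t, W (circ t) -> v t = 0) -> chain_lim v = 0.
  move=> hv; apply: chain_lim_eq; apply: cvg_near_cst; exists N => // j /= Nj.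
  rewrite /chain_pair (_ : (fun t => _) = fun=> 0) ?av_cst//.
  apply/funext => t; have [->|Sn] := eqVneq (ch_S ch j t) 0; first by rewrite mul0r.
  rewrite hv ?mulr0//; have [|i _ //] := hN t.
  move=> i iN; apply: (@chain_supp _ _ ch j t); first by rewrite Sn.
  exact: leq_trans iN Nj.
have e t : W (circ t) -> phi (\pi_(circle R) t)%qT = 0 by exact: phiW.
rewrite /= /chain_pairing !zero// => t /e; rewrite /lift_Re /lift_Im => -> //.
Qed.

End ChainSchwartz.

(** * Measures carried by the limit set *)

Section BoundedMeasurable.
Context d (T : measurableType d) (R : realType).
Implicit Types (f g h : T -> R) (c M : R) (D A : set T).

Definition bm f := measurable_fun setT f /\ exists M, forall x, `|f x| <= M.

Lemma bm_cst c : bm (fun=> c).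
Proof. by split; [exact: measurable_cst|exists `|c|]. Qed.

Lemma bmD f g : bm f -> bm g -> bm (fun x => f x + g x).
Proof.
move=> [mf [M hM]] [mg [N hN]]; split; first exact: measurable_funD.
by exists (M + N) => x; apply: le_trans (ler_normD _ _) _; exact: lerD.
Qed.

Lemma bmM f g : bm f -> bm g -> bm (fun x => f x * g x).
Proof.
move=> [mf [M hM]] [mg [N hN]]; split; first exact: measurable_funM.
by exists (M * N) => x; rewrite normrM ler_pM.
Qed.

Lemma bmZ c f : bm f -> bm (fun x => c * f x).
Proof. exact: bmM (bm_cst c). Qed.

Lemma bmB f g : bm f -> bm g -> bm (fun x => f x - g x).
Proof.
move=> bf /(bmZ (-1)) bg; have := bmD bf bg.
by under eq_fun do rewrite mulN1r.
Qed.

Lemma bm_norm f : bm f -> bm (fun x => `|f x|).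
Proof.
move=> [mf [M hM]]; split; first exact: measurableT_comp.
by exists M => x; rewrite normr_id.
Qed.

Lemma bm_indic A : measurable A -> bm (\1_A : T -> R).
Proof.
move=> mA; split; first exact: measurable_indic.
by exists 1 => x; rewrite indicE; case: (x \in A); rewrite ?normr1 ?normr0.
Qed.

Lemma bm_sum (I : Type) (s : seq I) (F : I -> T -> R) :
  (forall i, bm (F i)) -> bm (fun x => \sum_(i <- s) F i x).
Proof.
move=> bF; elim: s => [|i s IH].
  by under eq_fun do rewrite big_nil; exact: bm_cst.
by under eq_fun do rewrite big_cons; exact: bmD.
Qed.

Variable mu : {finite_measure set T -> \bar R}.

Lemma bm_integrable f D : measurable D -> bm f -> mu.-integrable D (EFin \o f).
Proof.
move=> mD [mf [M hM]]; apply: measurable_bounded_integrable => //.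
- by rewrite ltey_eq fin_num_measure.
- exact: measurable_funTS.
exists M; split; first exact: num_real.
by move=> y My x _; apply: le_trans (hM x) (ltW My).
Qed.

Lemma bm_dominated (f_ : nat -> T -> R) D M : measurable D -> (forall n : nat, bm (f_ n)) ->
  (forall n x, `|f_ n x| <= M) -> (forall x, D x -> f_ ^~ x @ \oo --> (0 : R)) ->
  (fun n => \int[mu]_(x in D) `|f_ n x|) @ \oo --> (0 : R).
Proof.
move=> mD bf hM cf.
have [] := @dominated_convergence _ T R mu D mD (fun n x => (f_ n x)%:E) (fun=> 0%E) (fun=> M%:E).
- by move=> n; apply/measurable_EFinP; apply: measurable_funTS; have [] := bf n.
- exact: measurable_cst.
- by apply: aeW => x Dx; apply: cvg_EFin; [exact: nearW|exact: cf].
- exact: bm_integrable (bm_cst M).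
- by apply: aeW => x n Dx; rewrite lee_fin.
move=> _ /fine_cvg h _; apply: cvg_trans h.
apply: near_eq_cvg; apply: nearW => n /=; congr fine; apply: eq_integral => x _.
by rewrite subr0.
Qed.

End BoundedMeasurable.

Section Jordan.
Context d (T : measurableType d) (R : realType).
Variables (mu1 mu2 : {finite_measure set T -> \bar R}).
Implicit Types (f g h : T -> R) (c M : R) (D A : set T).

(** The signed measure [mu1 - mu2] is handled through its two parts; the integral [tint] against
    their sum plays the role of the total variation. *)
Definition dint D f := \int[mu1]_(x in D) f x - \int[mu2]_(x in D) f x.
Definition tint D f := \int[mu1]_(x in D) f x + \int[mu2]_(x in D) f x.

Lemma dintD D f g : measurable D -> bm f -> bm g ->
  dint D (fun x => f x + g x) = dint D f + dint D g.
Proof.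
move=> mD bf bg; rewrite /dint RintegralD ?RintegralD//; try exact: bm_integrable.
by ring.
Qed.

Lemma dintZ D c f : measurable D -> bm f -> dint D (fun x => c * f x) = c * dint D f.
Proof.
move=> mD bf; rewrite /dint RintegralZl ?RintegralZl//; try exact: bm_integrable.
by ring.
Qed.

Lemma dint0 D : measurable D -> dint D (fun=> 0) = 0.
Proof. by move=> mD; rewrite /dint !Rintegral_cst// !mul0r subrr. Qed.

Lemma dint_sum (I : Type) (s : seq I) D (F : I -> T -> R) : measurable D ->
  (forall i, bm (F i)) -> dint D (fun x => \sum_(i <- s) F i x) = \sum_(i <- s) dint D (F i).
Proof.
move=> mD bF; elim: s => [|i s IH].
  by rewrite big_nil; under [X in dint _ X]eq_fun do rewrite big_nil; exact: dint0.
rewrite big_cons -IH; under [X in dint _ X]eq_fun do rewrite big_cons.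
by apply: dintD => //; exact: bm_sum.
Qed.

Lemma dint_le_tint D f g : measurable D -> bm f -> bm g -> (forall x, D x -> `|f x| <= g x) ->
  `|dint D f| <= tint D g.
Proof.
move=> mD bf bg fg; apply: le_trans (ler_normB _ _) _; apply: lerD.
  apply: le_trans (le_normr_Rintegral mD (bm_integrable _ mD bf)) _.
  by apply: le_Rintegral => //; apply: bm_integrable => //; exact: bm_norm.
apply: le_trans (le_normr_Rintegral mD (bm_integrable _ mD bf)) _.
by apply: le_Rintegral => //; apply: bm_integrable => //; exact: bm_norm.
Qed.

Lemma tintZ D c f : measurable D -> bm f -> tint D (fun x => c * f x) = c * tint D f.
Proof.
move=> mD bf; rewrite /tint RintegralZl ?RintegralZl//; try exact: bm_integrable.
by ring.
Qed.

Lemma dint_setT D f : measurable D -> bm f -> mu1 (~` D) = 0%E -> mu2 (~` D) = 0%E ->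
  dint setT f = dint D f.
Proof.
move=> mD bf h1 h2; rewrite /dint /Rintegral.
have mC := measurableC mD.
rewrite (negligible_integral mC measurableT (bm_integrable mu1 measurableT bf) h1).
rewrite (negligible_integral mC measurableT (bm_integrable mu2 measurableT bf) h2).
by rewrite setTD setCK.
Qed.

End Jordan.

(** * Borel and Lipschitz functions on the circle *)

Section CircleBorel.
Variable R : realType.
Implicit Types (u : R -> R) (f : circle R -> R) (z w : circle R) (U : set (circle R)).

Definition down u : circle R -> R := fun z => u (repr z).

Lemma down_circ u t : periodic2pi u -> down u (circ t) = u t.
Proof.
move=> pu; rewrite /down; have [k /eqP] := repr_circleP t.
by rewrite subr_eq addrC => /eqP e; rewrite /circ e pu.
Qed.

Lemma open_circle_measurable U : open U -> measurable (U : set (circle_borel R)).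
Proof. by move=> oU; apply: sub_sigma_algebra. Qed.

Lemma closed_circle_measurable U : closed U -> measurable (U : set (circle_borel R)).
Proof.
move=> cU; rewrite -[U]setCK; apply: measurableC; apply: open_circle_measurable.
exact: closed_openC.
Qed.

Lemma lip_bm f (B M : R) : (forall z w, `|f z - f w| <= B * mdist z w) -> (forall z, `|f z| <= M) ->
  bm (f : circle_borel R -> R).
Proof.
move=> lf hM; split; last by exists M.
apply: (measurability _ (RGenOpens.measurableE R)).
move=> _ [_ [a [b ->] <-]]; rewrite setTI; apply: open_circle_measurable.
rewrite openE => z; rewrite /= in_itv /= => /andP[az zb].
have B1 : 0 < `|B| + 1 by rewrite ltr_wpDl.
have m0 : 0 < Num.min (f z - a) (b - f z) by rewrite lt_min !subr_gt0 az zb.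
apply/nbhs_ballP; exists (Num.min (f z - a) (b - f z) / (`|B| + 1)); first by rewrite /= divr_gt0.
move=> w; rewrite ballEmdist /= => zw; rewrite in_itv /=.
have : `|f z - f w| < Num.min (f z - a) (b - f z).
  apply: le_lt_trans (lf z w) _.
  apply: (@le_lt_trans _ _ ((`|B| + 1) * mdist z w)); last by rewrite mulrC -ltr_pdivlMr.
  by rewrite ler_wpM2r ?mdist_ge0//; apply: le_trans (ler_norm B) _; rewrite lerDl.
rewrite lt_min !ltr_norml => /andP[/andP[h1 h2] /andP[h3 h4]].
by apply/andP; split; lra.
Qed.

Lemma lip_lift f (B : R) : 0 <= B -> (forall z w, `|f z - f w| <= B * mdist z w) ->
  [/\ cont (fun t => f (circ t)), periodic2pi (fun t => f (circ t)) &
      lipc (32 * B ^+ 2) (fun t => f (circ t))].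
Proof.
move=> B0 lf.
have pf : periodic2pi (fun t => f (circ t)) by move=> k x; rewrite circ_per.
have lc x y : `|f (circ x) - f (circ y)| <= B * `|x - y|.
  apply: le_trans (lf _ _) _; rewrite ler_wpM2l//.
  by have := mdist_circ_le 0 x y; rewrite mul0r addr0.
split => //; last by apply: lipc_of.
move=> x; apply/cvgrPdist_le => e e0.
have B1 : 0 < B + 1 by rewrite ltr_wpDl.
apply/nbhs_ballP; exists (e / (B + 1)); first by rewrite /= divr_gt0.
move=> y; rewrite /ball /= => xy; apply: le_trans (lc x y) _.
apply: (@le_trans _ _ ((B + 1) * `|x - y|)); first by rewrite ler_wpM2r// lerDl.
by rewrite mulrC -ler_pdivlMr// ltW.
Qed.

Lemma down_trig_lip u (B : R) : (forall x y, `|u x - u y| <= B * `|x - y|) -> 0 <= B ->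
  periodic2pi u -> forall z w, `|down u z - down u w| <= B * mdist z w.
Proof.
move=> lu B0 pu z w; apply/ler_addgt0Pr => e e0.
have B1 : 0 < B + 1 by rewrite ltr_wpDl.
have [k hk] : exists k : int, `|repr z - repr w + k%:~R * (2 * pi)| < mdist z w + e / (B + 1).
  by apply: mdist_circ_lt; rewrite !circ_repr ltrDl divr_gt0.
rewrite /down -(pu k (repr z)); apply: le_trans (lu _ _) _.
rewrite addrAC; apply: le_trans (ler_wpM2l B0 (ltW hk)) _.
rewrite mulrDr lerD2l mulrCA ler_piMr ?(ltW e0)// ler_pdivrMr// mul1r lerDl.
by [].
Qed.

End CircleBorel.

Section TruncatedDistance.
Context (R : realType) (T : metricType R).
Implicit Types (U : set T) (z w : T).

(* Truncating at [1] keeps the infimum meaningful when [U] is the whole space. *)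
Definition cdist U z : R := inf (1 |` [set mdist z w | w in ~` U]).

Lemma cdist_has_inf U z : has_inf (1 |` [set mdist z w | w in ~` U]).
Proof.
split; first by exists 1; left.
by exists 0 => _ [->|[w _ <-]]; [|exact: mdist_ge0].
Qed.

Lemma cdist_ge0 U z : 0 <= cdist U z.
Proof.
apply: lb_le_inf; first by exists 1; left.
by move=> _ [->|[w _ <-]]; [|exact: mdist_ge0].
Qed.

Lemma cdist_le U z w : cdist U z <= cdist U w + mdist z w.
Proof.
rewrite -lerBlDr; apply: lb_le_inf; first by exists 1; left.
have [_ hb] := cdist_has_inf U z.
move=> _ [->|[y Uy <-]]; rewrite lerBlDr.
  apply: (@le_trans _ _ 1); last by rewrite lerDl mdist_ge0.
  by apply: ge_inf => //; left.
apply: (@le_trans _ _ (mdist z y)); last by rewrite addrC; exact: metric_triangle.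
by apply: ge_inf => //; right; exists y.
Qed.

Lemma cdist_lip U z w : `|cdist U z - cdist U w| <= mdist z w.
Proof.
have h1 := cdist_le U z w; have h2 := cdist_le U w z.
by rewrite metric_sym in h2; rewrite ler_norml; apply/andP; split; lra.
Qed.

Lemma cdist_gt0 U z : open U -> U z -> 0 < cdist U z.
Proof.
rewrite openE => /(_ z) /[apply] /nbhs_ballP [e /= e0 eU].
apply: lt_le_trans (_ : 0 < Num.min 1 e) _; first by rewrite lt_min ltr01.
apply: lb_le_inf; first by exists 1; left.
move=> _ [->|[w Uw <-]]; rewrite ge_min ?lexx//; apply/orP; right.
by rewrite leNgt; apply/negP => zw; apply: Uw; apply: eU; rewrite ballEmdist.
Qed.

Lemma cdist_eq0 U z : ~ U z -> cdist U z = 0.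
Proof.
move=> Uz; apply/eqP; rewrite eq_le cdist_ge0 andbT -(mdistxx z).
by have [_ hb] := cdist_has_inf U z; apply: ge_inf => //; right; exists z.
Qed.

Definition bump U (n : nat) z : R := Num.min 1 (n%:R * cdist U z).

Lemma bump_ge0 U n z : 0 <= bump U n z.
Proof. by rewrite le_min ler01 mulr_ge0// cdist_ge0. Qed.

Lemma bump_norm U n z : `|bump U n z| <= 1.
Proof. by rewrite ger0_norm ?bump_ge0// ge_min lexx. Qed.

Lemma bump_lip U n z w : `|bump U n z - bump U n w| <= n%:R * mdist z w.
Proof.
apply: (@le_trans _ _ `|n%:R * cdist U z - n%:R * cdist U w|); last first.
  by rewrite -mulrBr normrM ger0_norm// ler_wpM2l// cdist_lip.
rewrite /bump; move: (n%:R * _) (n%:R * _) => a b.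
have h1 := ler_norm (a - b); have h2 := ler_norm (b - a); rewrite distrC in h1.
by case: (leP 1 a) => ha; case: (leP 1 b) => hb; rewrite ler_norml; apply/andP; split; lra.
Qed.

Lemma bump_cvg U z : open U -> bump U ^~ z @ \oo --> (\1_U z : R).
Proof.
move=> oU; have [Uz|Uz] := pselect (U z); last first.
  rewrite indicE memNset//=; apply: cvg_near_cst; apply: nearW => n.
  by rewrite /bump (cdist_eq0 Uz) mulr0 min_r.
rewrite indicE mem_set//=; have d0 := cdist_gt0 oU Uz.
apply: cvg_near_cst; exists (Num.truncn (cdist U z)^-1).+1 => // n /= hn.
rewrite /bump min_l// -ler_pdivrMr// div1r.
have h : (cdist U z)^-1 < (Num.truncn (cdist U z)^-1).+1%:R by exact: truncnS_gt.
by apply: le_trans (ltW h) _; rewrite ler_nat.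
Qed.

End TruncatedDistance.

Lemma cvg0_half (R : realType) (v : nat -> R) (B : R) :
  (forall j, `|v j| <= B * 2^-1 ^+ (j + 2)) -> v @ \oo --> (0 : R).
Proof.
move=> hv; pose g j := B * 2^-1 ^+ (j + 2).
have cg : g @ \oo --> (0 : R).
  have -> : g = (fun j => B * 2^-1 ^+ 2 * 2^-1 ^+ j).
    by apply/funext => j; rewrite /g addnC exprD mulrA.
  rewrite -(mulr0 (B * 2^-1 ^+ 2)); apply: cvgMl_tmp; apply: cvg_expr.
  by rewrite ger0_norm//; lra.
have cgN : (fun j => - g j) @ \oo --> (0 : R) by rewrite -oppr0; exact: cvgN.
apply: (squeeze_cvgr _ cgN cg); apply: nearW => j.
by have := hv j; rewrite ler_norml.
Qed.

(** * Vanishing of signed measures on the limit set *)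

Section Kill.
Variables (R : realType) (q : R) (ch : chain q).
Hypothesis q2 : 2 < q.
Variables (mu1 mu2 : {finite_measure set (circle_borel R) -> \bar R}) (M : R).
Local Notation K := (chain_set ch : set (circle_borel R)).
Local Notation cosn n := (down (fun t : R => cos (n%:~R * t)) : circle_borel R -> R).
Local Notation sinn n := (down (fun t : R => sin (n%:~R * t)) : circle_borel R -> R).
Hypothesis mu1K : mu1 (~` K) = 0%E.
Hypothesis mu2K : mu2 (~` K) = 0%E.
Hypothesis cosM : forall s : seq int, uniq s ->
  \sum_(n <- s) `|dint mu1 mu2 setT (cosn n)| `^ q <= M.
Hypothesis sinM : forall s : seq int, uniq s ->
  \sum_(n <- s) `|dint mu1 mu2 setT (sinn n)| `^ q <= M.
Implicit Types (h : circle_borel R -> R) (n : int) (j : nat).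

Let cj j := ch_c ch j.
Let mj j := ch_m ch j.

Definition lay j : circle_borel R -> R := down (fun t => cj j * cs (mj j) t).

Lemma chain_set_measurable : measurable K.
Proof.
apply: closed_circle_measurable; apply: compact_closed; first exact: metric_hausdorff.
exact: chain_set_compact.
Qed.
Let mK := chain_set_measurable.

Lemma cosn_bm n : bm (cosn n).
Proof.
apply: (@lip_bm _ _ `|n%:~R| 1) => [z w|z]; last exact: cos_max.
apply: down_trig_lip => //; last by have [_ ? _] := @good_cosn R n.
have dn : dv (fun t : R => cos (n%:~R * t)) (fun t => - sin (n%:~R * t) * n%:~R).
  apply: dv_eq; first (apply: dv_comp; [exact: dv_cos|by apply: dvM; [exact: dvC|exact: dvI]]).
  by move=> t /=; ring.
apply: (mvt_norm dn) => t; rewrite normrM normrN ler_piMl//; exact: sin_max.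
Qed.

Lemma sinn_bm n : bm (sinn n).
Proof.
apply: (@lip_bm _ _ `|n%:~R| 1) => [z w|z]; last exact: sin_max.
apply: down_trig_lip => //; last first.
  by move=> k x; rewrite mulrDr mulrA -intrM; have [_ ->] := cos_sin_period (n * k) (n%:~R * x).
have dn : dv (fun t : R => sin (n%:~R * t)) (fun t => cos (n%:~R * t) * n%:~R).
  apply: dv_eq; first (apply: dv_comp; [exact: dv_sin|by apply: dvM; [exact: dvC|exact: dvI]]).
  by move=> t /=; ring.
apply: (mvt_norm dn) => t; rewrite normrM ler_piMl//; exact: cos_max.
Qed.

Lemma layE j : lay j = (fun z => cj j * \sum_(k < mj j) cosn (9 ^ k)%:Z z).
Proof. by []. Qed.

Lemma lay_bm j : bm (lay j).
Proof. by rewrite layE; apply: bmZ; apply: bm_sum => k; exact: cosn_bm. Qed.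

Lemma lay_itv j z : K z -> 1 <= lay j z <= 512.
Proof.
move=> [t ht <-]; have [h _] := ht j.
have [_ pc _] := @good_cs R (mj j).
by rewrite /lay down_circ// => k x; rewrite pc.
Qed.

(** A property of [h] to be carried from characters to indicators of Borel sets, where [lay j >= 1]
    on [K] makes it force a measure to vanish. *)
Definition killed h := (fun j => dint mu1 mu2 K (fun z => lay j z * h z)) @ \oo --> (0 : R).

(** Hoelder: the [q]-th power is at most [c ^ q * m ^ (q - 1) * M], and the first two factors are
    below [tol q j]. An arbitrary injective [g] allows shifted frequencies. *)
Lemma lacunary_cvg (a : int -> R) (g : nat -> int) : injective g ->
  (forall s, uniq s -> \sum_(k <- s) `|a k| `^ q <= M) ->
  (fun j => cj j * \sum_(k < mj j) a (g k)) @ \oo --> (0 : R).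
Proof.
move=> ig aM; have q2' := q2; have q0 : 0 < q by lra.
have q1 : 1 < q by lra.
have M0 : 0 <= M by have := aM [::] isT; rewrite big_nil.
have bnd j : `|cj j * \sum_(k < mj j) a (g k)| <= M `^ q^-1 * 2^-1 ^+ (j + 2).
  have [c0 cm] := (ch_c_gt0 ch j, ch_cm ch j).
  rewrite -/(cj j) -/(mj j) in c0 cm; set X := \sum_(k < _) _.
  have [/andP[h0 h1] B0] := (@half_itv R (j + 2), powR_ge0 M q^-1).
  have [m0|m0] := posnP (mj j).
    by rewrite /X m0 big_ord0 mulr0 normr0 mulr_ge0// ltW.
  have Xq : `|X| `^ q <= (mj j)%:R `^ (q - 1) * M.
    have := @powR_jensen R q (mj j)%:R 'I_(mj j) (index_enum _) predT (fun=> 1)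
      (fun k : 'I_(mj j) => a (g k)) q1 _ (fun=> ler01).
    rewrite ltr0n m0 sumr_const card_ord => /(_ isT (lexx _)).
    under eq_bigr do rewrite mul1r.
    move=> h; apply: le_trans h _; rewrite ler_wpM2l ?powR_ge0//.
    under eq_bigr do rewrite mul1r.
    have := aM [seq g (nat_of_ord k) | k : 'I_(mj j) <- index_enum 'I_(mj j)].
    rewrite big_map; apply.
    by rewrite map_inj_uniq ?index_enum_uniq// => x y /ig; exact: val_inj.
  rewrite normrM (gtr0_norm c0) leNgt; apply/negP => lt.
  have := @gt0_ltr_powR R q q0 _ _ _ _ lt; rewrite !nnegrE.
  rewrite !mulr_ge0 ?(ltW c0) ?(ltW h0)// => /(_ isT isT).
  rewrite !powRM ?(ltW c0) ?(ltW h0)// -powRrM mulVf ?gt_eqF// powRr1// ltNge => /negP; apply.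
  apply: le_trans (ler_wpM2l (powR_ge0 _ _) Xq) _.
  rewrite mulrA [leRHS]mulrC ler_wpM2r//; apply: le_trans cm _.
  by apply: tol_le; rewrite lerDl.
exact: cvg0_half bnd.
Qed.

Lemma killedZ (c : R) h : bm h -> killed h -> killed (fun z => c * h z).
Proof.
move=> bh kh; rewrite /killed -(mulr0 c).
rewrite (_ : (fun j => _) = (fun j => c * dint mu1 mu2 K (fun z => lay j z * h z))).
  exact: cvgMl_tmp.
apply/funext => j; rewrite -dintZ//; last by apply: bmM => //; exact: lay_bm.
by congr dint; apply/funext => z; rewrite mulrCA.
Qed.

Lemma killedD h1 h2 : bm h1 -> bm h2 -> killed h1 -> killed h2 -> killed (fun z => h1 z + h2 z).
Proof.
move=> b1 b2 k1 k2; rewrite /killed -(addr0 0).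
rewrite (_ : (fun j => _) = (fun j => dint mu1 mu2 K (fun z => lay j z * h1 z) +
    dint mu1 mu2 K (fun z => lay j z * h2 z))).
  exact: cvgD.
apply/funext => j; have lj := lay_bm j; rewrite -dintD//; [|exact: bmM|exact: bmM].
by congr dint; apply/funext => z; rewrite mulrDr.
Qed.

Lemma killed_sum (I : Type) (s : seq I) (F : I -> circle_borel R -> R) :
  (forall i, bm (F i)) -> (forall i, killed (F i)) -> killed (fun z => \sum_(i <- s) F i z).
Proof.
move=> bF kF; elim: s => [|i s IH].
  rewrite /killed (_ : (fun j => _) = (fun=> 0)); first exact: cvg_cst.
  apply/funext => j; rewrite -[RHS](dint0 mu1 mu2 mK); congr dint; apply/funext => z.
  by rewrite big_nil mulr0.
rewrite (_ : (fun z => _) = (fun z => F i z + \sum_(k <- s) F k z)).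
  by apply: killedD => //; exact: bm_sum.
by apply/funext => z; rewrite big_cons.
Qed.

(** Since [lay j] is at most 512 on [K] for all [j], dominated convergence makes the approximation
    error small uniformly in [j]. *)
Lemma killed_limit (g : nat -> circle_borel R -> R) (B : R) h : (forall k, bm (g k)) ->
  bm h -> (forall k z, `|g k z| <= B) -> (forall z, g ^~ z @ \oo --> (h z : R)) ->
  (forall k, killed (g k)) -> killed h.
Proof.
move=> bg bh gB gh kg.
have [_ [C hC]] := bh.
have tv : (fun k => tint mu1 mu2 K (fun z => `|h z - g k z|)) @ \oo --> (0 : R).
  rewrite -(addr0 0); apply: cvgD.
    apply: (@bm_dominated _ _ _ mu1 (fun k z => h z - g k z) K (C + B)) => //.
    - by move=> k; exact: bmB.
    - by move=> k z; apply: le_trans (ler_normB _ _) _; exact: lerD.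
    - by move=> z _; rewrite -(subrr (h z)); apply: cvgB => //; exact: cvg_cst.
  apply: (@bm_dominated _ _ _ mu2 (fun k z => h z - g k z) K (C + B)) => //.
  - by move=> k; exact: bmB.
  - by move=> k z; apply: le_trans (ler_normB _ _) _; exact: lerD.
  - by move=> z _; rewrite -(subrr (h z)); apply: cvgB => //; exact: cvg_cst.
apply/cvgr0Pnorm_le => e e0.
have e2 : 0 < e / 2 := divr_gt0 e0 (ltr0Sn R 1).
have e1 : 0 < e / 2 / 512 := divr_gt0 e2 (ltr0Sn R 511).
have /cvgr0Pnorm_le/(_ _ e1)[k _ /(_ k (leqnn k))/= hk] := tv.
have /cvgr0Pnorm_le/(_ _ e2) := kg k; apply: filterS => j hj.
have lj := lay_bm j; have bd : bm (fun z => h z - g k z) by exact: bmB.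
rewrite (_ : dint _ _ _ _ = dint mu1 mu2 K (fun z => lay j z * g k z) +
    dint mu1 mu2 K (fun z => lay j z * (h z - g k z))); last first.
  rewrite -dintD//; [|exact: bmM|exact: bmM].
  by congr dint; apply/funext => z; rewrite -mulrDr addrC subrK.
rewrite (splitr e); apply: le_trans (ler_normD _ _) _; apply: lerD => //.
have bn := bm_norm bd.
apply: (@le_trans _ _ (tint mu1 mu2 K (fun z => 512 * `|h z - g k z|))).
  apply: (dint_le_tint _ _ mK (bmM lj bd) (bmZ _ bn)).
  move=> z /(lay_itv j)/andP[l1 l2]; rewrite normrM ler_wpM2r// ger0_norm//.
  exact: le_trans ler01 l1.
rewrite (tintZ mu1 mu2 512 mK bn) mulrC -(ler_pdivlMr _ _ (ltr0Sn R 511)); exact: le_trans (ler_norm _) hk.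
Qed.

(** Multiplication by the cosine of [n] turns the frequencies [9 ^ k] into [9 ^ k + n] and
    [9 ^ k - n], two injective families. *)
Lemma killed_cosn n : killed (cosn n).
Proof.
pose a k := dint mu1 mu2 K (cosn k).
have aM s : uniq s -> \sum_(k <- s) `|a k| `^ q <= M.
  have e k : a k = dint mu1 mu2 setT (cosn k) := esym (dint_setT mK (cosn_bm k) mu1K mu2K).
  move=> us; rewrite (eq_bigr (fun k => `|dint mu1 mu2 setT (cosn k)| `^ q)); first exact: cosM.
  by move=> k _; rewrite e.
have i1 : injective (fun k : nat => (9 ^ k)%:Z + n).
  by move=> x y /addIr [] /expnI; exact.
have i2 : injective (fun k : nat => (9 ^ k)%:Z - n).
  by move=> x y /addIr [] /expnI; exact.
have h1 := lacunary_cvg i1 aM; have h2 := lacunary_cvg i2 aM.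
rewrite /killed -(mulr0 2^-1) -(addr0 0).
rewrite (_ : (fun j => _) = (fun j => 2^-1 *
    (cj j * (\sum_(k < mj j) a ((9 ^ k)%:Z + n)) + cj j * (\sum_(k < mj j) a ((9 ^ k)%:Z - n))))).
  exact: cvgMl_tmp (cvgD h1 h2).
apply/funext => j.
rewrite /a -!dint_sum//; try by move=> k; exact: cosn_bm.
rewrite -mulrDr -dintD//; try by apply: bm_sum => k; exact: cosn_bm.
rewrite mulrA -dintZ//; last by apply: bmD; apply: bm_sum => k; exact: cosn_bm.
congr dint; apply/funext => z; rewrite layE -big_split /= -mulrA mulr_suml !mulr_sumr.
apply: eq_bigr => k _; rewrite /down cosMcos intrD intrB mulrDl mulrBl; ring.
Qed.

Lemma killed_sinn n : killed (sinn n).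
Proof.
pose a k := dint mu1 mu2 K (sinn k).
have aM s : uniq s -> \sum_(k <- s) `|a k| `^ q <= M.
  have e k : a k = dint mu1 mu2 setT (sinn k) := esym (dint_setT mK (sinn_bm k) mu1K mu2K).
  move=> us; rewrite (eq_bigr (fun k => `|dint mu1 mu2 setT (sinn k)| `^ q)); first exact: sinM.
  by move=> k _; rewrite e.
have i1 : injective (fun k : nat => (9 ^ k)%:Z + n).
  by move=> x y /addIr [] /expnI; exact.
have i2 : injective (fun k : nat => (9 ^ k)%:Z - n).
  by move=> x y /addIr [] /expnI; exact.
have h1 := lacunary_cvg i1 aM; have h2 := lacunary_cvg i2 aM.
rewrite /killed -(mulr0 2^-1) -(subrr 0).
rewrite (_ : (fun j => _) = (fun j => 2^-1 *
    (cj j * (\sum_(k < mj j) a ((9 ^ k)%:Z + n)) - cj j * (\sum_(k < mj j) a ((9 ^ k)%:Z - n))))).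
  exact: cvgMl_tmp (cvgB h1 h2).
apply/funext => j.
rewrite /a -!dint_sum//; try by move=> k; exact: sinn_bm.
have b1 : bm (fun z => \sum_(k < mj j) sinn ((9 ^ k)%:Z + n) z) by apply: bm_sum => k; exact: sinn_bm.
have b2 : bm (fun z => \sum_(k < mj j) sinn ((9 ^ k)%:Z - n) z) by apply: bm_sum => k; exact: sinn_bm.
rewrite -mulrBr -[X in _ - X]mul1r -mulNr -(dintZ _ _ (- 1) mK b2).
rewrite -(dintD _ _ mK b1 (bmZ _ b2)) mulrA -(dintZ _ _ _ mK (bmD b1 (bmZ _ b2))).
congr dint; apply/funext => z; rewrite layE mulN1r -sumrB /= -mulrA mulr_suml !mulr_sumr.
apply: eq_bigr => k _; rewrite /down intrD intrB mulrDl mulrBl sinD sinB; by field.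
Qed.

(** The lift of [f] is a uniform limit of Fejer means, which are combinations of cosines and
    sines. *)
Lemma killed_lip (f : circle R -> R) (B C : R) : 0 <= B ->
  (forall z w, `|f z - f w| <= B * mdist z w) -> (forall z, `|f z| <= C) -> killed f.
Proof.
move=> B0 lf fC; have bf := lip_bm lf fC; have [cu pu lu] := lip_lift B0 lf.
set u := fun t => f (circ t) in cu pu lu.
have L0 : 0 <= 32 * B ^+ 2 by rewrite mulr_ge0// sqr_ge0.
have e0 k : 0 < k.+1%:R^-1 :> R by rewrite invr_gt0.
have [N hN] : {N : nat -> nat & forall k, (0 < N k)%N /\
    forall x, `|sig (N k) u x - u x| <= k.+1%:R^-1}.
  apply: (@boolp.choice _ _ (fun k N => (0 < N)%N /\
    forall x, `|sig N u x - u x| <= k.+1%:R^-1)) => k.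
  by have [N N0 h] := sig_unif cu lu L0 (e0 k); exists N.
have du z : u (repr z) = f z by rewrite /u circ_repr.
pose g k : circle_borel R -> R := fun z => sig (N k) u (repr z).
have gE k : g k = (fun z => (N k)%:R^-1 * \sum_(i < N k) \sum_(l < N k)
   (hat u (i%:Z - l%:Z) * cosn (i%:Z - l%:Z) z + hats u (i%:Z - l%:Z) * sinn (i%:Z - l%:Z) z)).
  by apply/funext => z; rewrite /g sigE.
have b1 k (i l : 'I_(N k)) : bm (fun z => hat u (i%:Z - l%:Z) * cosn (i%:Z - l%:Z) z +
    hats u (i%:Z - l%:Z) * sinn (i%:Z - l%:Z) z).
  by apply: bmD; apply: bmZ; [exact: cosn_bm|exact: sinn_bm].
have b2 k (i : 'I_(N k)) := bm_sum (index_enum 'I_(N k)) (b1 k i).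
have bg k : bm (g k) by rewrite gE; apply: bmZ; apply: bm_sum => i; exact: b2.
apply: (@killed_limit g (C + 1)) => //.
- move=> k z; rewrite -[g k z](subrK (u (repr z))) addrC; apply: le_trans (ler_normD _ _) _.
  rewrite du; apply: lerD => //; rewrite -du; apply: le_trans ((hN k).2 _) _.
  by rewrite invf_le1// ler1n.
- move=> z; rewrite -du; apply/cvgrPdist_le => e ep.
  exists (Num.truncn e^-1) => // k /= hk; rewrite distrC; apply: le_trans ((hN k).2 _) _.
  rewrite -[leRHS]invrK lef_pV2 ?posrE ?invr_gt0//.
  have h : e^-1 < (Num.truncn e^-1).+1%:R by exact: truncnS_gt.
  by apply: le_trans (ltW h) _; rewrite ler_nat ltnS.
move=> k; rewrite gE; apply: killedZ; first by apply: bm_sum => i; exact: b2.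
apply: killed_sum => [i|i]; first exact: b2.
apply: killed_sum => [l|l]; first exact: b1.
have [cn sn] := (cosn_bm (i%:Z - l%:Z), sinn_bm (i%:Z - l%:Z)).
apply: killedD; [exact: bmZ|exact: bmZ| |].
  by apply: killedZ => //; exact: killed_cosn.
by apply: killedZ => //; exact: killed_sinn.
Qed.

Lemma killed_open (U : set (circle R)) : open U -> killed (\1_U).
Proof.
move=> oU; apply: (@killed_limit (bump U) 1).
- by move=> k; apply: lip_bm (bump_lip U k) (bump_norm U k).
- by apply: bm_indic; exact: open_circle_measurable.
- by move=> k z; exact: bump_norm.
- by move=> z; exact: bump_cvg.
by move=> k; apply: killed_lip (bump_lip U k) (bump_norm U k).
Qed.

(** The sets with this property form a Dynkin class, and the open sets are stable under
    intersection. *)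
Lemma killed_measurable (A : set (circle_borel R)) : measurable A -> killed (\1_A).
Proof.
move=> mA; apply: (@dynkin_induction _ (circle_borel R) (@open (circle R)) (fun A => killed (\1_A))) => //.
- by move=> U V oU oV; exact: openI.
- by apply: killed_open; exact: openT.
- exact: killed_open.
- move=> S mS kS; have b1 := bm_indic R mS.
  rewrite (_ : \1_(~` S) = (fun z => \1_setT z + - 1 * \1_S z)).
    apply: killedD; [exact: bm_indic|exact: bmZ|by apply: killed_open; exact: openT|exact: killedZ].
  apply/funext => z; rewrite !indicE in_setC in_setT; case: (z \in S) => /=; ring.
move=> F mF tF kF.
have bF k := bm_indic R (mF k).
have sumF i z : F i z -> forall k, \sum_(l < k) \1_(F l) z = (i < k)%:R :> R.
  move=> Fz; have e l : \1_(F l) z = (l == i)%:R :> R.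
    rewrite indicE; congr ((nat_of_bool _)%:R); apply/idP/eqP => [|->]; last exact: mem_set.
    by move=> /set_mem Fl; apply: tF => //; exists z.
  elim=> [|k IH]; first by rewrite big_ord0.
  rewrite big_ord_recr /= IH e ltnS (leq_eqVlt i k) (eq_sym i).
  by have [->|_] := eqVneq k i; rewrite ?ltnn ?add0r ?addr0.
have sumF0 z : ~ (\bigcup_k F k) z -> forall k, \sum_(l < k) \1_(F l) z = 0 :> R.
  move=> nF k; rewrite big1// => l _; rewrite indicE memNset// => Fz.
  by apply: nF; exists (nat_of_ord l).
apply: (@killed_limit (fun k z => \sum_(l < k) \1_(F l) z) 1).
- by move=> k; apply: bm_sum => l; exact: bF.
- by apply: bm_indic; exact: bigcupT_measurable.
- move=> k z; have [[i _ Fz]|nF] := pselect ((\bigcup_k F k) z).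
    by rewrite (sumF i z Fz); case: (i < k)%N; rewrite ?normr1 ?normr0.
  by rewrite sumF0// normr0.
- move=> z; have [Fz|nF] := pselect ((\bigcup_k F k) z).
    rewrite indicE mem_set//=; have [i _ Fiz] := Fz.
    by apply: cvg_near_cst; exists i.+1 => // k /= ik; rewrite (sumF i z Fiz) ik.
  by rewrite indicE memNset//=; apply: cvg_near_cst; apply: nearW => k; rewrite sumF0.
by move=> k; apply: killed_sum => l; [exact: bF|exact: kF].
Qed.

(** Test [killed] on the indicator of [P], where only [mu1] lives: [mu1 (P] meet [K)] is at most
    each of the integrals, which tend to 0. *)
Lemma singular_null (P : set (circle_borel R)) : measurable P ->
  mu1 (~` P) = 0%E -> mu2 P = 0%E -> mu1 setT = 0%E.
Proof.
move=> mP P1 P2; have kP := killed_measurable mP.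
have bP := bm_indic R mP.
have ind (mu : {finite_measure set (circle_borel R) -> \bar R}) :
    \int[mu]_(z in K) (\1_P z : R) = fine (mu (P `&` K)).
  by rewrite /Rintegral integral_indic.
have PK2 : mu2 (P `&` K) = 0%E.
  apply/eqP; rewrite eq_le measure_ge0 andbT -P2; apply: le_measure; [by apply/mem_set; exact: measurableI|exact: mem_set|exact: subIsetl].
have lo j : fine (mu1 (P `&` K)) <= dint mu1 mu2 K (fun z => lay j z * \1_P z).
  have bl := bmM (lay_bm j) bP; have b5 := bmZ 512 bP.
  have h1 : fine (mu1 (P `&` K)) <= \int[mu1]_(z in K) (lay j z * \1_P z).
    rewrite -ind; apply: le_Rintegral; [exact: mK|exact: bm_integrable|exact: bm_integrable|].
    by move=> z /(lay_itv j)/andP[l1 _]; rewrite ler_peMl.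
  have h2 : \int[mu2]_(z in K) (lay j z * \1_P z) <= 0.
    apply: (@le_trans _ _ (\int[mu2]_(z in K) (512 * \1_P z))).
      apply: le_Rintegral; [exact: mK|exact: bm_integrable|exact: bm_integrable|].
      by move=> z /(lay_itv j)/andP[_ l2]; rewrite ler_wpM2r.
    by rewrite RintegralZl ?ind ?PK2 ?mulr0//; exact: bm_integrable.
  by rewrite /dint; lra.
have f0 : fine (mu1 (P `&` K)) <= 0 by apply: (cvgr_to_ge kP); exact: nearW.
have PK1 : mu1 (P `&` K) = 0%E.
  have fin : mu1 (P `&` K) \is a fin_num by apply: fin_num_measure; exact: measurableI.
  rewrite -[LHS]fineK//; congr (_%:E); apply/eqP; rewrite eq_le f0 fine_ge0//.
have mC := measurableC mK; have mPC := measurableC mP.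
have u : (mu1 setT <= mu1 (P `&` K) + (mu1 (~` P) + mu1 (~` K)))%E.
  have -> : setT = (P `&` K) `|` (~` P `|` ~` K) by rewrite -setCI setUCr.
  have u1 := measureU2 mu1 (measurableI _ _ mP mK) (measurableU _ _ mPC mC).
  have u2 := measureU2 mu1 mPC mC.
  by apply: le_trans u1 _; exact: leeD (le_refl _) u2.
apply/eqP; rewrite eq_le measure_ge0 andbT; apply: le_trans u _.
by rewrite PK1 P1 mu1K !adde0.
Qed.

End Kill.

(** * Null sets of charges and Jordan parts *)

Section ChargeNull.
Variable R : realType.
Implicit Types (nu : {charge set (circle_borel R) -> \bar R}) (A U : set (circle_borel R)).

(** Vanishing on all measurable subsets: [nu U = 0] alone could come from cancellation. *)
Definition charge_null nu U := forall A, measurable A -> A `<=` U -> nu A = 0%E.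

Lemma charge_null_bigcup nu (F : nat -> set (circle_borel R)) :
  (forall k, measurable (F k)) -> (forall k, charge_null nu (F k)) ->
  charge_null nu (\bigcup_k F k).
Proof.
move=> mF nF A mA AF.
have mD k : measurable (A `&` seqDU F k) by apply: measurableI => //; exact: seqDU_measurable.
have e : \bigcup_k (A `&` seqDU F k) = A.
  by rewrite -setI_bigcupr -seqDU_bigcup_eq; exact: setIidl.
have := @charge_semi_sigma_additive _ _ _ nu (fun k => A `&` seqDU F k) mD.
rewrite e => /(_ (@trivIset_setIl _ _ setT (seqDU F) (fun=> A) (@trivIset_seqDU _ F)) mA) h.
rewrite -(cvg_lim _ h)//; apply: cvg_lim => //.
rewrite (_ : (fun n => _) = (fun=> 0%E)); first exact: cvg_cst.
apply/funext => n; rewrite big1// => k _; apply: (nF k) => //.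
by move=> z [_ [Fz _]].
Qed.

Lemma ratr_circ_dense (z : circle R) (e : R) : 0 < e ->
  exists r : rat, mdist (circ (ratr r : R)) z < e.
Proof.
move=> e0; have lt : repr z < repr z + e by rewrite ltrDl.
have [r] := rat_in_itvoo lt; rewrite in_itv /= => /andP[h1 h2]; exists r.
rewrite -(circ_repr z); have := mdist_circ_le 0 (ratr r) (repr z).
rewrite mul0r addr0 => /le_lt_trans; apply.
by rewrite gtr0_norm ?subr_gt0// ltrBlDl.
Qed.

(* Balls with rational centres and radii [1 / (n + 1)] form a countable base. *)
Lemma charge_null_local nu U :
  (forall z, U z -> exists V, [/\ open V, V z & charge_null nu V]) -> charge_null nu U.
Proof.
move=> loc.
pose B (p : rat * nat) : set (circle R) := ball (circ (ratr p.1 : R)) p.2.+1%:R^-1.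
pose F k : set (circle_borel R) := if @choice.unpickle (rat * nat)%type k is Some p then
  (if `[< charge_null nu (B p) >] then B p else set0) else set0.
have n0 : charge_null nu set0.
  by move=> A _; rewrite subset0 => ->; exact: charge0.
have mF k : measurable (F k).
  rewrite /F; case: choice.unpickle => [p|]; last exact: measurable0.
  case: ifP => _; last exact: measurable0.
  by apply: open_circle_measurable; exact: metric_ball_open.
have nF k : charge_null nu (F k).
  by rewrite /F; case: choice.unpickle => [p|]//; case: ifP => // /asboolP.
have UF : U `<=` \bigcup_k F k.
  move=> z /loc[V [oV Vz nV]].
  move: oV; rewrite openE => /(_ z Vz)/nbhs_ballP[e /= e0 eV].
  pose n := Num.truncn (2 / e).
  have ne : n.+1%:R^-1 < e / 2.
    rewrite -[ltRHS]invrK ltf_pV2 ?posrE ?invr_gt0 ?divr_gt0// invf_div.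
    exact: truncnS_gt.
  have nn : 0 < n.+1%:R^-1 :> R by rewrite invr_gt0.
  have [r hr] := ratr_circ_dense z nn.
  pose k := @choice.pickle (rat * nat)%type (r, n); exists k; first exact: I.
  have kE : choice.unpickle k = Some (r, n) by exact: choice.pickleK.
  rewrite /F kE; case: asboolP; first by move=> _; rewrite /B ballEmdist.
  case=> A mA AB; apply: nV => //; apply: subset_trans AB _.
  apply: subset_trans eV => w; rewrite /B !ballEmdist /= => hw.
  apply: le_lt_trans (metric_triangle z (circ (ratr r : R)) w) _.
  apply: (@lt_le_trans _ _ (e / 2 + e / 2)); last by rewrite -splitr.
  by apply: ltrD; [rewrite metric_sym; exact: lt_trans hr ne|exact: lt_trans hw ne].
by move=> A mA AU; apply: (charge_null_bigcup mF nF mA); exact: subset_trans UF.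
Qed.

End ChargeNull.

Section JordanValues.
Context d (T : measurableType d) (R : realType) (nu : {charge set T -> \bar R}) (P N : set T).
Variable nuPN : hahn_decomposition nu P N.

Lemma jordan_pos_value A : measurable A -> jordan_pos nuPN A = nu (A `&` P).
Proof. by move=> mA; rewrite jordan_posE cjordan_posE /crestr0 mem_set. Qed.

Lemma jordan_neg_value A : measurable A -> jordan_neg nuPN A = (- nu (A `&` N))%E.
Proof. by move=> mA; rewrite jordan_negE cjordan_negE /crestr0 mem_set. Qed.

End JordanValues.

(** * Charges and complex measures carried by the limit set *)

Section ChargeKill.
Variables (R : realType) (q : R) (ch : chain q).
Hypothesis q2 : 2 < q.
Variables (nu : {charge set (circle_borel R) -> \bar R}) (M : R).
Local Notation K := (chain_set ch : set (circle_borel R)).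
Hypothesis nuK : charge_null nu (~` K).
Hypothesis cosM : forall s : seq int, uniq s ->
  \sum_(n <- s) `|charge_integral nu (down (fun t : R => cos (n%:~R * t)))| `^ q <= M.
Hypothesis sinM : forall s : seq int, uniq s ->
  \sum_(n <- s) `|charge_integral nu (down (fun t : R => sin (n%:~R * t)))| `^ q <= M.

Lemma dint_swap d (T : measurableType d) (mu1 mu2 : {finite_measure set T -> \bar R}) D f :
  dint mu1 mu2 D f = - dint mu2 mu1 D f.
Proof. by rewrite /dint opprB. Qed.

(** [singular_null] is applied to the Jordan parts twice, with the roles of the positive and the
    negative part exchanged. *)
Lemma charge_killed A : measurable A -> nu A = 0%E.
Proof.
move=> mA; pose nuPN := projT2 (cid (hahn_pair nu)).
move: (nuPN) (nuPN); set P := (projT1 (cid (hahn_pair nu))).1.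
set N := (projT1 (cid (hahn_pair nu))).2 => h [[mP _] [mN _] PN PN0].
pose m1 : {finite_measure set (circle_borel R) -> \bar R} := jordan_pos nuPN.
pose m2 : {finite_measure set (circle_borel R) -> \bar R} := jordan_neg nuPN.
have mKC := measurableC (chain_set_measurable ch).
have CP : ~` P = N.
  by apply/seteqP; split => z; [move=> nP; have [] : (P `|` N) z by rewrite PN|
    move=> Nz Pz; have : (P `&` N) z by []; rewrite PN0].
have CN : ~` N = P by rewrite -CP setCK.
have v1 B : measurable B -> m1 B = nu (B `&` P) := jordan_pos_value nuPN (A := B).
have v2 B : measurable B -> m2 B = (- nu (B `&` N))%E := jordan_neg_value nuPN (A := B).
have k1 : m1 (~` K) = 0%E.
  by rewrite v1//; apply: nuK; [exact: measurableI|exact: subIsetl].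
have k2 : m2 (~` K) = 0%E.
  by rewrite v2// (nuK (measurableI _ _ mKC mN)) ?oppe0//; exact: subIsetl.
have z1 : m1 (~` P) = 0%E by rewrite v1 ?CP// setIC PN0 charge0.
have z2 : m2 P = 0%E by rewrite v2// PN0 charge0 oppe0.
have e1 := singular_null q2 k1 k2 cosM sinM mP z1 z2.
have e2 : m2 setT = 0%E.
  apply: (@singular_null R q ch q2 m2 m1 M k2 k1 _ _ N mN); last 2 first.
  - by rewrite CN.
  - by rewrite -CP.
  - by move=> s us; under eq_bigr do rewrite dint_swap normrN; exact: cosM.
  - by move=> s us; under eq_bigr do rewrite dint_swap normrN; exact: sinM.
have null (m : {finite_measure set (circle_borel R) -> \bar R}) : m setT = 0%E -> m A = 0%E.
  move=> m0; apply/eqP; rewrite eq_le measure_ge0 andbT -m0.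
  by apply: le_measure; [exact: mem_set|exact: mem_set|exact: subsetT].
rewrite (charge_partition nu mA mP mN PN PN0) -v1// (null _ e1) add0e.
by rewrite -[LHS]oppeK -v2// (null _ e2) oppe0.
Qed.

End ChargeKill.

Section ComplexKill.
Variables (R : realType) (q : R) (ch : chain q).
Hypothesis q2 : 2 < q.
Variable mu : complex_measure R.
Hypothesis muK : measure_support mu `<=` chain_set ch.
Hypothesis muq : in_lq q (measure_fourier mu).
Local Open Scope complex_scope.
Local Notation K := (chain_set ch : set (circle_borel R)).
Local Notation cosn n := (down (fun t : R => cos (n%:~R * t)) : circle_borel R -> R).
Local Notation sinn n := (down (fun t : R => sin (n%:~R * t)) : circle_borel R -> R).
Implicit Types (n : int).

Lemma measure_null_charge (nu : {charge set (circle_borel R) -> \bar R}) :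
  (forall A, measurable A -> measure_value mu A = 0 -> nu A = 0%E) ->
  charge_null nu (~` K).
Proof.
move=> h; apply: charge_null_local => z Kz.
have [V [oV nV] Vz] : (\bigcup_(U in [set U : set (circle R) | open U /\ measure_null_on mu U]) U) z.
  by apply: contrapT => nz; apply: Kz; exact: muK.
by exists V; split => // A mA AV; apply: h => //; exact: nV.
Qed.

Lemma charge_fine0 (nu : {charge set (circle_borel R) -> \bar R}) A :
  measurable A -> fine (nu A) = 0 -> nu A = 0%E.
Proof.
by move=> mA h; rewrite -(@fineK _ (nu A)) ?h//; exact: fin_num_measure.
Qed.

Lemma Re_null : charge_null (measure_Re mu) (~` K).
Proof. by apply: measure_null_charge => A mA [h _]; exact: charge_fine0. Qed.

Lemma Im_null : charge_null (measure_Im mu) (~` K).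
Proof. by apply: measure_null_charge => A mA [_ h]; exact: charge_fine0. Qed.

Lemma fourier_bound : exists W : R, forall s : seq int, uniq s ->
  \sum_(n <- s) Normc.normc (measure_fourier mu n) `^ q <= W.
Proof.
move: muq; rewrite /in_lq; set E := esum _ _ => hE.
have E0 : (0 <= E)%E by apply: esum_ge0 => n _; rewrite lee_fin powR_ge0.
exists (fine E) => s us; rewrite -lee_fin fineK; last by rewrite ge0_fin_numE.
apply: esum_ge; exists [set` s]; first by split => //; exact: finite_seq.
by rewrite -fsbig_seq// sumEFin.
Qed.

Lemma charge_integral_sin (nu : {charge set (circle_borel R) -> \bar R}) n :
  charge_integral nu (fun z => - sin (n%:~R * repr z)) = - charge_integral nu (sinn n).
Proof.
pose nuPN := projT2 (cid (hahn_pair nu)).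
have := @dintZ _ _ _ (jordan_pos nuPN) (jordan_neg nuPN) setT (- 1) (sinn n) measurableT (@sinn_bm R n).
rewrite mulN1r /charge_integral -/nuPN => <-; rewrite /dint.
by under [X in _ = X - _]eq_Rintegral do rewrite mulN1r;
   under [X in _ = _ - X]eq_Rintegral do rewrite mulN1r.
Qed.

Lemma fourierE n : measure_fourier mu n =
  (charge_integral (measure_Re mu) (cosn n) + charge_integral (measure_Im mu) (sinn n)) +i*
  (charge_integral (measure_Im mu) (cosn n) - charge_integral (measure_Re mu) (sinn n)).
Proof.
rewrite /measure_fourier /complex_integral /charge_integralC /=.
rewrite !charge_integral_sin; apply/eqP; rewrite eq_complex /=.
by apply/andP; split; apply/eqP; rewrite /down; ring.
Qed.

Lemma cosnN n : cosn (- n) = cosn n.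
Proof. by apply/funext => z; rewrite /down intrN mulNr cosN. Qed.

Lemma charge_integral_sinN (nu : {charge set (circle_borel R) -> \bar R}) n :
  charge_integral nu (sinn (- n)) = - charge_integral nu (sinn n).
Proof.
rewrite -charge_integral_sin; congr charge_integral.
by apply/funext => z; rewrite /down intrN mulNr sinN.
Qed.

Lemma half_sum_bound (W : R) (x : int -> R) :
  (forall s : seq int, uniq s ->
    \sum_(n <- s) Normc.normc (measure_fourier mu n) `^ q <= W) ->
  (forall n, `|x n| <= Normc.normc (measure_fourier mu n) + Normc.normc (measure_fourier mu (- n))) ->
  forall s : seq int, uniq s -> \sum_(n <- s) `|x n| `^ q <= 2 `^ q * (W + W).
Proof.
move=> hW hx s us; have q2' := q2; have q1 : 1 < q by lra.
have q0 : 0 <= q by lra.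
pose c n := Normc.normc (measure_fourier mu n).
have c0 n : 0 <= c n by case: (measure_fourier mu n) @c => a b c; exact: sqrtr_ge0.
apply: (@le_trans _ _ (\sum_(n <- s) 2 `^ q * (c n `^ q + c (- n) `^ q))).
  apply: ler_sum => n _; have := powR_normD_le (c n) (c (- n)) q1.
  rewrite !(ger0_norm (c0 _)); apply: le_trans.
  by apply: ge0_ler_powR; rewrite ?nnegrE ?normr_ge0//; apply: le_trans (hx n) (ler_norm _).
rewrite -mulr_sumr ler_wpM2l ?powR_ge0// big_split; apply: lerD; first exact: hW.
have := hW [seq - n | n <- s]; rewrite big_map; apply.
by rewrite map_inj_uniq//; exact: oppr_inj.
Qed.

Lemma measure_zero : ~ measure_nonzero mu.
Proof.
move=> [A mA]; have [W hW] := fourier_bound.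
pose c n := Normc.normc (measure_fourier mu n).
(* The coefficient at [n] mixes the two charges. As the cosine integrals are even and the sine
   integrals odd in [n], the coefficients at [n] and [- n] together control all four. *)
have parts n :
  [/\ `|charge_integral (measure_Re mu) (cosn n)| <= c n + c (- n),
      `|charge_integral (measure_Re mu) (sinn n)| <= c n + c (- n),
      `|charge_integral (measure_Im mu) (cosn n)| <= c n + c (- n) &
      `|charge_integral (measure_Im mu) (sinn n)| <= c n + c (- n)].
  rewrite /c !fourierE cosnN !charge_integral_sinN opprK.
  move: (charge_integral (measure_Re mu) (cosn n)) (charge_integral (measure_Re mu) (sinn n)).
  move: (charge_integral (measure_Im mu) (cosn n)) (charge_integral (measure_Im mu) (sinn n)).
  move=> z y x w.
  have [h1 h2] := norm_le_normc (x + y) (z - w).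
  have [h3 h4] := norm_le_normc (x - y) (z + w).
  move: (Normc.normc (_ +i* (z - w))) (Normc.normc (_ +i* (z + w))) h1 h2 h3 h4 => a b.
  rewrite !ler_norml => /andP[? ?] /andP[? ?] /andP[? ?] /andP[? ?].
  by split; apply/andP; split; lra.
have eR : measure_Re mu A = 0%E.
  apply: (charge_killed q2 Re_null _ _ mA).
    by apply: (half_sum_bound hW) => n; have [] := parts n.
  by apply: (half_sum_bound hW) => n; have [] := parts n.
have eI : measure_Im mu A = 0%E.
  apply: (charge_killed q2 Im_null _ _ mA).
    by apply: (half_sum_bound hW) => n; have [] := parts n.
  by apply: (half_sum_bound hW) => n; have [] := parts n.
by rewrite /measure_value eR eI eqxx.
Qed.

End ComplexKill.

Theorem corollary4p1 (R : realType) (q : R) (hq : 2 < q) :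
  exists K : set (circle R),
    [/\ compact K,
        hausdorff_dim K = (2 / q)%:E,
        exists S : schwartz R,
          [/\ schwartz_nonzero S,
              schwartz_support S `<=` K
            & in_lq q (schwartz_fourier S)]
      & ~ exists mu : complex_measure R,
          [/\ measure_nonzero mu,
              measure_support mu `<=` K
            & in_lq q (measure_fourier mu)]].
Proof.
have [ch] := chain_exists hq; exists (chain_set ch); split.
- exact: chain_set_compact.
- exact: chain_set_dim.
- exists (chain_schwartz ch hq); split.
  + exact: chain_schwartz_nonzero.
  + exact: chain_schwartz_support.
  + exact: chain_schwartz_lq.
move=> [mu [mu0 muK muq]]; exact: (measure_zero hq muK muq mu0).
Qed.
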